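(* Consider the interacting system described in the context, with $N\ge1$ and $1/2<\gamma<1$. Then $$n^{\gamma-\frac12}\begin{pmatrix}\mathbf{Z}_n-Z_\infty\mathbf{1}\\ \mathbf{N}_n-Z_\infty\mathbf{1}\end{pmatrix}\longrightarrow \mathcal{N}\left(\mathbf{0},\; Z_\infty(1-Z_\infty)\begin{pmatrix}\widetilde\Sigma_\gamma&\widetilde\Sigma_\gamma\\ \widetilde\Sigma_\gamma&\widetilde\Sigma_\gamma+\widehat\Gamma_\gamma\end{pmatrix}\right)\quad\text{stably},$$ where $$\widetilde\Sigma_\gamma=\widetilde\sigma_\gamma^2\,\mathbf{1}\mathbf{1}^\top,\quad \widetilde\sigma_\gamma^2=\frac{c^2\|\mathbf{v}_1\|^2}{N(2\gamma-1)}>0,\qquad \widehat\Gamma_\gamma=\widehat\sigma_\gamma^2\,\mathbf{1}\mathbf{1}^\top,\quad \widehat\sigma_\gamma^2=\frac{c^2\|\mathbf{v}_1\|^2}{N(3-2\gamma)}>0.$$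
   Context: Model. Let $N\ge1$ and let $W=[w_{h,j}]_{1\le h,j\le N}$ be a real matrix with $w_{h,j}\ge 0$ and $\sum_{h=1}^N w_{h,j}=1$ for every $j$ (i.e. $W^\top\mathbf{1}=\mathbf{1}$). It is assumed that $W$ is irreducible and diagonalizable (over $\mathbb{C}$). Let $(r_n)_{n\ge0}$ be real numbers with $0\le r_n<1$ and $\lim_n n^\gamma r_n=c$ for constants $c>0$ and $\gamma$ (here $1/2<\gamma<1$). On a probability space $(\Omega,\mathcal{A},P)$ let $Z_{0,1},\dots,Z_{0,N}$ be $[0,1]$-valued random variables and let $X_{n,j}$ ($n\ge1$, $1\le j\le N$) be $\{0,1\}$-valued random variables; set $\mathcal{F}_n=\sigma(Z_{0,h}:1\le h\le N)\vee\sigma(X_{k,j}:1\le k\le n,\,1\le j\le N)$. For every $n\ge0$ the variables $X_{n+1,1},\dots,X_{n+1,N}$ are conditionally independent given $\mathcal{F}_n$ with $P(X_{n+1,j}=1\mid\mathcal{F}_n)=\sum_{h=1}^N w_{h,j}Z_{n,h}$, where $Z_{n,h}=(1-r_{n-1})Z_{n-1,h}+r_{n-1}X_{n,h}$ for $n\ge1$. Put $N_{0,j}=0$, $N_{n,j}=\frac1n\sum_{k=1}^nX_{k,j}$ for $n\ge1$, $\mathbf{Z}_n=(Z_{n,1},\dots,Z_{n,N})^\top$, $\mathbf{N}_n=(N_{n,1},\dots,N_{n,N})^\top$; $\mathbf{1}$ is the all-ones vector. Known: all the processes $(Z_{n,j})_n$, $1\le j\le N$, converge almost surely to one and the same $[0,1]$-valued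 random variable, denoted $Z_\infty$. The vector $\mathbf{v}_1$: by Perron–Frobenius, $1$ is a simple eigenvalue of $W$; $\mathbf{v}_1$ is the right eigenvector of $W$ (i.e. $W\mathbf{v}_1=\mathbf{v}_1$) normalized by $N^{-1/2}\mathbf{1}^\top\mathbf{v}_1=1$; it has strictly positive entries. $\|\cdot\|$ is the Euclidean norm. Stable convergence: a kernel $K$ on $\mathbb{R}^d$ is a family $\{K(\omega):\omega\in\Omega\}$ of Borel probability measures on $\mathbb{R}^d$ with $\omega\mapsto\int f\,dK(\omega)$ $\mathcal{A}$-measurable for each bounded Borel $f$. Random vectors $Y_n$ converge stably to $K$ if for every $H\in\mathcal{A}$ with $P(H)>0$ the conditional laws $P(Y_n\in\cdot\mid H)$ converge weakly to $E[K(\cdot)\mid H]$. For a random positive semidefinite matrix $\Sigma$, $\mathcal{N}(\mathbf{0},\Sigma)$ denotes the kernel $\omega\mapsto\mathcal{N}(\mathbf{0},\Sigma(\omega))$ (possibly degenerate Gaussian). *)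

(* Defs.v *)
From HB Require Import structures.
From mathcomp Require Import all_boot all_order all_algebra.
From mathcomp Require Import complex.
From mathcomp Require Import all_classical all_reals all_analysis.

Set Implicit Arguments.
Unset Strict Implicit.
Unset Printing Implicit Defensive.

Import Order.TTheory GRing.Theory Num.Theory.
Import numFieldNormedType.Exports.

Local Open Scope classical_set_scope.
Local Open Scope ring_scope.

Definition ones (R : realType) (N : nat) : 'cV[R]_N := const_mx 1.

(* The norm carried by 'cV[R]_N in the library is the sup norm. *)
Definition euclidean_norm (R : realType) (N : nat) (v : 'cV[R]_N) : R :=
  Num.sqrt (\sum_i v i 0 ^+ 2).

(* No simultaneous permutation of rows and columns brings W to a nontrivial
   block triangular form: the indices cannot be split into two nonempty parts
   A, ~: A with W vanishing on A * ~: A. *)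
Definition irreducible_mx (R : realType) (N : nat) (W : 'M[R]_N) : Prop :=
  forall A : {set 'I_N}, (exists i, i \in A) -> (exists j, j \notin A) ->
    exists i j, [/\ i \in A, j \notin A & W i j != 0].

Definition diagonalizable_over_C (R : realType) (N : nat) (W : 'M[R]_N) : Prop :=
  diagonalizable (map_mx (real_complex R) W).

(* F stands for a sub-sigma-algebra of the events. *)

Section conditioning.
Context (d : measure_display) (T : measurableType d) (R : realType).
Variables (P : probability T R) (F : set (set T)).

(* g is a version of P(A | F) *)
Definition cond_prob_version (A : set T) (g : T -> R) : Prop :=
  [/\ forall U : set R, measurable U -> F (g @^-1` U),
      P.-integrable [set: T] (EFin \o g) &
      forall B, F B -> (\int[P]_(w in B) (g w)%:E = P (A `&` B))%E].

Definition cond_independent (I : finType) (Y : I -> T -> R) : Prop :=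
  forall (U : I -> set R) (g : I -> T -> R),
    (forall i, measurable (U i)) ->
    (forall i, cond_prob_version (Y i @^-1` U i) (g i)) ->
    cond_prob_version (\bigcap_i (Y i @^-1` U i)) (fun w => \prod_i g i w).

End conditioning.

(* Weak and stable convergence on R^k, seen as 'cV[R]_k with its Borel sets *)

Definition borelV (R : realType) (k : nat) := g_sigma_algebraType (@open 'cV[R]_k).

Definition weak_cvg (R : realType) (k : nat)
    (mu_ : nat -> set (borelV R k) -> \bar R) (mu : set (borelV R k) -> \bar R) : Prop :=
  forall f : 'cV[R]_k -> R, continuous f -> (exists M : R, forall x, `|f x| <= M) ->
    (\int[mu_ n]_x (f x)%:E @[n --> \oo] --> \int[mu]_x (f x)%:E)%E.

Section stable.
Context (d : measure_display) (T : measurableType d) (R : realType) (k : nat).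
Variable P : probability T R.

(* B |-> P(Y \in B | H) *)
Definition cond_law (H : set T) (Y : T -> borelV R k) (B : set (borelV R k)) : \bar R :=
  ((fine (P H))^-1%:E * P (Y @^-1` B `&` H))%E.

(* B |-> E[K(B) | H] *)
Definition cond_mixture (H : set T) (K : R.-pker T ~> borelV R k)
    (B : set (borelV R k)) : \bar R :=
  ((fine (P H))^-1%:E * \int[P]_(w in H) K w B)%E.

Definition stable_cvg (Y : nat -> T -> borelV R k) (K : R.-pker T ~> borelV R k) : Prop :=
  (forall n, measurable_fun [set: T] (Y n)) /\
  forall H : set T, measurable H -> (0 < P H)%E ->
    weak_cvg (fun n => cond_law H (Y n)) (cond_mixture H K).

End stable.

(* N(m, v) on the line. The library's normal_prob takes the standard deviation
   and is not the Dirac mass when that is 0. *)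
Definition gauss1 (R : realType) (m v : R) (B : set R) : \bar R :=
  if v == 0 then \d_m B else normal_prob m (Num.sqrt v) B.

(* mu = N(m, S), for S symmetric positive semidefinite: every linear form
   x |-> u^T x has law N(u^T m, u^T S u) under mu. *)
Definition is_gaussian (R : realType) (k : nat) (mu : set (borelV R k) -> \bar R)
    (m : 'cV[R]_k) (S : 'M[R]_k) : Prop :=
  forall (u : 'cV[R]_k) (B : set R), measurable B ->
    mu [set x : 'cV[R]_k | B ((u^T *m x) 0 0)] =
    gauss1 ((u^T *m m) 0 0) ((u^T *m S *m u) 0 0) B.

Section system.
Context (d : measure_display) (T : measurableType d) (R : realType).
Variables (P : probability T R) (N : nat) (W : 'M[R]_N) (r : nat -> R).
(* X 0 is not used. *)
Variables (Z0 : 'I_N -> {RV P >-> R}) (X : nat -> 'I_N -> {RV P >-> R}).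

Fixpoint Zproc (n : nat) (h : 'I_N) (w : T) : R :=
  match n with
  | 0 => Z0 h w
  | m.+1 => (1 - r m) * Zproc m h w + r m * X m.+1 h w
  end.

Definition Zvec (n : nat) (w : T) : 'cV[R]_N := \col_h Zproc n h w.

Definition Nvec (n : nat) (w : T) : 'cV[R]_N :=
  \col_j (n%:R^-1 * \sum_(1 <= k < n.+1) X k j w).

Definition sysfilt (n : nat) : set (set T) :=
  <<s \bigcup_h preimage_set_system [set: T] (Z0 h) measurable `|`
      \bigcup_(k in [set k | (1 <= k <= n)%N]) \bigcup_j
        preimage_set_system [set: T] (X k j) measurable >>.

Record interacting_system : Prop := {
  W_ge0 : forall h j, 0 <= W h j ;
  W_col_sum : W^T *m ones R N = ones R N ;
  W_irreducible : irreducible_mx W ;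
  W_diagonalizable : diagonalizable_over_C W ;
  r_range : forall n, 0 <= r n < 1 ;
  Z0_range : forall h w, 0 <= Z0 h w <= 1 ;
  X_range : forall n j w, (1 <= n)%N -> X n j w = 0 \/ X n j w = 1 ;
  X_cond_independent : forall n,
    cond_independent P (sysfilt n) (fun j => X n.+1 j) ;
  X_cond_prob : forall n j,
    cond_prob_version P (sysfilt n) (X n.+1 j @^-1` [set 1])
      (fun w => \sum_h W h j * Zproc n h w)
}.

(* Z_infty: the common almost sure limit of the processes Z_{n,j} *)
Definition is_Zlimit (Zinf : {RV P >-> R}) : Prop :=
  (forall w, 0 <= Zinf w <= 1) /\
  \forall w \ae P, forall j, Zproc n j w @[n --> \oo] --> Zinf w.

End system.

(* Main.v *)
Require Import Defs.
From HB Require Import structures.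
From mathcomp Require Import all_boot all_order all_algebra.
From mathcomp Require Import all_classical all_reals all_analysis.
From mathcomp Require Import measurable_realfun.
From mathcomp Require Import ring lra.

Set Implicit Arguments.
Unset Strict Implicit.
Unset Printing Implicit Defensive.

Import Order.TTheory GRing.Theory Num.Theory.
Import numFieldNormedType.Exports.

Local Open Scope classical_set_scope.
Local Open Scope ring_scope.

(** Write p = v1 / sqrt N for the stationary probability vector of W and
    M_n = sum_j p_j Z_{n,j}. Then M_{n+1} = M_n + r_n xi_n, where xi_n is the
    p-weighted mean of the centred noises X_{n+1,j} - P(X_{n+1,j} = 1 | F_n), so
    that M is a martingale. By a Poincare inequality, which rests on the
    irreducibility of W, the expectation of sum_j p_j (Z_{n,j} - M_n)^2 contracts
    by a factor 1 - K r_n at each step, up to a noise term of order r_n^2; hence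
    it is O(n^-gamma). At the scale n^(gamma - 1/2) one may therefore replace
    every Z_{n,j} by M_n and, after a summation by parts, every N_{n,j} by
    M_n - n^-1 sum_{l < n} (l + 1) r_l xi_l. Now M_n - Z_infty is minus the sum
    of the r_l xi_l with l >= n, so the two fluctuations are sums of martingale
    differences over disjoint ranges of indices, and their conditional variances
    n^(2 gamma - 1) sum_{l >= n} r_l^2 and
    n^(2 gamma - 3) sum_{l < n} (l + 1)^2 r_l^2, up to the common factor
    Z_infty (1 - Z_infty) |v1|^2 / N, tend to c^2 / (2 gamma - 1) and
    c^2 / (3 - 2 gamma).

    The stable central limit theorem for bounded martingale differences is
    proved by making the characters cos (S_n + th) almost constant in mean
    through the factor expR (conditional variance / 2); the resulting variables
    are asymptotically orthogonal to the past, hence mixing. Stable convergence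
    is deduced from that of the characters: on a box x and y are continuous
    functions of the sines of multiples of x and y, in which a continuous test
    function is uniformly approximated by Bernstein polynomials, and second
    moments control the mass outside the box. *)

(** * Spectral gap of the interaction matrix *)

(** The exponents decide what survives. Deviations from the mean, of size n^(-gamma/2), and averages
    of n centred noises, of size n^(-1/2), become n^((gamma - 1)/2) and n^(gamma - 1) at the scale
    n^(gamma - 1/2); both vanish since gamma < 1. So only M matters, and the limit in dimension 2N
    lives on the plane spanned by (1, 1) and (0, 1): everything reduces to a pair of real variables.

    The obstacle is that the limit variance involves Z_infty and that the conditioning event is
    arbitrary: neither is known at a finite time. The compensating exponential therefore carries the
    conditional variances, which are adapted, and the weight containing Z_infty enters only once
    mixing has been established.

    The series for M_n - Z_infty is infinite while the central limit theorem takes finite rows. It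
    is cut at time n^2, where the remainder, of order n^(1 - 2 gamma), is still negligible after
    scaling.

    A free phase th in every cosine replaces complex exponentials: th = 0 and th = -pi/2 give the
    real and imaginary parts. *)

Section stationary.
Context (R : realType) (N : nat) (W : 'M[R]_N) (p : 'I_N -> R).
Hypothesis W_ge0 : forall h j, 0 <= W h j.
Hypothesis W_sum : forall j, \sum_h W h j = 1.
Hypothesis W_irr : irreducible_mx W.
Hypothesis p_stat : forall h, \sum_j W h j * p j = p h.
Hypothesis p_sum : \sum_j p j = 1.

(** The triangle inequality gives >= for every h, and both sides have the same total over h because
    the columns of W sum to 1; hence every inequality is an equality. *)
Lemma abs_stationary h : \sum_j W h j * `|p j| = `|p h|.
Proof.
have le_h k : `|p k| <= \sum_j W k j * `|p j|.
  rewrite -{1}p_stat; apply: (le_trans (ler_norm_sum _ _ _)).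
  by apply: ler_sum => j _; rewrite normrM (ger0_norm (W_ge0 _ _)).
have eq_s : \sum_k (\sum_j W k j * `|p j| - `|p k|) = 0.
  rewrite sumrB exchange_big /=.
  under eq_bigr => j _ do rewrite -mulr_suml W_sum mul1r.
  by rewrite subrr.
apply/eqP; rewrite -subr_eq0; apply/eqP.
move: eq_s => /eqP; rewrite psumr_eq0; last by move=> k _; rewrite subr_ge0.
by move=> /allP/(_ h); rewrite mem_index_enum => /(_ isT)/eqP.
Qed.

(** The positive part q of p is again stationary, by [abs_stationary], and it is not identically
    zero since p sums to 1. If q k = 0 then q l = 0 whenever W k l is nonzero, so irreducibility
    forces the zero set of q to be empty. *)
Lemma stationary_gt0 h : 0 < p h.
Proof.
pose q j := (`|p j| + p j) / 2.
have q_ge0 j : 0 <= q j.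
  by rewrite /q divr_ge0// -lerBlDr sub0r -normrN ler_norm.
have q_stat k : \sum_j W k j * q j = q k.
  rewrite /q -abs_stationary -[X in _ = (_ + X) / 2]p_stat -big_split/= mulr_suml.
  by apply: eq_bigr => j _; rewrite -mulrDr mulrA.
have [i qi] : exists i, 0 < q i.
  apply: contrapT => nq.
  have q0 i : `|p i| + p i = 0.
    have /eqP : q i = 0.
      apply/le_anti/andP; split; rewrite ?q_ge0// leNgt; apply/negP => qi.
      by apply: nq; exists i.
    by rewrite mulf_eq0 invr_eq0 pnatr_eq0 orbF => /eqP.
  have : \sum_j p j <= 0.
    by apply: sumr_le0 => j _; rewrite -(q0 j) lerDr.
  by rewrite p_sum ler10.
have qpos : forall j, 0 < q j.
  move=> j; rewrite lt0r q_ge0 andbT; apply/negP => /eqP qj.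
  have [||k [l [ka la]]] := W_irr (A := [set k | q k == 0]%SET).
  - by exists j; rewrite inE qj.
  - by exists i; rewrite inE gt_eqF.
  - move: ka la; rewrite !inE => /eqP qk ql /eqP; apply.
    have /eqP := q_stat k; rewrite qk psumr_eq0; last first.
      by move=> m _; rewrite mulr_ge0.
    move=> /allP/(_ l); rewrite mem_index_enum => /(_ isT)/=.
    by rewrite mulf_eq0 (negbTE ql) orbF => /eqP.
have := qpos h; rewrite /q; have [//|ph0|->] := ltrgt0P (p h).
  by rewrite addNr mul0r ltxx.
by rewrite addr0 mul0r ltxx.
Qed.

Lemma stationary_ge0 h : 0 <= p h.
Proof. exact/ltW/stationary_gt0. Qed.

Definition wmean (z : 'I_N -> R) := \sum_j p j * z j.

Definition wvar (z : 'I_N -> R) := \sum_j p j * (z j - wmean z) ^+ 2.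

(** W is read as a Markov chain that jumps from j to h with probability [W h j]. This is its
    transition operator, and p is its stationary law. *)
Definition push (z : 'I_N -> R) j := \sum_h W h j * z h.

(** E[(z(X_1) - z(X_0))^2] for the stationary chain. *)
Definition dirichlet (z : 'I_N -> R) :=
  \sum_j \sum_h p j * W h j * (z h - z j) ^+ 2.

Lemma wmean_push z : wmean (push z) = wmean z.
Proof.
rewrite /wmean /push; under eq_bigr => j _ do rewrite mulr_sumr.
rewrite exchange_big/=; apply: eq_bigr => h _.
by rewrite -[in RHS]p_stat mulr_suml; apply: eq_bigr => j _; ring.
Qed.

Lemma weighted_sum_sqr (I : finType) (a z : I -> R) : (forall i, 0 <= a i) ->
  \sum_i a i = 1 -> (\sum_i a i * z i) ^+ 2 <= \sum_i a i * z i ^+ 2.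
Proof.
move=> a0 a1; set m := \sum_i a i * z i.
have : 0 <= \sum_i a i * (z i - m) ^+ 2.
  by apply: sumr_ge0 => i _; rewrite mulr_ge0// sqr_ge0.
suff -> : \sum_i a i * (z i - m) ^+ 2 = \sum_i a i * z i ^+ 2 - m ^+ 2.
  by rewrite subr_ge0.
transitivity (\sum_i (a i * z i ^+ 2 - 2 * m * (a i * z i) + m ^+ 2 * a i)).
  by apply: eq_bigr => i _; ring.
by rewrite big_split/= sumrB -!mulr_sumr a1 -/m; ring.
Qed.

(** Jensen's inequality in each column of W, after which stationarity turns the p-average of the
    columns back into p. *)
Lemma wvar_push z : wvar (push z) <= wvar z.
Proof.
rewrite /wvar wmean_push.
have -> : \sum_j p j * (z j - wmean z) ^+ 2 =
    \sum_j \sum_h p j * (W h j * (z h - wmean z) ^+ 2).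
  rewrite exchange_big/=; apply: eq_bigr => h _.
  by rewrite -[in LHS]p_stat mulr_suml; apply: eq_bigr => j _; ring.
apply: ler_sum => j _; rewrite -mulr_sumr ler_pM2l ?stationary_gt0//.
have -> : push z j - wmean z = \sum_h W h j * (z h - wmean z).
  under eq_bigr => h _ do rewrite mulrBr.
  by rewrite sumrB -mulr_suml W_sum mul1r.
exact: weighted_sum_sqr.
Qed.

Let dirichlet_term_ge0 z j h : 0 <= p j * W h j * (z h - z j) ^+ 2.
Proof. by rewrite mulr_ge0 ?sqr_ge0// mulr_ge0// stationary_ge0. Qed.

Lemma dirichlet_ge0 z : 0 <= dirichlet z.
Proof.
by apply: sumr_ge0 => j _; apply: sumr_ge0.
Qed.

(** The indices comparable with i form a set that contains i and cannot be left along a nonzero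
    entry of W; irreducibility makes it everything, with no explicit path. *)
Lemma pairwise_dirichlet i j :
  exists2 K, 0 <= K & forall z, (z i - z j) ^+ 2 <= K * dirichlet z.
Proof.
pose S := [set k | `[< exists2 K, 0 <= K &
  forall z, (z i - z k) ^+ 2 <= K * dirichlet z >]]%SET.
suff : j \in S by rewrite inE => /asboolP.
apply/negPn/negP => jS.
have iS : i \in S.
  rewrite inE; apply/asboolP; exists 0 => // z.
  by rewrite subrr expr0n/= mul0r.
have [||h [k []]] := W_irr (A := S); [by exists i|by exists j|].
rewrite inE => /asboolP[K K0 hK] /negP nk Whk; apply: nk; rewrite inE; apply/asboolP.
have a0 : 0 < p k * W h k by rewrite mulr_gt0 ?stationary_gt0// lt0r Whk W_ge0.
(* One more edge is added to the comparison: (x + y)^2 <= 2 x^2 + 2 y^2, and the edge from k to h is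
   a single term of the Dirichlet form. *)
exists (2 * K + 2 / (p k * W h k)); first by rewrite addr_ge0 ?mulr_ge0 ?invr_ge0 ?(ltW a0).
move=> z.
have hk : (z h - z k) ^+ 2 <= (p k * W h k)^-1 * dirichlet z.
  rewrite mulrC ler_pdivlMr// mulrC /dirichlet (bigD1 k)//= (bigD1 h)//=.
  rewrite -addrA lerDl addr_ge0//.
    by apply: sumr_ge0.
  by apply: sumr_ge0 => m _; apply: sumr_ge0.
have -> : z i - z k = (z i - z h) + (z h - z k) by ring.
apply: (@le_trans _ _ (2 * (z i - z h) ^+ 2 + 2 * (z h - z k) ^+ 2)).
  by have := sqr_ge0 ((z i - z h) - (z h - z k)); nra.
by rewrite [leRHS]mulrDl -!mulrA lerD// ler_pM2l.
Qed.

(* The strict positivity of the Dirichlet form off the constants is where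
   irreducibility enters. *)
Lemma poincare : exists2 K, 0 < K & forall z, wvar z <= K * dirichlet z.
Proof.
have /all_sig2[K K0 hK] (ij : 'I_N * 'I_N) :
    {K : R | 0 <= K & forall z, (z ij.1 - z ij.2) ^+ 2 <= K * dirichlet z}.
  have H := pairwise_dirichlet ij.1 ij.2.
  exact/cid2.
exists (1 + \sum_ij K ij).
  by rewrite ltr_wpDr// sumr_ge0.
move=> z; apply: (@le_trans _ _ (\sum_i p i * ((1 + \sum_ij K ij) * dirichlet z))); last first.
  by rewrite -mulr_suml p_sum mul1r.
apply: ler_sum => i _; rewrite ler_pM2l ?stationary_gt0//.
have -> : z i - wmean z = \sum_j p j * (z i - z j).
  under eq_bigr => j _ do rewrite mulrBr.
  by rewrite sumrB -mulr_suml p_sum mul1r.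
apply: le_trans (weighted_sum_sqr _ _ _) _ => //.
  by move=> j; exact: stationary_ge0.
rewrite -[leRHS]mul1r -[X in X * _]p_sum mulr_suml.
apply: ler_sum => j _; rewrite ler_pM2l ?stationary_gt0//.
apply: (le_trans (hK (i, j) z)); rewrite ler_wpM2r ?dirichlet_ge0//.
rewrite (bigD1 (i, j))//= addrCA lerDl addr_ge0// sumr_ge0//.
Qed.

(** The gain comes from the cross term between z and [push z], where the Dirichlet form appears with
    coefficient r (1 - r) >= r / 2. The term in [push z] alone is only bounded by [wvar_push], so a
    periodic W does no harm. The rate is half the inverse Poincare constant. *)
Lemma wvar_contraction : exists2 K, 0 < K & forall z r, 0 <= r <= 2^-1 ->
  \sum_j p j * ((1 - r) * z j + r * push z j - wmean z) ^+ 2 <= (1 - K * r) * wvar z.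
Proof.
have [K K0 hK] := poincare; exists (K^-1 / 2); first by rewrite divr_gt0// invr_gt0.
move=> z r /andP[r0 r2].
set m := wmean z.
pose a := \sum_j p j * ((z j - m) * (push z j - m)).
have split_sum : \sum_j p j * ((1 - r) * z j + r * push z j - m) ^+ 2 =
    (1 - r) ^+ 2 * wvar z + 2 * r * (1 - r) * a + r ^+ 2 * wvar (push z).
  rewrite /wvar wmean_push -/m /a !mulr_sumr -!big_split/=.
  by apply: eq_bigr => j _; ring.
(* In the expansion of (z h - z j)^2 around m, one square averages to [wvar z] by stationarity, the
   other by the column sums of W. *)
have a_dir : 2 * a = 2 * wvar z - dirichlet z.
  have -> : dirichlet z = \sum_j \sum_h (p j * W h j * (z h - m) ^+ 2
      + p j * (W h j * (z j - m) ^+ 2) - 2 * (p j * ((z j - m) * (W h j * (z h - m))))).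
    by apply: eq_bigr => j _; apply: eq_bigr => h _; ring.
  under eq_bigr => j _ do rewrite sumrB big_split/=.
  rewrite sumrB big_split/=.
  have -> : \sum_j \sum_h p j * W h j * (z h - m) ^+ 2 = wvar z.
    rewrite exchange_big/=; apply: eq_bigr => h _.
    by rewrite -mulr_suml -[in RHS]p_stat; congr (_ * _); apply: eq_bigr => j _; ring.
  have -> : \sum_j \sum_h p j * (W h j * (z j - m) ^+ 2) = wvar z.
    by apply: eq_bigr => j _; rewrite -mulr_sumr -mulr_suml W_sum mul1r.
  have -> : \sum_i \sum_h 2 * (p i * ((z i - m) * (W h i * (z h - m)))) = 2 * a.
    rewrite /a mulr_sumr; apply: eq_bigr => j _.
    rewrite -!mulr_sumr; do 3 congr (_ * _).
    under eq_bigr => h _ do rewrite mulrBr.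
    by rewrite sumrB -mulr_suml W_sum mul1r.
  by ring.
rewrite split_sum.
have v0 : 0 <= wvar z.
  by apply: sumr_ge0 => j _; rewrite mulr_ge0 ?sqr_ge0// stationary_ge0.
have := wvar_push z; have := hK z => dz vp.
have -> : 2 * r * (1 - r) * a = r * (1 - r) * (2 * a) by ring.
rewrite a_dir.
have : r ^+ 2 * wvar (push z) <= r ^+ 2 * wvar z by rewrite ler_wpM2l// sqr_ge0.
have {}dz : K^-1 * wvar z <= dirichlet z by rewrite mulrC ler_pdivrMr// mulrC.
have : r * (1 - r) * (K^-1 * wvar z) <= r * (1 - r) * dirichlet z.
  by rewrite ler_wpM2l// mulr_ge0//; lra.
have : r * 2^-1 * (K^-1 * wvar z) <= r * (1 - r) * (K^-1 * wvar z).
  rewrite ler_wpM2r//; last by rewrite ler_wpM2l//; lra.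
  by rewrite mulr_ge0// invr_ge0 ltW.
rewrite (_ : (1 - K^-1 / 2 * r) * wvar z = wvar z - r * 2^-1 * (K^-1 * wvar z)); last by ring.
nra.
Qed.

End stationary.

(** * Power sums and stochastic approximation recursions *)

Section power_asymptotics.
Context (R : realType).
Implicit Types (a q k e : R) (x : nat -> R).

Lemma powR_nat_cvg0 a : a < 0 -> n%:R `^ a @[n --> \oo] --> (0 : R).
Proof.
rewrite -oppr_gt0 -{2}[a]opprK; set b := - a => b0.
apply/cvgrPdist_lt => e e0.
have [k hk] : exists k : nat, e `^ (- b^-1) < k%:R.
  by exists (Num.bound (e `^ (- b^-1))); rewrite archi_boundP// powR_ge0.
exists k.+1 => // n /= kn.
have n0 : 0 < n%:R :> R by rewrite ltr0n (leq_trans _ kn).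
rewrite sub0r normrN ger0_norm ?powR_ge0//.
have -> : e = (e `^ (- b^-1)) `^ (- b).
  by rewrite -powRrM mulrNN mulVf ?gt_eqF// powRr1// ltW.
rewrite 2!(powRN _ b) ltf_pV2 ?posrE ?powR_gt0//.
rewrite gt0_ltr_powR ?nnegrE ?powR_ge0//.
by rewrite (lt_le_trans hk)// ler_nat ltnW.
Qed.

(** The derivative of x^a at 1, taken along the increments 1 / n. *)
Lemma powR_nat_increment a :
  (n.+1%:R `^ a - n%:R `^ a) * n%:R `^ (1 - a) @[n --> \oo] --> a.
Proof.
have d1 : derivable (@powR R ^~ a) 1 1.
  by apply: derivable_powR; rewrite in_itv/= andbT.
have d0 : h^-1 *: (((h *: 1 + 1) `^ a) - 1 `^ a) @[h --> (0 : R)^'] --> a.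
  have Da : 'D_1 (@powR R ^~ a) 1 = a.
    by rewrite -derive1E powR_derive1 ?powR1 ?mulr1// in_itv/= andbT.
  by rewrite -[X in _ --> X]Da; exact: d1.
have h0 : (forall n, (n.+1%:R : R)^-1 != 0) /\ (n.+1%:R : R)^-1 @[n --> \oo] --> 0.
  by split; [move=> n; rewrite invr_eq0 pnatr_eq0|exact: cvg_harmonic].
have := (cvgr_dnbhsP _ _ _).1 d0 _ h0.
move=> c; rewrite -cvg_shiftS/=; apply: cvg_trans c; apply: near_eq_cvg.
near=> n; rewrite powR1 invrK /GRing.scale/= mulr1.
have n0 : 0 < n.+1%:R :> R by rewrite ltr0n.
have -> : n.+2%:R = n.+1%:R * (n.+1%:R^-1 + 1) :> R.
  by rewrite mulrDr mulfV ?gt_eqF// mulr1 -natr1 addrC.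
rewrite powRM ?addr_ge0 ?invr_ge0 ?ler0n//.
have un : n.+1%:R `^ a * n.+1%:R `^ (1 - a) = n.+1%:R :> R.
  by rewrite -powRD ?subrKC ?powRr1 ?(ltW n0)// gt_eqF// implybT.
by rewrite -{1}un; ring.
Unshelve. all: end_near. Qed.

(** Up to a relative error, x n is k times the increment of n^a / a, and these increments telescope.
    The exponent a may have either sign: a > 0 serves the head sums and a < 0 the tail sums. *)
Lemma power_sum_approx a k x : a != 0 ->
  x n * n%:R `^ (1 - a) @[n --> \oo] --> k -> forall e, 0 < e ->
  \forall n0 \near \oo, forall n m, (n0 <= n <= m)%N ->
    `|\sum_(n <= l < m) x l - k * ((m%:R `^ a - n%:R `^ a) / a)|
      <= e * ((m%:R `^ a - n%:R `^ a) / a).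
Proof.
move=> a0 xk e e0.
pose D n : R := (n.+1%:R `^ a - n%:R `^ a) / a.
have D1 : D n * n%:R `^ (1 - a) @[n --> \oo] --> (1 : R).
  have -> : (fun n => D n * n%:R `^ (1 - a)) =
      (fun n => (n.+1%:R `^ a - n%:R `^ a) * n%:R `^ (1 - a) * a^-1).
    by apply/funext => n; rewrite /D mulrAC.
  rewrite -[X in _ --> X](mulfV a0); apply: cvgM; last exact: cvg_cst.
  exact: powR_nat_increment.
have xD : (x n * n%:R `^ (1 - a) - k * (D n * n%:R `^ (1 - a))) @[n --> \oo] --> (0 : R).
  rewrite [X in _ --> X](_ : _ = k - k * 1); last by rewrite mulr1 subrr.
  by apply: cvgB => //; apply: cvgM => //; exact: cvg_cst.
have [N0 _ HN] : \forall n \near \oo, `|x n - k * D n| <= e * D n.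
  near=> n.
  have n0 : 0 < n%:R `^ (1 - a) :> R.
    by rewrite powR_gt0// ltr0n; near: n; exists 1%N.
  rewrite -(ler_pM2r n0) -{1}(gtr0_norm n0) -normrM mulrBl -[k * D n * _]mulrA -[e * D n * _]mulrA.
  have : `|0 - (x n * n%:R `^ (1 - a) - k * (D n * n%:R `^ (1 - a)))| <= e / 2.
    by near: n; move/cvgrPdist_le : xD; apply; rewrite divr_gt0.
  rewrite sub0r normrN => /le_trans; apply; rewrite ler_pM2l//.
  have : `|1 - D n * n%:R `^ (1 - a)| <= 2^-1.
    by near: n; move/cvgrPdist_le : D1; apply; rewrite invr_gt0.
  by rewrite ler_distlC => /andP[]; lra.
exists N0 => // n1 /= N1 n m /andP[n1n nm].
have tel : (m%:R `^ a - n%:R `^ a) / a = \sum_(n <= l < m) D l.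
  by rewrite -mulr_suml telescope_sumr.
rewrite tel mulr_sumr -sumrB mulr_sumr (le_trans (ler_norm_sum _ _ _))//.
rewrite big_seq [leRHS]big_seq; apply: ler_sum => l.
rewrite mem_index_iota => /andP[nl _]; apply: HN => /=.
by rewrite (leq_trans N1)// (leq_trans n1n).
Unshelve. all: end_near. Qed.

Lemma power_head_sum q k x : q < 1 -> x n * n%:R `^ q @[n --> \oo] --> k ->
  n%:R `^ (q - 1) * \sum_(0 <= l < n) x l @[n --> \oo] --> k / (1 - q).
Proof.
move=> q1 xk.
have b0 : 0 < 1 - q by rewrite subr_gt0.
have := @power_sum_approx (1 - q) k x; rewrite subKr gt_eqF// => /(_ isT xk) app.
apply/cvgrPdist_le => e e0.
have /app[N0 _ /(_ N0 (leqnn N0)) hN] : 0 < e * (1 - q) / 2 by rewrite divr_gt0// mulr_gt0.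
(* The terms before N0 contribute a fixed constant, which n^(q - 1) sends to 0. *)
pose C := `|\sum_(0 <= l < N0) x l - k * (N0%:R `^ (1 - q) / (1 - q))|.
have C0 : n%:R `^ (q - 1) * C @[n --> \oo] --> (0 : R).
  have q0 : q - 1 < 0 by rewrite subr_lt0.
  rewrite -[X in _ --> X](mul0r C); apply: cvgM; last exact: cvg_cst.
  exact: powR_nat_cvg0.
near=> n.
have n0 : 0 < n%:R :> R by rewrite ltr0n; near: n; exists 1%N.
have Nn : (N0 <= n)%N by near: n; exists N0.
have pn : n%:R `^ (q - 1) * n%:R `^ (1 - q) = 1 :> R.
  by rewrite -powRD ?subrKA ?subrr ?powRr0// (gt_eqF n0) implybT.
have -> : k / (1 - q) - n%:R `^ (q - 1) * \sum_(0 <= l < n) x l =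
  - (n%:R `^ (q - 1) * (\sum_(0 <= l < n) x l - k * (n%:R `^ (1 - q) / (1 - q)))).
  rewrite mulrBr [_ * (k * _)]mulrC -!mulrA [_^-1 * _]mulrC !mulrA.
  by rewrite -[k * _ * _]mulrA [_ `^ _ * _ `^ _]mulrC pn mulr1 opprB.
rewrite normrN normrM ger0_norm ?powR_ge0//.
have Hn := hN N0 n; rewrite leqnn Nn in Hn.
apply: (@le_trans _ _ (n%:R `^ (q - 1) * C + n%:R `^ (q - 1) *
    (e * (1 - q) / 2 * ((n%:R `^ (1 - q) - N0%:R `^ (1 - q)) / (1 - q))))).
  rewrite -mulrDr ler_wpM2l ?powR_ge0//.
  rewrite (big_cat_nat (n := N0))//=.
  set s0 := \sum_(0 <= l < N0) _; set s1 := \sum_(N0 <= l < n) _.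
  have -> : s0 + s1 - k * (n%:R `^ (1 - q) / (1 - q)) =
    (s0 - k * (N0%:R `^ (1 - q) / (1 - q)))
    + (s1 - k * ((n%:R `^ (1 - q) - N0%:R `^ (1 - q)) / (1 - q))) by ring.
  by rewrite (le_trans (ler_normD _ _))// lerD2l; exact: Hn.
rewrite [leRHS](splitr e) lerD//.
  have : `|0 - n%:R `^ (q - 1) * C| <= e / 2.
    by near: n; move/cvgrPdist_le : C0; apply; rewrite divr_gt0.
  by rewrite sub0r normrN; apply: le_trans; exact: ler_norm.
have -> : e * (1 - q) / 2 * ((n%:R `^ (1 - q) - N0%:R `^ (1 - q)) / (1 - q)) =
   e / 2 * (n%:R `^ (1 - q) - N0%:R `^ (1 - q)).
   by field; rewrite gt_eqF.
rewrite mulrCA -[leRHS]mulr1 ler_pM2l ?divr_gt0// mulrBr pn.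
by rewrite gerBl mulr_ge0 ?powR_ge0.
Unshelve. all: end_near. Qed.

(** The estimate is uniform in the upper end m and keeps the factor 1 - (n / m)^(q - 1): it serves
    both for m = n^2 and for bounds valid for every m. *)
Lemma power_tail_sum q k x : 1 < q -> x n * n%:R `^ q @[n --> \oo] --> k ->
  forall e, 0 < e -> \forall n0 \near \oo, forall n m, (n0 <= n <= m)%N ->
    `|n%:R `^ (q - 1) * \sum_(n <= l < m) x l
       - k / (q - 1) * (1 - (n%:R / m%:R) `^ (q - 1))| <= e.
Proof.
move=> q1 xk e e0.
have b0 : 0 < q - 1 by rewrite subr_gt0.
have := @power_sum_approx (1 - q) k x; rewrite subKr lt_eqF ?subr_lt0// => /(_ isT xk) app.
have /app : 0 < e * (q - 1) by rewrite mulr_gt0.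
move=> [N0 _ hN]; exists N0.+1 => //= n0 n0N n m /andP[n0n nm].
have n1 : 0 < n%:R :> R by rewrite ltr0n (leq_trans _ n0n)// (leq_trans _ n0N).
have m1 : 0 < m%:R :> R by rewrite (lt_le_trans n1)// ler_nat.
have {hN} := hN n0 (ltnW n0N) n m; rewrite n0n nm => /(_ isT).
have -> : (m%:R `^ (1 - q) - n%:R `^ (1 - q)) / (1 - q) =
    (n%:R `^ (1 - q) - m%:R `^ (1 - q)) / (q - 1).
  by field; rewrite (gt_eqF b0) lt_eqF ?subr_lt0.
have pn : n%:R `^ (q - 1) * (n%:R `^ (1 - q) - m%:R `^ (1 - q)) =
    1 - (n%:R / m%:R) `^ (q - 1).
  rewrite mulrBr -powRD ?subrKA ?subrr ?powRr0; last by rewrite (gt_eqF n1) implybT.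
  rewrite powRM ?invr_ge0 ?ltW//; congr (_ - _ * _).
  by rewrite -[m%:R^-1]powR_inv1 ?ltW// -powRrM mulN1r opprB.
rewrite -(@ler_pM2l _ (n%:R `^ (q - 1))) ?powR_gt0//.
rewrite -{1}[n%:R `^ (q - 1)]gtr0_norm ?powR_gt0// -normrM => H.
have -> : n%:R `^ (q - 1) * \sum_(n <= l < m) x l
    - k / (q - 1) * (1 - (n%:R / m%:R) `^ (q - 1)) =
   n%:R `^ (q - 1) * (\sum_(n <= l < m) x l - k * ((n%:R `^ (1 - q) - m%:R `^ (1 - q)) / (q - 1))).
  by rewrite -pn; ring.
apply: (le_trans H).
have -> : n%:R `^ (q - 1) * (e * (q - 1) * ((n%:R `^ (1 - q) - m%:R `^ (1 - q)) / (q - 1)))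
  = e * (n%:R `^ (q - 1) * (n%:R `^ (1 - q) - m%:R `^ (1 - q))).
  by field; rewrite gt_eqF.
by rewrite pn -[leRHS]mulr1 ler_pM2l// gerBl powR_ge0.
Qed.

End power_asymptotics.

(** K n^(-g) is a supersolution of the recursion: the drift is of order n^(-2 g), whereas n^(-g)
    loses at most n^(-g - 1) in one step, which is smaller since g < 1. *)
Lemma step_recursion_rate (R : realType) (g c d C : R) (r e : nat -> R) :
  0 < g < 1 -> 0 < c -> 0 < d -> 0 <= C ->
  n%:R `^ g * r n @[n --> \oo] --> c -> (forall n, 0 <= e n) ->
  (\forall n \near \oo, e n.+1 <= (1 - d * r n) * e n + C * r n ^+ 2) ->
  exists2 K, 0 <= K & \forall n \near \oo, e n <= K * n%:R `^ (- g).
Proof.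
move=> /andP[g0 g1] c0 d0 C0 rc e_ge0 rec.
pose u n : R := n%:R `^ (- g).
(* Eventually [r n] lies between c / 2 and 2 c times [u n]; these are the resulting constants. *)
pose d' := d * c / 2; pose C' := C * (2 * c) ^+ 2.
have d'0 : 0 < d' by rewrite !mulr_gt0.
have u_ge0 n : 0 <= u n by exact: powR_ge0.
have ng0 : - g < 0 by rewrite oppr_lt0.
have g10 : g - 1 < 0 by rewrite subr_lt0.
have [n0 _ Hn0] : \forall n \near \oo, (0 < n)%N /\
    e n.+1 <= (1 - d' * u n) * e n + C' * u n ^+ 2 /\ d' * u n <= 1 /\ (n%:R)^-1 <= d' / 2 * u n.
  near=> n.
  have n0 : (0 < n)%N by near: n; exists 1%N.
  have nr0 : 0 < n%:R :> R by rewrite ltr0n.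
  have un0 : 0 < u n by rewrite powR_gt0.
  have rnE : r n = u n * (n%:R `^ g * r n).
    by rewrite mulrA -powRD ?addNr ?powRr0 ?mul1r// (gt_eqF nr0) implybT.
  have : `|c - n%:R `^ g * r n| <= c / 2.
    by near: n; move/cvgrPdist_le : rc; apply; rewrite divr_gt0.
  rewrite ler_distlC => /andP[lo hi].
  split=> //; split.
    have rec_n : e n.+1 <= (1 - d * r n) * e n + C * r n ^+ 2 by near: n.
    apply: (le_trans rec_n); apply: lerD.
      rewrite ler_wpM2r// lerD2l lerN2 /d' rnE -!mulrA ler_pM2l//.
      by rewrite mulrC -mulrA mulrCA ler_pM2l//; lra.
    rewrite rnE exprMn /C' -mulrA ler_wpM2l// mulrC ler_wpM2r ?sqr_ge0//.
    by rewrite ler_sqr ?nnegrE; lra.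
  split.
    have : `|0 - u n| <= d'^-1.
      by near: n; move/cvgrPdist_le : (powR_nat_cvg0 ng0); apply; rewrite invr_gt0.
    by rewrite sub0r normrN gtr0_norm// -[leRHS]mul1r ler_pdivlMr// mulrC.
  have : `|0 - n%:R `^ (g - 1)| <= d' / 2.
    near: n.
    by move/cvgrPdist_le : (powR_nat_cvg0 g10); apply; rewrite divr_gt0.
  rewrite sub0r normrN ger0_norm ?powR_ge0// => H.
  have -> : n%:R^-1 = n%:R `^ (g - 1) * u n.
    rewrite /u -powRD; last by rewrite (gt_eqF nr0) implybT.
    by rewrite addrAC subrr sub0r powR_inv1// ltW.
  by rewrite ler_wpM2r// ltW.
(* The first term starts the induction at n0. The second makes C' <= K d' / 2: half of the drift
   absorbs the noise, the other half the loss in 1 / n. *)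
pose K := e n0 / u n0 + 2 * C' / d'.
have K0 : 0 <= K.
  by apply: addr_ge0; apply: divr_ge0; rewrite ?mulr_ge0// ltW.
exists K => //; exists n0 => // n /= /subnKC <-.
elim: (n - n0)%N => {n} [|k IH].
  rewrite addn0 -/(u n0) /K mulrDl divfK; last first.
    by rewrite gt_eqF// powR_gt0// ltr0n; have [] := Hn0 n0 (leqnn _).
  by rewrite lerDl mulr_ge0 ?powR_ge0// divr_ge0 ?mulr_ge0// ltW.
rewrite addnS; set n := (n0 + k)%N in IH *.
have [n_gt0 [rec_n [du1 inv_n]]] := Hn0 n (leq_addr _ _).
have nr0 : 0 < n%:R :> R by rewrite ltr0n.
have un0 : 0 < u n by rewrite powR_gt0.
apply: (le_trans rec_n).
(* (1 + 1/n)^g <= 1 + 1/n as g <= 1, and 1 / (1 + x) >= 1 - x. *)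
have next : u n * (1 - n%:R^-1) <= n.+1%:R `^ (- g).
  have -> : n.+1%:R = n%:R * (1 + n%:R^-1) :> R.
    by rewrite mulrDr mulfV ?gt_eqF// mulr1 natr1.
  rewrite powRM ?addr_ge0 ?invr_ge0// -/(u n) ler_pM2l//.
  have i0 : 0 < n%:R^-1 :> R by rewrite invr_gt0.
  rewrite powRN; apply: (@le_trans _ _ (1 + n%:R^-1)^-1).
    by rewrite -[leRHS]mul1r ler_pdivlMr ?addr_gt0//; nra.
  by rewrite lef_pV2 ?posrE ?powR_gt0 ?addr_gt0// ler1_powR ?lerDl// ltW.
apply: le_trans (ler_wpM2l K0 next).
have CK : C' <= K * (d' / 2).
  rewrite /K mulrDl -[leLHS]add0r lerD//.
    by rewrite mulr_ge0// divr_ge0// ?powR_ge0 ?ltW.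
  by rewrite [leRHS](_ : _ = C')//; field; rewrite gt_eqF.
have CK2 : C' * u n ^+ 2 <= K * (d' / 2) * u n ^+ 2 by rewrite ler_wpM2r// sqr_ge0.
have Kinv : K * u n * n%:R^-1 <= K * u n * (d' / 2 * u n).
  by rewrite ler_wpM2l// mulr_ge0// ltW.
have : (1 - d' * u n) * e n <= (1 - d' * u n) * (K * u n).
  by rewrite ler_wpM2l// subr_ge0.
lra.
Unshelve. all: end_near. Qed.

(** * Bounded random variables and conditional expectations *)

Section bmfun.
Context d (T : measurableType d) (R : realType).
Implicit Types f g : T -> R.

(** Boundedness at every point makes all integrals finite and the class stable under products. The
    measurable space is a parameter, so adaptedness to a filtration is the same predicate over
    [g_sigma_algebraType]. *)
Definition bmfun f :=
  measurable_fun [set: T] f /\ exists M, forall w, `|f w| <= M.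

Lemma bmfun_cst a : bmfun (fun=> a).
Proof. by split; [exact: measurable_cst|exists `|a|]. Qed.

Lemma bmfun_comp f (h : R -> R) : continuous h -> bmfun f ->
  bmfun (fun w => h (f w)).
Proof.
move=> ch [mf [M fM]]; split.
  by apply: measurableT_comp mf; exact: continuous_measurable_fun.
have : compact (h @` `[- M, M]).
  by apply: continuous_compact; [exact: continuous_subspaceT|exact: segment_compact].
move=> /compact_bounded [N [_ hN]]; exists (N + 1) => w.
apply: (hN (N + 1)); first by rewrite ltrDl.
exists (f w) => //=; rewrite in_itv/=.
by rewrite -ler_norml.
Qed.

Lemma bmfunD f g : bmfun f -> bmfun g ->
  bmfun (fun w => f w + g w).
Proof.
move=> [mf [M fM]] [mg [M' gM]]; split; first exact: measurable_funD.
by exists (M + M') => w; rewrite (le_trans (ler_normD _ _))// lerD.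
Qed.

Lemma bmfunM f g : bmfun f -> bmfun g ->
  bmfun (fun w => f w * g w).
Proof.
move=> [mf [M fM]] [mg [M' gM]]; split; first exact: measurable_funM.
by exists (M * M') => w; rewrite normrM ler_pM.
Qed.

Lemma bmfunZ a f : bmfun f -> bmfun (fun w => a * f w).
Proof. by apply: bmfunM; exact: bmfun_cst. Qed.

Lemma bmfunN f : bmfun f -> bmfun (fun w => - f w).
Proof.
move=> mf; rewrite (_ : (fun w => - f w) = (fun w => (-1) * f w)).
  exact: bmfunZ.
by apply/funext => w; rewrite mulN1r.
Qed.

Lemma bmfunB f g : bmfun f -> bmfun g ->
  bmfun (fun w => f w - g w).
Proof. by move=> mf mg; apply: bmfunD => //; exact: bmfunN. Qed.

Lemma bmfunX f n : bmfun f -> bmfun (fun w => f w ^+ n).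
Proof.
by move=> mf; apply: (@bmfun_comp f (fun x => x ^+ n)) mf; exact: exprn_continuous.
Qed.

Lemma bmfun_norm f : bmfun f -> bmfun (fun w => `|f w|).
Proof. exact: (@bmfun_comp f Num.norm (@norm_continuous _ _)). Qed.

Lemma bmfun_sum I (s : seq I) (Q : pred I) (F : I -> T -> R) :
  (forall i, bmfun (F i)) ->
  bmfun (fun w => \sum_(i <- s | Q i) F i w).
Proof.
move=> mF; rewrite -[X in bmfun X]fct_sumE.
elim/big_rec: _ => [|i f _ mf]; first exact: bmfun_cst.
exact: bmfunD.
Qed.

Lemma bmfun_indic (A : set T) : measurable A ->
  bmfun (\1_A : T -> R).
Proof.
move=> mA; split; first exact: measurable_indic.
by exists 1 => w; rewrite indicE ger0_norm ?ler0n// lern1 leq_b1.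
Qed.

End bmfun.

Ltac bmf := repeat first [assumption | exact: bmfun_cst | apply: bmfunB
  | apply: bmfunD | apply: bmfunN | apply: bmfunX | apply: bmfunM
  | apply: bmfun_norm].

Section expectation.
Context d (T : measurableType d) (R : realType) (P : probability T R).
Implicit Types f g : T -> R.
Local Notation E := (Rintegral P setT).

Lemma bmfun_integrable f : bmfun f ->
  P.-integrable [set: T] (EFin \o f).
Proof.
move=> [mf [M fM]]; apply: measurable_bounded_integrable => //.
  by rewrite [X in (X < _)%E]probability_setT ltry.
exists M; split; first by rewrite num_real.
by move=> y My w _; apply: (le_trans (fM w)); exact: ltW.
Qed.

Lemma expect_cst a : E (fun=> a) = a.
Proof. by rewrite Rintegral_cst// [X in fine X]probability_setT mulr1. Qed.

Lemma expectD f g : bmfun f -> bmfun g ->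
  E (fun w => f w + g w) = E f + E g.
Proof. by move=> mf mg; rewrite RintegralD//; exact: bmfun_integrable. Qed.

Lemma expectB f g : bmfun f -> bmfun g ->
  E (fun w => f w - g w) = E f - E g.
Proof. by move=> mf mg; rewrite RintegralB//; exact: bmfun_integrable. Qed.

Lemma expectZ a f : bmfun f -> E (fun w => a * f w) = a * E f.
Proof. by move=> mf; rewrite RintegralZl//; exact: bmfun_integrable. Qed.

Lemma expect_sum I (s : seq I) (Q : pred I) (F : I -> T -> R) :
  (forall i, bmfun (F i)) ->
  E (fun w => \sum_(i <- s | Q i) F i w) = \sum_(i <- s | Q i) E (F i).
Proof.
move=> mF; elim: s => [|i s IH].
  under eq_Rintegral do rewrite big_nil.
  by rewrite big_nil expect_cst.
rewrite big_cons; case: ifP => Qi; under eq_Rintegral do rewrite big_cons Qi.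
  by rewrite expectD ?IH//; exact: bmfun_sum.
exact: IH.
Qed.

Lemma expect_le f g : bmfun f -> bmfun g ->
  (forall w, f w <= g w) -> E f <= E g.
Proof.
by move=> mf mg fg; apply: le_Rintegral => //; exact: bmfun_integrable.
Qed.

Lemma expect_norm f : bmfun f -> `|E f| <= E (fun w => `|f w|).
Proof. by move=> mf; apply: le_normr_Rintegral => //; exact: bmfun_integrable. Qed.

Lemma expect_bound f M : bmfun f -> (forall w, `|f w| <= M) -> `|E f| <= M.
Proof.
move=> mf fM; rewrite (le_trans (expect_norm mf))// -[leRHS]expect_cst.
by apply: expect_le => //; [exact: bmfun_norm|exact: bmfun_cst].
Qed.

Lemma expect_sqr f : bmfun f -> E f ^+ 2 <= E (fun w => f w ^+ 2).
Proof.
move=> mf; set m := E f.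
have : 0 <= E (fun w => (f w - m) ^+ 2).
  by apply: Rintegral_ge0 => w _; exact: sqr_ge0.
have -> : E (fun w => (f w - m) ^+ 2) = E (fun w => f w ^+ 2 - 2 * m * f w + m ^+ 2).
  by apply: eq_Rintegral => w _; ring.
rewrite expectD ?expectB ?(expectZ (2 * m)) ?expect_cst -/m; try bmf.
by lra.
Qed.

Lemma expect_norm_sqrt f : bmfun f ->
  E (fun w => `|f w|) <= Num.sqrt (E (fun w => f w ^+ 2)).
Proof.
move=> mf; have mnf := bmfun_norm mf.
rewrite -[leLHS]ger0_norm ?Rintegral_ge0// -sqrtr_sqr ler_wsqrtr//.
apply: le_trans (expect_sqr mnf) _; rewrite le_eqVlt; apply/orP; left; apply/eqP.
by apply: eq_Rintegral => w _; rewrite real_normK ?num_real.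
Qed.

Lemma expect_cauchy_schwarz f g : bmfun f -> bmfun g ->
  (E (fun w => f w * g w)) ^+ 2 <= E (fun w => f w ^+ 2) * E (fun w => g w ^+ 2).
Proof.
move=> mf mg; set a := E (fun w => f w ^+ 2); set b := E (fun w => g w ^+ 2).
set c := E (fun w => f w * g w).
have key (t s : R) : 0 <= t ^+ 2 * a - 2 * t * s * c + s ^+ 2 * b.
  have : 0 <= E (fun w => (t * f w - s * g w) ^+ 2).
    by apply: Rintegral_ge0 => w _; exact: sqr_ge0.
  have -> : E (fun w => (t * f w - s * g w) ^+ 2) =
      E (fun w => t ^+ 2 * f w ^+ 2 - 2 * t * s * (f w * g w) + s ^+ 2 * g w ^+ 2).
    by apply: eq_Rintegral => w _; ring.
  by rewrite expectD ?expectB ?expectZ; try bmf.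
have a0 : 0 <= a by apply: Rintegral_ge0 => w _; exact: sqr_ge0.
have b0 : 0 <= b by apply: Rintegral_ge0 => w _; exact: sqr_ge0.
move: a0; rewrite le_eqVlt => /predU1P[a0|a_gt0].
  (* With a = 0 the form is affine in t; this choice of (t, s) yields -(b + 2) c^4 >= 0, hence c =
     0. *)
  rewrite -a0 mul0r; have := key ((b + 1) * c) (c ^+ 2); rewrite -a0 => H.
  have : c ^+ 2 * c ^+ 2 * (b + 2) <= 0 by lra.
  have b2 : 0 < b + 2 by lra.
  by rewrite pmulr_lle0// -expr2 exprn_even_le0//= expf_eq0/= => /eqP->; rewrite expr0n.
rewrite -subr_ge0 -(pmulr_rge0 _ a_gt0); have := key c a; lra.
Qed.

Lemma expect_dominated (F : nat -> T -> R) f M : (forall n, bmfun (F n)) ->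
  bmfun f -> (forall n w, `|F n w| <= M) ->
  (\forall w \ae P, F n w @[n --> \oo] --> f w) -> E (F n) @[n --> \oo] --> E f.
Proof.
move=> mF mf FM Ff.
have [] := @dominated_convergence _ T R P setT measurableT (fun n => EFin \o F n)
  (EFin \o f) (cst M%:E).
- by move=> n; apply/measurable_EFinP; case: (mF n).
- by apply/measurable_EFinP; case: mf.
- by apply: filterS Ff => w Fw _; apply/cvg_EFin; [exact: nearW|exact: Fw].
- exact: (bmfun_integrable (bmfun_cst T M)).
- by apply: aeW => w n _; rewrite lee_fin.
move=> _ _ c; apply/fine_cvg; rewrite fineK//.
by apply: integrable_fin_num => //; exact: bmfun_integrable.
Qed.

Lemma expect_indic (A : set T) : measurable A -> E \1_A = fine (P A).
Proof. by move=> mA; rewrite /Rintegral integral_indic// setIT. Qed.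

End expectation.

Lemma sum_indicator_floor (R : realType) (K : nat) (z : R) : 0 <= z < K%:R ->
  `|z - \sum_(i < K) (i.+1%:R <= z)%R%:R| <= 1.
Proof.
move=> /andP[z0 zK].
have -> : \sum_(i < K) (i.+1%:R <= z)%R%:R = (Num.truncn z)%:R :> R.
  have tK : (Num.truncn z <= K)%N.
    by rewrite -(ler_nat R) (le_trans _ (ltW zK))// truncn_le.
  transitivity (\sum_(i < K) (i < Num.truncn z)%N%:R : R).
    by apply: eq_bigr => i _; rewrite truncn_ge_nat.
  rewrite -(subnKC tK) big_split_ord/= addrC big1 ?add0r; last first.
    by move=> i _; rewrite ltnNge leq_addr.
  under eq_bigr => i _ do rewrite ltn_ord.
  by rewrite sumr_const card_ord.
have /andP[lo hi] := truncn_itv z0.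
by rewrite ger0_norm ?subr_ge0// lerBlDr addrC natr1 ltW.
Qed.

(** Rounding down on a grid of mesh e: the integer part of z is the sum of the indicators of z >= 1,
    ..., z >= K, so one coefficient serves for all level sets. This is how identities on events pass
    to bounded functions. *)
Lemma bmfun_simple_approx d (T : measurableType d) (R : realType) (g : T -> R) e :
  bmfun g -> 0 < e ->
  exists (K : nat) (a b : R) (B : 'I_K -> set T),
    (forall i, measurable (B i)) /\
    forall w, `|g w - (a + b * \sum_i \1_(B i) w)| <= e.
Proof.
move=> [mg [M gM]] e0.
pose K := (Num.truncn ((M + M) / e)).+1.
pose z w := (g w + M) / e.
have zK w : 0 <= z w < K%:R.
  have := gM w; rewrite ler_norml => /andP[lo hi]; apply/andP; split.
    by apply: divr_ge0; lra.
  rewrite (@le_lt_trans _ _ ((M + M) / e))// ?truncnS_gt// ler_pM2r ?invr_gt0//.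
  by rewrite lerD2r.
exists K, (- M), e, (fun i => [set w | i.+1%:R <= z w]); split.
  move=> i; rewrite -[X in measurable X]setTI.
  have mz : measurable_fun setT z.
    by apply: measurable_funM => //; apply: measurable_funD.
  rewrite (_ : [set w | i.+1%:R <= z w] = z @^-1` `[i.+1%:R, +oo[); first exact: mz.
  by apply/seteqP; split => w /=; rewrite in_itv/= andbT.
move=> w.
have -> : \sum_(i < K) \1_[set w | i.+1%:R <= z w] w = \sum_(i < K) (i.+1%:R <= z w)%R%:R :> R.
  by apply: eq_bigr => i _; rewrite indicE; congr (nat_of_bool _)%:R; apply/idP/idP; rewrite inE.
have := sum_indicator_floor (zK w).
rewrite -(ler_pM2l e0) mulr1 -{1}(gtr0_norm e0) -normrM; congr (`|_| <= _).
by rewrite mulrBr /z mulrC divfK ?gt_eqF//; ring.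
Qed.

Section conditional.
Context d (T : measurableType d) (R : realType) (P : probability T R).
Variable G : set (set T).
Hypothesis G_meas : <<s G >> `<=` measurable.
Local Notation E := (Rintegral P setT).
Local Notation Gfun := (fun f : T -> R => @bmfun _ (g_sigma_algebraType G) R f).
Implicit Types (f g p : T -> R).

Lemma bmfun_sub f : Gfun f -> @bmfun _ T R f.
Proof.
move=> [mf bf]; split=> // _ U mU; apply: G_meas.
exact: mf.
Qed.

(* Conditional expectations given the sigma-algebra generated by G, tested
   against bounded functions instead of events. *)
Definition cond_expect (Y p : T -> R) := [/\ bmfun Y, Gfun p &
  forall g, Gfun g -> E (fun w => g w * Y w) = E (fun w => g w * p w)].

Lemma cond_prob_version_expect A p : measurable A -> Gfun p ->
  cond_prob_version P <<s G >> A p -> cond_expect \1_A p.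
Proof.
move=> mA Gp [_ _ ver]; have mp := bmfun_sub Gp.
have mA1 := bmfun_indic R mA.
split=> // g Gg; have mg := bmfun_sub Gg.
have [Mp Mp0 hMp] : exists2 Mp, 0 < Mp & forall w, `|p w| <= Mp.
  case: mp => _ [M hM]; exists (`|M| + 1); first by rewrite ltr_pwDr.
  by move=> w; rewrite (le_trans (hM w))// (le_trans (ler_norm _))// lerDl.
apply/eqP; rewrite -subr_eq0 -normr_le0; apply/ler_addgt0Pr => e e0; rewrite add0r.
(* 1 + Mp bounds |1_A - p|, so a staircase at distance e / (1 + Mp) from g costs at most e. *)
have e'0 : 0 < e / (1 + Mp) by rewrite divr_gt0// addr_gt0.
have E0 (B : set T) : <<s G >> B -> E (fun w => \1_B w * (\1_A w - p w)) = 0.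
  move=> GB; have mB := G_meas GB; have mB1 := bmfun_indic R mB.
  have -> : E (fun w => \1_B w * (\1_A w - p w)) =
     E (fun w => \1_(A `&` B) w - p w * \1_B w).
    by apply: eq_Rintegral => w _; rewrite indicI/=; ring.
  rewrite expectB; [|exact/bmfun_indic/measurableI|by bmf].
  rewrite expect_indic; last exact: measurableI.
  have := ver _ GB; rewrite /Rintegral => <-.
  apply/eqP; rewrite subr_eq0; apply/eqP; congr fine.
  rewrite [LHS]integral_mkcond; apply: eq_integral => w _.
  by rewrite patchE indicE; case: ifPn => _; rewrite ?mulr1 ?mulr0.
have [K [a [b [B [mB gB]]]]] := bmfun_simple_approx Gg e'0.
have mB1 i : bmfun (\1_(B i) : T -> R).
  by apply: bmfun_indic; apply: G_meas; exact: mB.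
have mT1 := bmfun_indic R (@measurableT _ T).
pose s (w : T) : R := a + b * \sum_i \1_(B i) w.
have ms : bmfun s by bmf; exact: bmfun_sum.
have Es : E (fun w => s w * (\1_A w - p w)) = 0.
  have -> : E (fun w => s w * (\1_A w - p w)) = E (fun w => a * (\1_setT w * (\1_A w - p w))
      + \sum_i b * (\1_(B i) w * (\1_A w - p w))).
    apply: eq_Rintegral => w _; rewrite -mulr_sumr -mulr_suml /s indicT/=; ring.
  rewrite expectD; [|by bmf|by apply: bmfun_sum => i; bmf].
  rewrite expectZ; last by bmf.
  rewrite expect_sum; last by move=> i; bmf.
  rewrite big1 => [|i _]; last by rewrite expectZ ?E0 ?mulr0//; [exact: mB|bmf].
  by rewrite E0 ?mulr0 ?addr0//; exact: (@measurableT _ (g_sigma_algebraType G)).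
have -> : E (fun w => g w * \1_A w) - E (fun w => g w * p w) =
    E (fun w => (g w - s w) * (\1_A w - p w)).
  rewrite -[RHS]addr0 -Es -expectD; [|by bmf..].
  by rewrite -expectB; [|by bmf..]; apply: eq_Rintegral => w _; ring.
apply: expect_bound => [|w]; first by bmf.
have -> : e = e / (1 + Mp) * (1 + Mp) by rewrite divfK// gt_eqF// addr_gt0.
rewrite normrM ler_pM//.
rewrite (le_trans (ler_normB _ _))// lerD//.
by rewrite indicE ger0_norm// lern1 leq_b1.
Qed.

End conditional.

(* The mean of j terms phi n, taken far enough apart, has norm O(j^(-1/2)) by
   almost orthogonality, so psi cannot correlate with all of them. *)
Lemma renyi_mixing d (T : measurableType d) (R : realType) (P : probability T R)
    (phi : nat -> T -> R) (psi : T -> R) (M : R) :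
  (forall n, bmfun (phi n)) -> (forall n w, `|phi n w| <= M) ->
  bmfun psi ->
  (forall m, \int[P]_w (phi m w * phi n w) @[n --> \oo] --> (0 : R)) ->
  \int[P]_w (psi w * phi n w) @[n --> \oo] --> (0 : R).
Proof.
move=> mphi phiM mpsi mix; apply: contrapT => nc.
have [e e0 He] : exists2 e, 0 < e &
    forall N, exists2 n, (N <= n)%N & e <= `|\int[P]_w (psi w * phi n w)|.
  apply: contrapT => ne; apply: nc; apply/cvgrPdist_lt => e e0.
  apply: contrapT => nN; apply: ne; exists e => // N.
  apply: contrapT => nn; apply: nN; exists N => // n /= Nn.
  rewrite sub0r normrN ltNge; apply/negP => le; apply: nn; by exists n.
(* g is a signed sum of j terms of phi. Each new index is taken so late that its correlation with g
   is at most 1/2; twice that is the +1 in the second moment bound. The sign makes every term add at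
   least e to the correlation with psi. *)
have build j : exists g, [/\ bmfun g,
    \int[P]_w (g w * phi n w) @[n --> \oo] --> (0 : R),
    \int[P]_w (g w ^+ 2) <= j%:R * (M ^+ 2 + 1) &
    j%:R * e <= \int[P]_w (psi w * g w)].
  elim: j => [|j [g [mg gphi g2 psig]]].
    exists (fun=> 0); split; first exact: bmfun_cst.
    - rewrite (_ : (fun n => _) = fun=> 0); first exact: cvg_cst.
      apply/funext => n; rewrite (_ : (fun w => _) = fun=> 0) ?expect_cst//.
      by apply/funext => w; rewrite mul0r.
    - rewrite mul0r (_ : (fun w => _) = fun=> 0) ?expect_cst//.
      by apply/funext => w; rewrite expr0n.
    - rewrite mul0r (_ : (fun w => _) = fun=> 0) ?expect_cst//.
      by apply/funext => w; rewrite mulr0.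
  have [N _ HN] : \forall n \near \oo, `|\int[P]_w (g w * phi n w)| <= 2^-1.
    move/cvgrPdist_le : gphi => /(_ 2^-1); rewrite invr_gt0 => /(_ (ltr0n _ 2)).
    by apply: filterS => n; rewrite sub0r normrN.
  have [n Nn en] := He N; have {}HN := HN _ Nn.
  pose s : R := Num.sg (\int[P]_w (psi w * phi n w)).
  have s2 : `|s| <= 1 by rewrite normr_sg lern1 leq_b1.
  exists (fun w => g w + s * phi n w); split.
  - by bmf.
  - have -> : (fun m => \int[P]_w ((g w + s * phi n w) * phi m w)) =
      (fun m => \int[P]_w (g w * phi m w) + s * \int[P]_w (phi n w * phi m w)).
      apply/funext => m; have mphim := mphi m.
      rewrite -expectZ -?expectD; [|by bmf..].
      by apply: eq_Rintegral => w _; ring.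
    rewrite -[X in _ --> X]addr0 -[X in _ --> _ + X](mulr0 s).
    by apply: cvgD => //; apply: cvgM; [exact: cvg_cst|exact: mix].
  - have -> : \int[P]_w ((g w + s * phi n w) ^+ 2) =
      \int[P]_w (g w ^+ 2) + 2 * s * \int[P]_w (g w * phi n w)
      + s ^+ 2 * \int[P]_w (phi n w ^+ 2).
      rewrite -!expectZ -?expectD; [|by bmf..].
      by apply: eq_Rintegral => w _; ring.
    have phi2 : \int[P]_w (phi n w ^+ 2) <= M ^+ 2.
      apply: le_trans (ler_norm _) _; apply: expect_bound => [|w]; first by bmf.
      rewrite normrX lerXn2r ?nnegrE//.
      by rewrite (le_trans _ (phiM n w)).
    have phi0 : 0 <= \int[P]_w (phi n w ^+ 2).
      by apply: Rintegral_ge0 => w _; exact: sqr_ge0.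
    have s21 : s ^+ 2 <= 1 by rewrite -real_normK ?num_real// expr_le1.
    have s20 := sqr_ge0 s.
    have sg : s * \int[P]_w (g w * phi n w) <= 2^-1.
      apply: le_trans (ler_norm _) _; rewrite normrM -[leRHS]mul1r.
      by rewrite ler_pM.
    rewrite -natr1 mulrDl mul1r; move: g2 phi2 phi0 s21 s20 sg.
    move: (\int[P]_w (g w ^+ 2)) (\int[P]_w (phi n w ^+ 2)) (\int[P]_w (g w * phi n w)).
    by move=> x y z; nra.
  - have -> : \int[P]_w (psi w * (g w + s * phi n w)) =
      \int[P]_w (psi w * g w) + s * \int[P]_w (psi w * phi n w).
      rewrite -!expectZ -?expectD; [|by bmf..].
      by apply: eq_Rintegral => w _; ring.
    by rewrite -natr1 mulrDl mul1r lerD// /s -normrEsg.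
pose A := \int[P]_w (psi w ^+ 2).
have A0 : 0 <= A by apply: Rintegral_ge0 => w _; exact: sqr_ge0.
(* Cauchy-Schwarz gives j e^2 <= A (M^2 + 1), which this j violates. *)
pose j := (Num.truncn (A * (M ^+ 2 + 1) / e ^+ 2)).+1.
have [g [mg _ g2 psig]] := build j.
have := expect_cauchy_schwarz P mpsi mg; rewrite -/A => CS.
have : (j%:R * e) ^+ 2 <= A * (j%:R * (M ^+ 2 + 1)).
  apply: (@le_trans _ _ ((\int[P]_w (psi w * g w)) ^+ 2)).
    by rewrite lerXn2r ?nnegrE ?mulr_ge0 ?(ltW e0)//; apply: le_trans psig; rewrite mulr_ge0 ?(ltW e0).
  by apply: (le_trans CS); rewrite ler_wpM2l.
rewrite mulrCA (_ : (j%:R * e) ^+ 2 = j%:R * (j%:R * e ^+ 2)); last by ring.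
rewrite ler_pM2l// leNgt -ltr_pdivrMr ?exprn_gt0//.
by rewrite truncnS_gt.
Qed.

(** * A stable central limit theorem for martingale differences *)

Section taylor.
Context (R : realType).
Implicit Types x y : R.

(** One rung of a ladder: a power bound on the derivative gives the next power on the function. It
    is climbed from sin to 1 - cos, x - sin and the remainder of cos; the factorials are lost, which
    is harmless. *)
Lemma MVT_pow (f df : R -> R) (K : R) n x : (forall y, is_derive y 1 f (df y)) ->
  f 0 = 0 -> (forall y, `|y| <= `|x| -> `|df y| <= K * `|x| ^+ n) ->
  `|f x| <= K * `|x| ^+ n.+1.
Proof.
move=> fdf f0 dfK.
have cf : continuous f.
  by move=> y; apply: differentiable_continuous; apply/derivable1_diffP.
have [x0|x0|<-] := ltrgtP 0 x; last by rewrite f0 normr0 exprS mul0r mulr0.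
- have [c + ->] : exists2 c, c \in `]0, x[%R & f x = df c * x.
    have [|c cx] := @MVT _ f df _ _ x0 (fun y _ => fdf y).
      exact: continuous_subspaceT.
    by rewrite f0 !subr0 => fx; exists c.
  rewrite in_itv/= => /andP[c0 cx]; rewrite normrM exprSr mulrA ler_wpM2r//.
  by apply: dfK; rewrite !gtr0_norm// ltW.
- have [c + fx] : exists2 c, c \in `]x, 0[%R & f x = df c * x.
    have [|c cx] := @MVT _ f df _ _ x0 (fun y _ => fdf y).
      exact: continuous_subspaceT.
    by rewrite f0 !sub0r mulrN => /oppr_inj fx; exists c.
  rewrite in_itv/= => /andP[xc c0]; rewrite fx normrM exprSr mulrA ler_wpM2r//.
  apply: dfK; rewrite !ltr0_norm//; lra.
Qed.

Lemma normr_sin_le x : `|sin x| <= `|x|.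
Proof.
have := @MVT_pow sin cos 1 0 x; rewrite expr0 expr1 !mul1r; apply.
- exact: sin0.
- by move=> y _; rewrite ler_norml cos_geN1 cos_le1.
Qed.

Lemma norm_one_sub_cos_le x : `|1 - cos x| <= `|x| ^+ 2.
Proof.
have := @MVT_pow (fun y => 1 - cos y) sin 1 1 x; rewrite expr1 !mul1r; apply.
- move=> y; have H : is_derive y 1 (fun z : R => 1 - cos z) (0 - - sin y) by exact: is_deriveB.
  by rewrite sub0r opprK in H.
- by rewrite cos0 subrr.
- by move=> y yx; apply: le_trans yx; exact: normr_sin_le.
Qed.

Lemma norm_sin_sub_le x : `|x - sin x| <= `|x| ^+ 3.
Proof.
have := @MVT_pow (fun y => y - sin y) (fun y => 1 - cos y) 1 2 x; rewrite !mul1r; apply.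
- by rewrite sin0 subrr.
- move=> y yx; apply: (le_trans (norm_one_sub_cos_le y)).
  by rewrite lerXn2r ?nnegrE.
Qed.

Lemma norm_cos_taylor_le x : `|cos x - 1 + x ^+ 2 / 2| <= `|x| ^+ 4.
Proof.
have := @MVT_pow (fun y => cos y - 1 + y ^+ 2 / 2) (fun y => y - sin y) 1 3 x; rewrite !mul1r; apply.
- move=> y.
  have d1 : is_derive y 1 (fun y => cos y - 1) (- sin y - 0) by apply: is_deriveB.
  have d2 : is_derive y (1 : R) (fun y => y ^+ 2 / 2) y.
    have H := is_deriveZ 2^-1 (is_deriveX 2 (is_derive_id y (1 : R))).
    rewrite (_ : (fun z => z ^+ 2 / 2) = 2^-1 \*: ((id : R -> R) ^+ 2)); last first.
      by apply/funext => z; rewrite /GRing.scale/= mulrC.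
    by apply: is_derive_eq H _; rewrite /GRing.scale/= mulr1 expr1 mulrA mulVf ?mul1r.
  by apply: is_derive_eq (is_deriveD d1 d2) _; rewrite subr0 addrC.
- by rewrite cos0 subrr add0r expr0n/= mul0r.
- move=> y yx; apply: (le_trans (norm_sin_sub_le y)).
  by rewrite lerXn2r ?nnegrE.
Qed.

(** The upper bound goes through e^x <= 1 / (1 - x), which is 1 + y <= e^y at y = -x. *)
Lemma expR_taylor_le x : 0 <= x <= 2^-1 -> 0 <= expR x - 1 - x <= 2 * x ^+ 2.
Proof.
move=> /andP[x0 x2]; apply/andP; split; first by have := expR_ge1Dx x; lra.
have e0 : 0 < 1 - x by lra.
have h : expR x * (1 - x) <= 1.
  by rewrite -[leRHS](mulfV (lt0r_neq0 (expR_gt0 x))) -expRN ler_pM2l ?expR_gt0 ?expR_ge1Dx.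
have : expR x <= (1 - x)^-1 by rewrite -[leRHS]mul1r ler_pdivlMr.
have : (1 - x)^-1 <= 1 + x + 2 * x ^+ 2.
  by rewrite -[leLHS]mul1r ler_pdivrMr//; nra.
lra.
Qed.

(* Taking expectations with E[A | F] = 0 and E[A^2 | F] = 2 b, the first-order
   terms on the left vanish. *)
Lemma exp_cos_step (s b A th : R) : 0 <= s <= 1 -> `|A| <= s -> 0 <= b <= s ^+ 2 / 2 ->
  `|expR b * cos (th + A) - cos th - ((b - A ^+ 2 / 2) * cos th - A * sin th)| <= 5 * s ^+ 3.
Proof.
move=> /andP[s0 s1] As /andP[b0 bs].
have s2 : s ^+ 2 <= s by rewrite expr2; nra.
have b2 : b <= 2^-1 by lra.
have /andP[e0 e1] : 0 <= expR b - 1 - b <= 2 * b ^+ 2 by apply: expR_taylor_le; rewrite b0.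
have cA := norm_cos_taylor_le A; have sA := norm_sin_sub_le A.
have A3 : `|A| ^+ 3 <= s ^+ 3 by rewrite lerXn2r ?nnegrE.
have A4 : `|A| ^+ 4 <= s ^+ 4 by rewrite lerXn2r ?nnegrE.
have A2 : A ^+ 2 <= s ^+ 2 by rewrite -real_normK ?num_real// lerXn2r ?nnegrE.
have s30 : 0 <= s ^+ 3 by rewrite exprn_ge0.
have s4 : s ^+ 4 <= s ^+ 3 by rewrite [leLHS]exprS ler_piMl.
have b2s : b ^+ 2 <= s ^+ 3 / 4.
  have : b ^+ 2 <= (s ^+ 2 / 2) ^+ 2 by rewrite lerXn2r ?nnegrE//; lra.
  rewrite expr_div_n -exprM/= => /le_trans; apply; lra.
have bs3 : b * s <= s ^+ 3 / 2.
  have : b * s <= s ^+ 2 / 2 * s by rewrite ler_wpM2r.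
  by move=> /le_trans; apply; rewrite le_eqVlt; apply/orP; left; apply/eqP; ring.
(* By the addition formula the left side is cos th times this quantity minus sin th times that of
   [c2]; each takes half of 5 s^3. *)
have c1 : `|expR b * cos A - 1 - b + A ^+ 2 / 2| <= 5 / 2 * s ^+ 3.
  have -> : expR b * cos A - 1 - b + A ^+ 2 / 2 = (expR b - 1 - b) * cos A
     + (1 + b) * (cos A - 1 + A ^+ 2 / 2) - b * A ^+ 2 / 2 by field.
  have t1 : `|(expR b - 1 - b) * cos A| <= s ^+ 3 / 2.
    rewrite normrM (ger0_norm e0) (@le_trans _ _ (expR b - 1 - b))//.
      by rewrite ler_piMr// cos_max.
    lra.
  have t2 : `|(1 + b) * (cos A - 1 + A ^+ 2 / 2)| <= 3 / 2 * s ^+ 3.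
    have b1 : `|1 + b| <= 3 / 2 by rewrite ger0_norm; lra.
    by rewrite normrM ler_pM//; apply: (le_trans cA); apply: (le_trans A4).
  have t3 : `|b * A ^+ 2 / 2| <= s ^+ 3 / 4.
    have bA : 0 <= b * A ^+ 2 by apply: mulr_ge0 => //; exact: sqr_ge0.
    rewrite ger0_norm; last by apply: divr_ge0.
    have : b * A ^+ 2 <= s ^+ 2 / 2 * s ^+ 2 by rewrite ler_pM// sqr_ge0.
    have -> : s ^+ 2 / 2 * s ^+ 2 = s ^+ 4 / 2 by ring.
    lra.
  have := ler_normB ((expR b - 1 - b) * cos A + (1 + b) * (cos A - 1 + A ^+ 2 / 2)) (b * A ^+ 2 / 2).
  have := ler_normD ((expR b - 1 - b) * cos A) ((1 + b) * (cos A - 1 + A ^+ 2 / 2)).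
  lra.
have c2 : `|expR b * sin A - A| <= 5 / 2 * s ^+ 3.
  have -> : expR b * sin A - A = (expR b - 1) * sin A - (A - sin A) by ring.
  have eb : `|expR b - 1| <= 2 * b.
    rewrite ger0_norm; last by lra.
    have : 2 * b ^+ 2 <= b by nra.
    lra.
  have t1 : `|(expR b - 1) * sin A| <= s ^+ 3.
    rewrite normrM (@le_trans _ _ (2 * b * s))//; last by lra.
    by rewrite ler_pM// (le_trans (normr_sin_le _)).
  have := ler_normB ((expR b - 1) * sin A) (A - sin A).
  lra.
have -> : expR b * cos (th + A) - cos th - ((b - A ^+ 2 / 2) * cos th - A * sin th) =
    cos th * (expR b * cos A - 1 - b + A ^+ 2 / 2) - sin th * (expR b * sin A - A).
  by rewrite cosD; ring.
apply: (le_trans (ler_normB _ _)); rewrite !normrM.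
have -> : 5 * s ^+ 3 = 5 / 2 * s ^+ 3 + 5 / 2 * s ^+ 3 by field.
rewrite lerD// -[leRHS]mul1r ler_pM//.
- exact: cos_max.
- exact: sin_max.
Qed.

End taylor.

Lemma cvg_sumr (R : realType) (I : Type) (s : seq I) (F : nat -> I -> R) (l : I -> R) :
  (forall i, F n i @[n --> \oo] --> l i) ->
  \sum_(i <- s) F n i @[n --> \oo] --> \sum_(i <- s) l i.
Proof.
move=> Fl; elim: s => [|i s IH].
  rewrite big_nil (_ : (fun n => _) = fun=> 0); first exact: cvg_cst.
  by apply/funext => n; rewrite big_nil.
rewrite big_cons (_ : (fun n => _) = fun n => F n i + \sum_(j <- s) F n j).
  exact: cvgD.
by apply/funext => n; rewrite big_cons.
Qed.

Section martingale_clt.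
Context d (T : measurableType d) (R : realType) (P : probability T R).
Variable G : nat -> set (set T).
Hypothesis G_meas : forall n, <<s G n >> `<=` measurable.
Hypothesis G_mono : forall n, <<s G n >> `<=` <<s G n.+1 >>.
Variables (xi V : nat -> T -> R) (C : R).
Local Notation E := (Rintegral P setT).
Local Notation Gfun n := (fun f : T -> R => @bmfun _ (g_sigma_algebraType (G n)) R f).
Hypothesis C_ge0 : 0 <= C.
Hypothesis xi_bound : forall l w, `|xi l w| <= C.
Hypothesis V_bound : forall l w, 0 <= V l w <= C ^+ 2.
Hypothesis xi_adapted : forall l, Gfun l.+1 (xi l).
Hypothesis xi_mart : forall l, cond_expect P (G l) (xi l) (fun=> 0).
Hypothesis xi_var : forall l, cond_expect P (G l) (fun w => xi l w ^+ 2) (V l).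

Lemma filtration_le m n : (m <= n)%N -> <<s G m >> `<=` <<s G n >>.
Proof.
move=> /subnKC <-; elim: (n - m)%N => [|k IH]; first by rewrite addn0.
by rewrite addnS; apply: subset_trans (@G_mono _).
Qed.

Lemma adapted_le m n f : (m <= n)%N -> Gfun m f -> Gfun n f.
Proof.
move=> mn [mf bf]; split=> // _ U mU; apply: (filtration_le mn).
exact: mf.
Qed.

Lemma adapted_measurable n f : Gfun n f -> @bmfun _ T R f.
Proof. exact: bmfun_sub. Qed.

Section weights.
Variables (a : nat -> R) (th : R).

Definition wsum k w := \sum_(l < k) a l * xi l w.
Definition wvarsum k w := \sum_(l < k) a l ^+ 2 * V l w / 2.
(** The real part of exp (i (S_k + th) + B_k), where B_k is half the predictable variance. It would
    be a martingale for conditionally Gaussian increments, and is one here up to third-order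
    errors. *)
Definition exp_cos k w := expR (wvarsum k w) * cos (wsum k w + th).

Lemma wsum_adapted k : Gfun k (wsum k).
Proof.
apply: (@bmfun_sum _ (g_sigma_algebraType (G k))) => -[l lk].
by apply: bmfunZ; apply: adapted_le (xi_adapted _).
Qed.

Lemma wvarsum_adapted k : Gfun k (wvarsum k).
Proof.
apply: (@bmfun_sum _ (g_sigma_algebraType (G k))) => -[l lk] /=.
have [_ Vl _] := xi_var l.
apply: bmfunM; last exact: bmfun_cst.
by apply: bmfunZ; apply: adapted_le Vl; exact: ltnW.
Qed.

Lemma bmfun_cos d' (T' : measurableType d') (f : T' -> R) :
  bmfun f -> bmfun (fun w => cos (f w)).
Proof. by apply: bmfun_comp; exact: continuous_cos. Qed.

Lemma bmfun_sin d' (T' : measurableType d') (f : T' -> R) :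
  bmfun f -> bmfun (fun w => sin (f w)).
Proof. by apply: bmfun_comp; exact: continuous_sin. Qed.

Lemma bmfun_expR d' (T' : measurableType d') (f : T' -> R) :
  bmfun f -> bmfun (fun w => expR (f w)).
Proof. by apply: bmfun_comp; exact: continuous_expR. Qed.

Lemma exp_cos_adapted k : Gfun k (exp_cos k).
Proof.
apply: bmfunM.
  by apply: bmfun_expR; exact: wvarsum_adapted.
apply: bmfun_cos; apply: bmfunD; last exact: bmfun_cst.
exact: wsum_adapted.
Qed.

Lemma wvarsum_le m k w A : (k <= m)%N -> \sum_(l < m) a l ^+ 2 <= A ->
  wvarsum k w <= A * C ^+ 2 / 2.
Proof.
move=> km; rewrite -(subnKC km) big_split_ord/= => sA.
have {sA} sA : \sum_(l < k) a l ^+ 2 <= A.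
  by apply: le_trans sA; rewrite lerDl sumr_ge0// => i _; exact: sqr_ge0.
apply: (@le_trans _ _ ((\sum_(l < k) a l ^+ 2) * C ^+ 2 / 2)).
  rewrite !mulr_suml; apply: ler_sum => l _.
  by rewrite ler_pM2r ?invr_gt0// ler_wpM2l ?sqr_ge0//; case/andP: (V_bound l w).
by rewrite ler_pM2r ?invr_gt0// ler_wpM2r ?sqr_ge0.
Qed.

Lemma exp_cos_increment g k M b : Gfun k g -> (forall w, `|g w| <= M) ->
  (forall w, wvarsum k w <= b) -> `|a k| * C <= 1 ->
  `|E (fun w => g w * exp_cos k.+1 w) - E (fun w => g w * exp_cos k w)|
    <= M * expR b * (5 * (`|a k| * C) ^+ 3).
Proof.
move=> Gg gM wb ak1.
have [mxi _ mart] := xi_mart k.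
have [mxi2 GV var] := xi_var k.
have GW := wsum_adapted k; have GB := wvarsum_adapted k.
have GE := bmfun_expR GB.
have GS : Gfun k (fun w => wsum k w + th).
  by apply: bmfunD => //; exact: bmfun_cst.
have Gc := bmfun_cos GS; have Gs := bmfun_sin GS.
(* The part of the increment that [exp_cos_step] isolates. It integrates to 0 because all its
   factors other than xi k and its square are known at time k. *)
pose h w := g w * expR (wvarsum k w) * (((a k ^+ 2 * V k w / 2 - (a k * xi k w) ^+ 2 / 2) *
   cos (wsum k w + th)) - (a k * xi k w) * sin (wsum k w + th)).
have mg := adapted_measurable Gg; have mE := adapted_measurable GE.
have mc := adapted_measurable Gc; have ms := adapted_measurable Gs.
have mV := adapted_measurable GV.
have mexp1 := adapted_measurable (exp_cos_adapted k.+1).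
have Eh : E h = 0.
  pose g1 w := g w * expR (wvarsum k w) * cos (wsum k w + th) * (a k ^+ 2 / 2).
  pose g2 w := g w * expR (wvarsum k w) * sin (wsum k w + th) * a k.
  have Gg1 : Gfun k g1 by bmf.
  have Gg2 : Gfun k g2 by bmf.
  have -> : E h = E (fun w => (g1 w * V k w - g1 w * xi k w ^+ 2) - g2 w * xi k w).
    by apply: eq_Rintegral => w _; rewrite /h /g1 /g2; field.
  rewrite expectB; [|by bmf..]; rewrite expectB; [|by bmf..].
  rewrite -var// subrr sub0r mart//.
  rewrite (_ : (fun w => _) = fun=> 0) ?expect_cst ?oppr0//.
  by apply/funext => w; rewrite mulr0.
have -> : E (fun w => g w * exp_cos k.+1 w) - E (fun w => g w * exp_cos k w) =
   E (fun w => g w * (exp_cos k.+1 w - exp_cos k w) - h w).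
  rewrite expectB; [|by bmf..]; rewrite Eh subr0 -expectB; [|by bmf..].
  by apply: eq_Rintegral => w _; rewrite mulrBr.
apply: expect_bound => [|w]; first by bmf.
have -> : g w * (exp_cos k.+1 w - exp_cos k w) - h w =
   g w * expR (wvarsum k w) * (expR (a k ^+ 2 * V k w / 2) *
     cos ((wsum k w + th) + a k * xi k w) - cos (wsum k w + th) -
     ((a k ^+ 2 * V k w / 2 - (a k * xi k w) ^+ 2 / 2) *
   cos (wsum k w + th) - (a k * xi k w) * sin (wsum k w + th))).
  rewrite /exp_cos /wsum /wvarsum !big_ord_recr/= expRD -/(wsum k w) -/(wvarsum k w) /h.
  by rewrite (addrAC _ _ th); ring.
rewrite normrM; apply: ler_pM => //.
  by rewrite normrM ler_pM// ger0_norm ?expR_ge0// ler_expR.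
apply: exp_cos_step.
- by rewrite mulr_ge0.
- by rewrite normrM ler_wpM2l.
- have /andP[V0 V1] := V_bound k w.
  rewrite exprMn real_normK ?num_real//; apply/andP; split.
    by apply: divr_ge0 => //; apply: mulr_ge0 => //; exact: sqr_ge0.
  by rewrite ler_pM2r ?invr_gt0// ler_wpM2l ?sqr_ge0.
Qed.

(** The cubic errors sum to at most max |a| times the sum of a^2, so they vanish with the largest
    weight. *)
Lemma exp_cos_sum g k0 m M A al : Gfun k0 g -> (forall w, `|g w| <= M) ->
  (k0 <= m)%N -> 0 <= al -> \sum_(l < m) a l ^+ 2 <= A ->
  (forall l, (l < m)%N -> `|a l| <= al) -> al * C <= 1 ->
  `|E (fun w => g w * exp_cos m w) - E (fun w => g w * exp_cos k0 w)|
    <= M * expR (A * C ^+ 2 / 2) * (5 * C ^+ 3 * al * A).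
Proof.
move=> Gg gM km al0 sA a_al al1.
have M0 : 0 <= M by rewrite (le_trans _ (gM point)).
have -> : E (fun w => g w * exp_cos m w) - E (fun w => g w * exp_cos k0 w) =
  \sum_(k0 <= k < m) (E (fun w => g w * exp_cos k.+1 w) - E (fun w => g w * exp_cos k w)).
  by rewrite telescope_sumr.
apply: (le_trans (ler_norm_sum _ _ _)).
apply: (@le_trans _ _ (\sum_(k0 <= k < m)
    M * expR (A * C ^+ 2 / 2) * (5 * C ^+ 3 * al) * a k ^+ 2)).
  rewrite big_seq [leRHS]big_seq; apply: ler_sum => k.
  rewrite mem_index_iota => /andP[k0k klt].
  have ak := a_al _ klt.
  have akC : `|a k| * C <= 1 by apply: le_trans al1; rewrite ler_wpM2r.
  apply: le_trans (exp_cos_increment (adapted_le k0k Gg) gM _ akC) _.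
    by move=> w; apply: wvarsum_le sA; exact: ltnW.
  rewrite -[leRHS]mulrA ler_wpM2l//; first by rewrite mulr_ge0 ?expR_ge0.
  rewrite exprMn mulrCA [leRHS](_ : _ = 5 * (al * `|a k| ^+ 2 * C ^+ 3)); last first.
    by rewrite real_normK ?num_real//; ring.
  rewrite mulrCA ler_pM2l// ler_wpM2r ?exprn_ge0// exprS.
  by rewrite ler_wpM2r ?exprn_ge0.
rewrite -mulr_sumr !mulrA ler_wpM2l//.
  by rewrite !mulr_ge0// ?expR_ge0 ?exprn_ge0.
apply: le_trans sA; rewrite -(big_mkord xpredT (fun l => a l ^+ 2)).
rewrite [leRHS](big_cat_nat (n := k0))//= lerDr.
by apply: sumr_ge0 => i _; exact: sqr_ge0.
Qed.

End weights.

(** Neither [psi] nor the random limit variance [v] need be measurable at a finite time. They are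
    merged into one weight, which is introduced only once [phi n] is asymptotically orthogonal to
    every bounded variable. *)
Theorem martingale_clt (a : nat -> nat -> R) (m : nat -> nat) (al : nat -> R)
    (A th : R) (v psi : T -> R) :
  (forall n, 0 <= al n) -> al n @[n --> \oo] --> (0 : R) ->
  (forall n l, (l < m n)%N -> `|a n l| <= al n) ->
  (forall n, \sum_(l < m n) a n l ^+ 2 <= A) ->
  (forall k, \forall n \near \oo, (k <= m n)%N) ->
  bmfun v -> (forall w, 0 <= v w) ->
  (\forall w \ae P, \sum_(l < m n) a n l ^+ 2 * V l w @[n --> \oo] --> v w) ->
  bmfun psi ->
  E (fun w => psi w * cos (wsum (a n) (m n) w + th)) @[n --> \oo] -->
  E (fun w => psi w * expR (- (v w / 2))) * cos th.
Proof.
move=> al_ge0 al0 a_al sA m_oo mv v0 Vv mpsi.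
pose b := A * C ^+ 2 / 2.
pose phi n w := exp_cos (a n) th (m n) w - cos th.
have Gphi n : Gfun (m n) (phi n).
  by apply: bmfunB; [exact: exp_cos_adapted|exact: bmfun_cst].
have mphi n : bmfun (phi n) := adapted_measurable (Gphi n).
have expb n w : expR (wvarsum (a n) (m n) w) <= expR b.
  by rewrite ler_expR; exact: (wvarsum_le w (leqnn _) (sA n)).
have mW n : bmfun (wvarsum (a n) (m n)) := adapted_measurable (wvarsum_adapted (a n) (m n)).
have mS n : bmfun (wsum (a n) (m n)) := adapted_measurable (wsum_adapted (a n) (m n)).
have phiM n w : `|phi n w| <= expR b + 1.
  apply: (le_trans (ler_normB _ _)); rewrite lerD ?cos_max//.
  rewrite /exp_cos normrM ger0_norm ?expR_ge0// -[leRHS]mulr1.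
  by rewrite ler_pM ?expR_ge0// cos_max.
(* A variable known at a fixed time k decorrelates from [phi n]: each weight tends to 0, so
   [exp_cos] at time k tends to cos th, and from k to m n its mean moves by O(al n). *)
have step1 k g : Gfun k g -> E (fun w => g w * phi n w) @[n --> \oo] --> (0 : R).
  move=> Gg; have mg := adapted_measurable Gg.
  have [M gM] : exists M, forall w, `|g w| <= M by case: mg.
  have M0 : 0 <= M by rewrite (le_trans _ (gM point)).
  have mk n := adapted_measurable (exp_cos_adapted (a n) th k).
  have c1 : E (fun w => g w * exp_cos (a n) th (m n) w) - E (fun w => g w * exp_cos (a n) th k w)
      @[n --> \oo] --> (0 : R).
    have c0 : M * expR b * (5 * C ^+ 3 * al n * A) @[n --> \oo] --> (0 : R).
      rewrite [X in _ --> X](_ : _ = M * expR b * (5 * C ^+ 3 * 0 * A)); last by ring.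
      apply: cvgM; first exact: cvg_cst.
      apply: cvgM; last exact: cvg_cst.
      by apply: cvgM => //; exact: cvg_cst.
    have alC : \forall n \near \oo, al n * C <= 1.
      have alC0 : al n * C @[n --> \oo] --> (0 : R).
        by rewrite -(mul0r C); apply: cvgM => //; exact: cvg_cst.
      move/cvgrPdist_le : alC0 => /(_ 1 ltr01); apply: filterS => n.
      by rewrite sub0r normrN; apply: le_trans; exact: ler_norm.
    apply/norm_cvg0P.
    apply: (@squeeze_cvgr _ _ _ _ (fun=> 0) _ _ _ _ _ c0); last exact: cvg_cst.
    near=> n; rewrite normr_ge0/=.
    apply: (@exp_cos_sum (a n) th g k (m n) M A (al n) Gg gM _ (al_ge0 n) (sA n) (a_al n)).
      by near: n; exact: m_oo.
    by near: n; exact: alC.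
  have c2 : E (fun w => g w * exp_cos (a n) th k w) @[n --> \oo] --> E (fun w => g w * cos th).
    have a0 l : a n l @[n --> \oo] --> (0 : R).
      apply/norm_cvg0P.
      apply: (@squeeze_cvgr _ _ _ _ (fun=> 0) _ _ _ _ _ al0); last exact: cvg_cst.
      near=> n; rewrite normr_ge0/=; apply: a_al.
      by near: n; exact: (m_oo l.+1).
    have Tk w : exp_cos (a n) th k w @[n --> \oo] --> cos th.
      have S0 : wsum (a n) k w + th @[n --> \oo] --> th.
        rewrite -[X in _ --> X]add0r; apply: cvgD; last exact: cvg_cst.
        rewrite /wsum [X in _ --> X](_ : _ = \sum_(l < k) 0 * xi l w); last first.
          by rewrite big1// => l _; rewrite mul0r.
        by apply: cvg_sumr => l; apply: cvgM; [exact: a0|exact: cvg_cst].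
      have W0 : wvarsum (a n) k w @[n --> \oo] --> (0 : R).
        rewrite /wvarsum [X in _ --> X](_ : _ = \sum_(l < k) 0 * 0 * V l w / 2); last first.
          by rewrite big1// => l _; rewrite !mul0r.
        apply: cvg_sumr => l; apply: cvgM; last exact: cvg_cst.
        by apply: cvgM; [apply: cvgM; exact: a0|exact: cvg_cst].
      rewrite -[X in _ --> X]mul1r -expR0; apply: cvgM.
        exact: (continuous_cvg _ (@continuous_expR R 0)).
      exact: (continuous_cvg _ (@continuous_cos R th)).
    (* The domination below holds only once k <= m n, hence the shift of the index by N. *)
    have near_k : \forall n \near \oo, (k <= m n)%N by exact: m_oo.
    have [N _ HN] := near_k.
    rewrite -(cvg_shiftn N); apply: (expect_dominated (M := M * expR b)).
    - by move=> n; have := mk (n + N)%N => ?; bmf.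
    - by bmf.
    - move=> n w; rewrite normrM ler_pM// /exp_cos normrM ger0_norm ?expR_ge0// -[leRHS]mulr1.
      rewrite ler_pM ?expR_ge0// ?cos_max// ler_expR.
      by apply: (wvarsum_le w _ (sA _)); apply: HN => /=; exact: leq_addl.
    - apply: aeW => w; apply: cvgM; first exact: cvg_cst.
      by rewrite (cvg_shiftn N (fun n => exp_cos (a n) th k w)).
  rewrite [X in X @ _](_ : _ = fun n =>
    (E (fun w => g w * exp_cos (a n) th (m n) w) - E (fun w => g w * exp_cos (a n) th k w))
    + (E (fun w => g w * exp_cos (a n) th k w) - E (fun w => g w * cos th))); last first.
    apply/funext => n; have := mk n; have := adapted_measurable (exp_cos_adapted (a n) th (m n)).
    move=> m1 m2; rewrite addrA subrK -expectB; [|by bmf..].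
    by apply: eq_Rintegral => w _; rewrite /phi mulrBr.
  rewrite -[X in _ --> X]addr0; apply: cvgD => //.
  rewrite -[X in _ --> X](subrr (E (fun w => g w * cos th))).
  by apply: cvgB => //; exact: cvg_cst.
(* Taking g = phi k in [step1] verifies the hypothesis of [renyi_mixing], which then accepts this
   weight. *)
pose psi' w := psi w * expR (- (v w / 2)).
have mE : bmfun (fun w => expR (- (v w / 2))) by apply: bmfun_expR; bmf.
have mpsi' : bmfun psi' by bmf.
have mix : E (fun w => psi' w * phi n w) @[n --> \oo] --> (0 : R).
  by apply: renyi_mixing mphi phiM mpsi' _ => k; exact: step1 (Gphi k).
have [M psiM] : exists M, forall w, `|psi w| <= M by case: mpsi.
have M0 : 0 <= M by rewrite (le_trans _ (psiM point)).
(* The cost of compensating by exp (v / 2) instead of the actual exp (wvarsum): the ratio of the two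
   tends to 1 almost surely and stays bounded. *)
have corr : E (fun w => psi w * cos (wsum (a n) (m n) w + th) *
    (1 - expR (wvarsum (a n) (m n) w - v w / 2))) @[n --> \oo] --> (0 : R).
  apply/norm_cvg0P.
  have c0 : M * E (fun w => `|1 - expR (wvarsum (a n) (m n) w - v w / 2)|) @[n --> \oo] --> (0 : R).
    rewrite -(mulr0 M); apply: cvgM; first exact: cvg_cst.
    rewrite -[X in _ --> X](expect_cst P 0); apply: (expect_dominated (M := 1 + expR b)).
    - move=> n; have := mW n => ?; apply: bmfun_norm.
      by apply: bmfunB; [bmf|apply: bmfun_expR; bmf].
    - exact: bmfun_cst.
    - move=> n w; rewrite normr_id (le_trans (ler_normB _ _))// lerD ?normr1//.
      rewrite ger0_norm ?expR_ge0// (le_trans _ (expb n w))// ler_expR gerBl.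
      by rewrite divr_ge0.
    - apply: filterS Vv => w Vw.
      apply/norm_cvg0P; rewrite -[X in _ --> X](subrr 1); apply: cvgB; first exact: cvg_cst.
      rewrite -[X in _ --> X]expR0 -[X in _ --> expR X](subrr (v w / 2)).
      apply: (continuous_cvg _ (@continuous_expR R _)).
      apply: cvgB; last exact: cvg_cst.
      rewrite [X in X @ _](_ : _ = fun n => (\sum_(l < m n) a n l ^+ 2 * V l w) * 2^-1).
        by apply: cvgM => //; exact: cvg_cst.
      by apply/funext => n; rewrite mulr_suml.
  apply: (@squeeze_cvgr _ _ _ _ (fun=> 0) _ _ _ _ _ c0); last exact: cvg_cst.
  near=> n; rewrite normr_ge0/=; have := mW n => mWn; have := mS n => mSn.
  have m1 : bmfun (fun w => cos (wsum (a n) (m n) w + th)).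
    by apply: bmfun_cos; bmf.
  have m2 : bmfun (fun w => expR (wvarsum (a n) (m n) w - v w / 2)).
    by apply: bmfun_expR; bmf.
  apply: le_trans (expect_norm _ _) _; first by bmf.
  rewrite -expectZ; last by bmf.
  apply: expect_le => [||w]; [by bmf..|].
  rewrite normrM ler_wpM2r// normrM -[leRHS]mulr1 ler_pM// cos_max//.
rewrite [X in X @ _](_ : _ = fun n => E (fun w => psi w * cos (wsum (a n) (m n) w + th) *
    (1 - expR (wvarsum (a n) (m n) w - v w / 2))) + (E (fun w => psi' w * phi n w)
     + E psi' * cos th)); last first.
  apply/funext => n; have := mW n => mWn; have := mS n => mSn; have mphin := mphi n.
  have m1 : bmfun (fun w => cos (wsum (a n) (m n) w + th)).
    by apply: bmfun_cos; bmf.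
  have m2 : bmfun (fun w => expR (wvarsum (a n) (m n) w - v w / 2)).
    by apply: bmfun_expR; bmf.
  rewrite [E psi' * _]mulrC -expectZ// -expectD; [|by bmf..].
  rewrite -expectD; [|by bmf..].
  apply: eq_Rintegral => w _; rewrite /psi' /phi /exp_cos expRD; ring.
rewrite -[X in _ --> X]add0r; apply: cvgD => //.
by rewrite -[X in _ --> X]add0r; apply: cvgD => //; exact: cvg_cst.
Unshelve. all: end_near. Qed.

End martingale_clt.

(** * The characteristic function of the normal law *)

Section gaussian.
Context (R : realType) (sigma : R).
Hypothesis s0 : 0 < sigma.
Local Notation mu := (@lebesgue_measure R).
Local Notation g := (normal_pdf 0 sigma).
Let sn0 : sigma != 0. Proof. exact: lt0r_neq0. Qed.

Lemma integral_normal_prob (f : R -> R) : bmfun f ->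
  \int[normal_prob 0 sigma]_x f x = \int[mu]_x (f x * g x).
Proof.
move=> mf; have intf := bmfun_integrable (normal_prob 0 sigma) mf.
rewrite /Rintegral; congr fine.
under [RHS]eq_integral do rewrite EFinM.
rewrite -(Radon_Nikodym_change_of_variables (normal_prob_dominates 0 sigma))//=.
have mfE : measurable_fun setT (EFin \o f) by apply/measurable_EFinP; case: mf.
apply: ae_eq_integral => //.
- apply: emeasurable_funM => //; apply: (measurable_int mu).
  by apply: Radon_Nikodym_integrable; exact: normal_prob_dominates.
- apply/measurable_EFinP; apply: measurable_funM; first by case: mf.
  exact: measurable_normal_pdf.
- apply: ae_eqe_mul2l => /=.
  rewrite Radon_NikodymE//=; first exact: normal_prob_dominates.
  move=> dom.
  case: cid => /= h [h1 h2 h3].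
  apply: integral_ae_eq => //=.
    by apply/measurable_EFinP; exact: measurable_normal_pdf.
  by move=> U _ mU; rewrite -h3.
Qed.

Lemma normal_pdf0E : g = fun x => normal_peak sigma * expR (- (x ^+ 2 / (2 * sigma ^+ 2))).
Proof.
rewrite normal_pdfE//; apply/funext => x; rewrite /normal_fun subr0.
by rewrite mulNr -[_ *+ 2]mulr_natl.
Qed.

Lemma is_derive_normal_pdf (x : R) : is_derive x 1 g (- (x / sigma ^+ 2) * g x).
Proof.
rewrite normal_pdf0E.
have H := is_deriveZ (- (2 * sigma ^+ 2)^-1) (is_deriveX 2 (is_derive_id x (1 : R))).
set q := (_ \*: _) in H.
have qE z : q z = - (z ^+ 2 / (2 * sigma ^+ 2)).
  by transitivity (- (2 * sigma ^+ 2)^-1 * z ^+ 2); [by []|rewrite mulNr mulrC].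
have H1 := is_derive1_comp (is_derive_expR (q x)) H.
have -> : (fun x => normal_peak sigma * expR (- (x ^+ 2 / (2 * sigma ^+ 2)))) =
    normal_peak sigma \*: (expR \o q).
  by apply/funext => z; rewrite -qE.
apply: is_derive_eq (is_deriveZ (normal_peak sigma) H1) _.
by rewrite qE /GRing.scale/=; field.
Qed.

Lemma integrable_mul_normal_pdf (f : R -> R) : bmfun f ->
  mu.-integrable setT (EFin \o (fun x => f x * g x)).
Proof.
move=> [mf [M fM]].
have M0 : 0 <= M by rewrite (le_trans _ (fM 0)).
apply: (@le_integrable _ _ _ mu setT measurableT _ (fun x => M%:E * (g x)%:E)%E) => //.
- apply/measurable_EFinP; apply: measurable_funM => //; exact: measurable_normal_pdf.
- move=> x _; rewrite -EFinM !abse_EFin lee_fin !normrM ler_wpM2r//.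
  by rewrite (ger0_norm M0).
- by apply: integrableZl => //; exact: integrable_normal_pdf.
Qed.

End gaussian.

Section gaussian_charfun.
Context (R : realType) (sigma : R).
Hypothesis s0 : 0 < sigma.
Local Notation mu := (@lebesgue_measure R).
Local Notation g := (normal_pdf 0 sigma).
Let sn0 : sigma != 0. Proof. exact: lt0r_neq0. Qed.

(* |x| e^{-x^2/(2 s^2)} is dominated by a multiple of e^{-x^2/(8 s^2)}. *)
Lemma integrable_id_normal_pdf : mu.-integrable setT (EFin \o (fun x => x * g x)).
Proof.
have s20 : 0 < 2 * sigma by rewrite mulr_gt0.
(* The ratio of the two peaks, times a constant from |x| <= 1 + x^2 <= (1 + 8 sigma^2 / 3) (1 + u)
   and 1 + u <= e^u, where u = 3 x^2 / (8 sigma^2) is the difference of the two exponents. *)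
pose K := normal_peak sigma / normal_peak (2 * sigma) * (1 + 8 * sigma ^+ 2 / 3).
have pk : 0 < normal_peak (2 * sigma) by apply: normal_peak_gt0; rewrite gt_eqF.
have pk' : 0 < normal_peak sigma by apply: normal_peak_gt0.
have sg2 : 0 < sigma ^+ 2 by rewrite exprn_gt0.
have c0 : 0 <= 8 * sigma ^+ 2 / 3 by apply: divr_ge0 => //; apply: mulr_ge0 => //; exact: ltW.
have K0 : 0 <= K.
  apply: mulr_ge0; first by apply: divr_ge0; exact: ltW.
  by apply: addr_ge0.
apply: (@le_integrable _ _ _ mu setT measurableT _
  (fun x => K%:E * (normal_pdf 0 (2 * sigma) x)%:E)%E) => //.
- by apply/measurable_EFinP; apply: measurable_funM => //; exact: measurable_normal_pdf.
- move=> x _; rewrite -EFinM !abse_EFin lee_fin [leLHS]normrM [leRHS]normrM (ger0_norm K0).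
  rewrite !(ger0_norm (normal_pdf_ge0 _ _ _)) (normal_pdf0E s0) (normal_pdf0E s20).
  pose u := 3 * x ^+ 2 / (8 * sigma ^+ 2).
  have -> : - (x ^+ 2 / (2 * sigma ^+ 2)) = - u - x ^+ 2 / (2 * (2 * sigma) ^+ 2).
    by rewrite /u; field.
  rewrite expRD /K.
  set e := expR (- (x ^+ 2 / _)).
  rewrite [leRHS](_ : _ = (1 + 8 * sigma ^+ 2 / 3) * (normal_peak sigma * e)); last first.
    by field; rewrite gt_eqF.
  rewrite [leLHS](_ : _ = (`|x| * expR (- u)) * (normal_peak sigma * e)); last by ring.
  rewrite ler_wpM2r ?mulr_ge0 ?expR_ge0 ?(ltW pk')//.
  rewrite expRN ler_pdivrMr ?expR_gt0//.
  apply: (@le_trans _ _ ((1 + 8 * sigma ^+ 2 / 3) * (1 + u))); last first.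
    by rewrite ler_wpM2l ?expR_ge1Dx// addr_ge0.
  have xu : x ^+ 2 = 8 * sigma ^+ 2 / 3 * u by rewrite /u; field.
  have : `|x| <= 1 + x ^+ 2.
    by rewrite -[x ^+ 2]real_normK ?num_real//; have := sqr_ge0 (`|x| - 1); nra.
  by rewrite xu; nra.
- apply: integrableZl => //; exact: integrable_normal_pdf.
Qed.

Lemma integral_derivative_eq0 (F f : R -> R) : (forall x : R, is_derive x 1 F (f x)) ->
  continuous f -> mu.-integrable setT (EFin \o f) ->
  F n%:R @[n --> \oo] --> (0 : R) -> F (- n%:R) @[n --> \oo] --> (0 : R) ->
  \int[mu]_x f x = 0.
Proof.
move=> dF cf intf F1 F2.
have cF : continuous F.
  by move=> y; apply: differentiable_continuous; apply/derivable1_diffP.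
have FTC n : (\int[mu]_x ((f \_ `[- n.+1%:R, n.+1%:R]) x)%:E)%E
    = (F n.+1%:R - F (- n.+1%:R))%:E.
  transitivity (\int[mu]_(x in `[(- n.+1%:R)%R, n.+1%:R%R]) (f x)%:E)%E.
    rewrite [RHS]integral_mkcond; apply: eq_integral => x _.
    by rewrite restrict_EFin.
  have nn : - n.+1%:R < n.+1%:R :> R by have : 0 < n.+1%:R :> R by []; lra.
  rewrite (continuous_FTC2 (F := F) nn)//.
  - exact: continuous_subspaceT.
  - by split=> [x _|//|//]; [exact: (@ex_derive _ _ _ _ _ _ _ (dF x))|
      apply: cvg_at_right_filter; exact: cF|apply: cvg_at_left_filter; exact: cF].
  - by move=> x _; rewrite derive1E; exact: (@derive_val _ _ _ _ _ _ _ (dF x)).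
have mf : measurable_fun setT f by exact: continuous_measurable_fun.
have [] := @dominated_convergence _ _ R mu setT measurableT
  (fun n => EFin \o (f \_ `[- n.+1%:R, n.+1%:R])) (EFin \o f) (EFin \o (fun x => `|f x|)).
- move=> n; apply/measurable_EFinP.
  by apply/(measurable_restrictT _ _).1 => //; exact: measurable_funTS.
- by apply/measurable_EFinP.
- apply: aeW => x _; apply: cvg_near_cst.
  near=> n; rewrite /= patchE ifT// inE/= in_itv/= -ler_norml.
  have : `|x| <= n%:R by near: n; exact: nbhs_infty_ger.
  by move=> /le_trans; apply; rewrite ler_nat.
- exact: (integrable_norm intf).
- apply: aeW => x n _ /=; rewrite lee_fin patchE; case: ifP => // _.
  by rewrite normr0.
move=> _ _ /= c.
have c0 : (\int[mu]_x ((f \_ `[- n.+1%:R, n.+1%:R]) x)%:E)%E @[n --> \oo] --> (0 : \bar R)%E.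
  rewrite [X in X @ _](funext FTC); apply/cvg_EFin; first exact: nearW.
  rewrite -[X in _ --> X](subrr 0); apply: cvgB.
    by rewrite (cvg_shiftS (fun n => F n%:R)).
  by rewrite (cvg_shiftS (fun n => F (- n%:R))).
by rewrite /Rintegral (cvg_unique _ c c0).
Unshelve. all: end_near. Qed.

Lemma normal_pdf_nat_cvg0 : g n%:R @[n --> \oo] --> (0 : R).
Proof.
pose K := normal_peak sigma * (2 * sigma ^+ 2).
have c : K * n.+1%:R^-1 @[n --> \oo] --> (0 : R).
  by rewrite -(mulr0 K); apply: cvgM; [exact: cvg_cst|exact: cvg_harmonic].
rewrite -cvg_shiftS; apply: (@squeeze_cvgr _ _ _ _ (fun=> 0) _ _ _ _ _ c); last exact: cvg_cst.
near=> n; rewrite normal_pdf_ge0/= (normal_pdf0E s0) /K -mulrA ler_wpM2l ?normal_peak_ge0//.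
have sg2 : 0 < 2 * sigma ^+ 2 by rewrite mulr_gt0// exprn_gt0.
have n0 : 0 < n.+1%:R :> R by [].
have n1 : 1 <= n.+1%:R :> R by rewrite ler1n.
move: (n.+1%:R : R) n0 n1 => x x0 x1.
rewrite expRN -[leLHS]mul1r ler_pdivrMr ?expR_gt0//.
apply: (@le_trans _ _ (2 * sigma ^+ 2 / x * (1 + x ^+ 2 / (2 * sigma ^+ 2)))); last first.
  by apply: ler_wpM2l; [apply: divr_ge0; exact: ltW|exact: expR_ge1Dx].
have -> : 2 * sigma ^+ 2 / x * (1 + x ^+ 2 / (2 * sigma ^+ 2)) =
   2 * sigma ^+ 2 / x + x by field; rewrite sn0 gt_eqF.
have : 0 <= 2 * sigma ^+ 2 / x by apply: divr_ge0; exact: ltW.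
by lra.
Unshelve. all: end_near. Qed.

Lemma is_derive_cos_affine (s y th : R) :
  is_derive s 1 (fun t => cos (t * y + th)) (- (y * sin (s * y + th))).
Proof.
have H : is_derive s 1 (fun t : R => t * y + th) y.
  have := is_deriveD (is_deriveZ y (is_derive_id s (1 : R))) (is_derive_cst th s 1).
  rewrite addr0 /GRing.scale/= mulr1 (_ : (_ + _) = fun t : R => t * y + th)//.
  by apply/funext => t; rewrite /GRing.scale/= mulrC.
have := @is_derive1_comp R cos (fun t : R => t * y + th) s _ _ (is_derive_cos _) H.
by rewrite mulNr mulrC.
Qed.

Lemma is_derive_sin_affine (s y th : R) :
  is_derive y 1 (fun t => sin (s * t + th)) (s * cos (s * y + th)).
Proof.
have H : is_derive y 1 (fun t : R => s * t + th) s.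
  have := is_deriveD (is_deriveZ s (is_derive_id y (1 : R))) (is_derive_cst th y 1).
  by rewrite addr0 /GRing.scale/= mulr1.
have := @is_derive1_comp R sin (fun t : R => s * t + th) y _ _ (is_derive_sin _) H.
by rewrite mulrC.
Qed.

Lemma bmfun_cos_affine (s th : R) : bmfun (fun x : R => cos (s * x + th)).
Proof.
split; last by exists 1 => x; exact: cos_max.
apply: continuous_measurable_fun => x; apply: continuous_comp; last exact: continuous_cos.
by apply: cvgD; [apply: cvgM; [exact: cvg_cst|exact: cvg_id]|exact: cvg_cst].
Qed.

Lemma bmfun_sin_affine (s th : R) : bmfun (fun x : R => sin (s * x + th)).
Proof.
split; last by exists 1 => x; exact: sin_max.
apply: continuous_measurable_fun => x; apply: continuous_comp; last exact: continuous_sin.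
by apply: cvgD; [apply: cvgM; [exact: cvg_cst|exact: cvg_id]|exact: cvg_cst].
Qed.

(* Integrating the derivative of g(x) sin(s x + th) over the line gives the
   differential equation F' = - sigma^2 s F. *)
Lemma is_derive_normal_charfun (th s : R) :
  let F t := \int[mu]_x (cos (t * x + th) * g x) in
  is_derive s 1 F (- (sigma ^+ 2 * s * F s)).
Proof.
move=> F.
have intf t := integrable_mul_normal_pdf sigma (bmfun_cos_affine t th).
have Is : `]s - 1, s + 1[%classic s by rewrite /= in_itv/=; lra.
have dcos (t y : R) : is_derive t 1 (fun t => cos (t * y + th) * g y)
    (- (y * sin (t * y + th)) * g y).
  have := is_deriveZ (g y) (is_derive_cos_affine t y th).
  rewrite /GRing.scale/= mulrC (_ : (_ \*: _) = fun t => cos (t * y + th) * g y)//.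
  by apply/funext => z; exact: mulrC.
have part t y : partial1of2 (fun t y => cos (t * y + th) * g y) t y =
    - (y * sin (t * y + th)) * g y.
  by rewrite partial1of2E; exact: (@derive_val _ _ _ _ _ _ _ (dcos t y)).
have intG : mu.-integrable setT (EFin \o (fun x => `|x * g x|)).
  exact: integrable_norm integrable_id_normal_pdf.
have G_ub (t y : R) : `|partial1of2 (fun t y => cos (t * y + th) * g y) t y| <= `|y * g y|.
  rewrite part !normrM normrN normrM ler_wpM2r// -[leRHS]mulr1 ler_wpM2l//.
  exact: sin_max.
have der1 (t y : R) : derivable (fun t : R => cos (t * y + th) * g y) t 1.
  exact: (@ex_derive _ _ _ _ _ _ _ (dcos t y)).
have dF : derivable F s 1.
  exact: (derivable_under_integral measurableT Is (fun t _ => intf t)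
    (fun t y _ _ => der1 t y) (fun y => normr_ge0 _) intG (fun t y _ _ => G_ub t y)).
have vF : F^`()%classic s = \int[mu]_y (- (y * sin (s * y + th)) * g y).
  rewrite (differentiation_under_integral measurableT Is (fun t _ => intf t)
    (fun t y _ _ => der1 t y) (fun y => normr_ge0 _) intG (fun t y _ _ => G_ub t y)).
  by apply: eq_Rintegral => y _; rewrite part.
have int_sin : mu.-integrable setT (EFin \o (fun y => - (y * sin (s * y + th)) * g y)).
  apply: (le_integrable measurableT _ _ intG) => [|y _].
    apply/measurable_EFinP; apply: measurable_funM; last exact: measurable_normal_pdf.
    apply: measurableT_comp => //; apply: measurable_funM => //.
    by case: (bmfun_sin_affine s th).
  by have := G_ub s y; rewrite part /= lee_fin normr_id.
have ibp : \int[mu]_y (sigma ^- 2 * (- (y * sin (s * y + th)) * g y)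
    + s * (cos (s * y + th) * g y)) = 0.
  apply: (@integral_derivative_eq0 (fun y => g y * sin (s * y + th))).
  - move=> y; have := is_deriveM (is_derive_normal_pdf s0 y) (is_derive_sin_affine s y th).
    by move=> H; apply: is_derive_eq H _; rewrite /GRing.scale/=; ring.
  - move=> y.
    have cs : continuous (fun y : R => sin (s * y + th)).
      move=> z; apply: continuous_comp; last exact: continuous_sin.
      by apply: cvgD; [apply: cvgM; [exact: cvg_cst|exact: cvg_id]|exact: cvg_cst].
    have cc : continuous (fun y : R => cos (s * y + th)).
      move=> z; apply: continuous_comp; last exact: continuous_cos.
      by apply: cvgD; [apply: cvgM; [exact: cvg_cst|exact: cvg_id]|exact: cvg_cst].
    have cg : continuous g by exact: continuous_normal_pdf.
    apply: cvgD; apply: cvgM; try exact: cvg_cst; apply: cvgM; try exact: cg; last exact: cc.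
    by apply: cvgN; apply: cvgM; [exact: cvg_id|exact: cs].
  - have i1 := integrableZl measurableT (sigma ^- 2) int_sin.
    have i2 := integrableZl measurableT s (intf s).
    by have := integrableD measurableT i1 i2; apply: eq_integrable.
  - apply/norm_cvg0P; have c := normal_pdf_nat_cvg0.
    apply: (@squeeze_cvgr _ _ _ _ (fun=> 0) _ _ _ _ _ c); last exact: cvg_cst.
    near=> n; rewrite normr_ge0/= normrM (ger0_norm (normal_pdf_ge0 _ _ _)).
    by rewrite ler_piMr ?normal_pdf_ge0// sin_max.
  - apply/norm_cvg0P; have c := normal_pdf_nat_cvg0.
    apply: (@squeeze_cvgr _ _ _ _ (fun=> 0) _ _ _ _ _ c); last exact: cvg_cst.
    near=> n; rewrite normr_ge0/= normrM (ger0_norm (normal_pdf_ge0 _ _ _)).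
    have -> : g n%:R = g (- n%:R) by rewrite (normal_pdf0E s0) sqrrN.
    by rewrite ler_piMr ?normal_pdf_ge0// sin_max.
have i1 := integrableZl measurableT (sigma ^- 2) int_sin.
have i2 := integrableZl measurableT s (intf s).
rewrite RintegralD ?RintegralZl// -vF in ibp.
apply: DeriveDef => //; rewrite -derive1E.
have sg2 : sigma ^+ 2 != 0 by rewrite expf_neq0.
have -> : F^`()%classic s = sigma ^+ 2 * (sigma ^- 2 * F^`()%classic s) by rewrite mulrA mulfV ?mul1r.
have -> : sigma ^- 2 * F^`()%classic s = - (s * F s) by apply/eqP; rewrite -addr_eq0 ibp.
by rewrite mulrN mulrA.
Unshelve. all: end_near. Qed.

(** By the differential equation, F times exp (sigma^2 t^2 / 2) has zero derivative, and F 0 = cos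
    th. *)
Lemma normal_charfun (th s : R) :
  \int[normal_prob 0 sigma]_x cos (s * x + th) = expR (- (sigma ^+ 2 * s ^+ 2 / 2)) * cos th.
Proof.
rewrite integral_normal_prob; last exact: bmfun_cos_affine.
pose F t := \int[mu]_x (cos (t * x + th) * g x).
pose q : R -> R := (sigma ^+ 2 / 2) \*: (id ^+ 2).
have qE t : q t = sigma ^+ 2 * t ^+ 2 / 2 by rewrite mulrAC.
have dH (t : R) : is_derive t 1 (F * (expR \o q)) 0.
  have dq := is_deriveZ (sigma ^+ 2 / 2) (is_deriveX 2 (is_derive_id t (1 : R))).
  have dE := is_derive1_comp (is_derive_expR (q t)) dq.
  apply: is_derive_eq (is_deriveM (is_derive_normal_charfun th t) dE) _.
  by rewrite /GRing.scale/= -/(F t); field.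
have := is_derive_0_is_cst s 0 dH.
have F0 : F 0 = cos th.
  rewrite /F; under eq_Rintegral do rewrite mul0r add0r.
  rewrite RintegralZl//; last exact: integrable_normal_pdf.
  by rewrite /Rintegral integral_normal_pdf mulr1.
have -> : (F * (expR \o q)) s = F s * expR (q s) by [].
have -> : (F * (expR \o q)) 0 = F 0 * expR (q 0) by [].
rewrite -qE expRN F0 [q 0]qE expr0n/= mulr0 mul0r expR0 mulr1 => <-.
by rewrite [RHS]mulrC mulfK// gt_eqF ?expR_gt0.
Qed.

End gaussian_charfun.

(** * Convergence of characters implies weak convergence *)

(** Stronger than uniform continuity on K, since y need not lie in K: it will compare the value of f
    on a compact piece of a plane with its value at a nearby point off that plane. *)
Lemma compact_unif_continuous (R : realType) (X : pseudoMetricType R) (K : set X)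
    (f : X -> R) : compact K -> (forall x, {for x, continuous f}) -> forall e, 0 < e ->
  exists2 del, 0 < del & forall x y, K x -> ball x del y -> `|f x - f y| < e.
Proof.
move=> cK cf e e0.
pose A (del : R) (x : X) : Prop := forall y, ball x del y -> `|f x - f y| < e.
have /compact_near_coveringP cov := cK.
have [del [del0 hdel]] : exists del, 0 < del /\ K `<=` A del.
  apply: (@filter_ex _ (0 : R)^'+).
  near=> del; split; first by near: del; exact: nbhs_right_gt.
  near: del; apply: cov => x Kx.
  have /nbhs_ballP[r /= r0 hr] : \forall y \near x, `|f x - f y| < e / 2.
    by move: (cf x) => /cvgrPdist_lt; apply; rewrite divr_gt0.
  exists (ball x (r / 2), [set d | 0 < d < r / 2]) => /=.
    split; first by apply/nbhs_ballP; exists (r / 2) => //=; rewrite divr_gt0.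
    suff : \forall d \near 0^'+, 0 < d < r / 2 by [].
    near=> d; apply/andP; split; near: d; first exact: nbhs_right_gt.
    by apply: nbhs_right_lt; rewrite divr_gt0.
  move=> [x' d] /= [xx' /andP[d0 dr]] y x'y.
  have h1 : `|f x - f x'| < e / 2 by apply: hr; apply: le_ball xx'; lra.
  have h2 : `|f x - f y| < e / 2.
    apply: hr; rewrite [r]splitr; apply: (ball_triangle xx').
    by apply: le_ball x'y; exact: ltW.
  have -> : f x' - f y = (f x - f y) - (f x - f x') by ring.
  by rewrite (le_lt_trans (ler_normB _ _))// [e]splitr ltrD.
by exists del => // x y Kx xy; exact: hdel.
Unshelve. all: end_near. Qed.

(** * Bernstein approximation in one and two variables *)

Section bernstein.
Context (R : realType).
Implicit Types (u c : R) (f : nat -> R).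

(* bernstein n u f is the expectation of f under the binomial law of
   parameters n and u. *)
Fixpoint bernstein n u f : R :=
  if n is m.+1 then u * bernstein m u (f \o S) + (1 - u) * bernstein m u f
  else f 0%N.

Lemma bernstein_lin n u f g a b :
  bernstein n u (fun i => a * f i + b * g i) = a * bernstein n u f + b * bernstein n u g.
Proof.
elim: n f g => [//|n IH] f g /=; rewrite (IH f g) [bernstein n u (_ \o _)](IH (f \o S) (g \o S)).
by ring.
Qed.

Lemma bernsteinN n u f : bernstein n u (fun i => - f i) = - bernstein n u f.
Proof.
elim: n f => [//|n IH] f /=; rewrite IH [bernstein n u (_ \o _)](IH (f \o S)); ring.
Qed.

Lemma bernstein_cst n u a : bernstein n u (fun=> a) = a.
Proof. by elim: n => [//|n IH] /=; rewrite !IH; ring. Qed.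

Lemma bernstein_le n u f g : 0 <= u <= 1 -> (forall i, (i <= n)%N -> f i <= g i) ->
  bernstein n u f <= bernstein n u g.
Proof.
move=> /andP[u0 u1]; elim: n f g => [|n IH] f g fg /=; first exact: fg.
rewrite lerD// ler_wpM2l ?subr_ge0//; apply: IH => i ni; apply: fg => //.
exact: leqW.
Qed.

(** Stated for every shift c because the recursion replaces c by 1 + c. *)
Lemma bernstein_sqr n u c :
  bernstein n u (fun i => (i%:R + c) ^+ 2) = (n%:R * u + c) ^+ 2 + n%:R * u * (1 - u).
Proof.
elim: n c => [|n IH] c /=; first by ring.
rewrite IH; have -> : (fun i : nat => (i%:R + c) ^+ 2) \o S = fun i => (i%:R + (1 + c)) ^+ 2.
  by apply/funext => i /=; rewrite -natr1 addrA.
by rewrite IH -natr1; ring.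
Qed.

Lemma bernstein_variance n u : 0 <= u <= 1 -> (0 < n)%N ->
  bernstein n u (fun i => (i%:R / n%:R - u) ^+ 2) <= n%:R^-1.
Proof.
move=> /andP[u0 u1] n0; have nr : n%:R != 0 :> R by rewrite pnatr_eq0 -lt0n.
have -> : (fun i : nat => (i%:R / n%:R - u) ^+ 2) =
    fun i => n%:R ^- 2 * (i%:R + - (n%:R * u)) ^+ 2 + 0 * 0.
  by apply/funext => i; field.
rewrite bernstein_lin bernstein_sqr subrr expr0n/= add0r mul0r addr0.
have -> : n%:R ^- 2 * (n%:R * u * (1 - u)) = n%:R^-1 * (u * (1 - u)) by field.
by rewrite ler_piMr ?invr_ge0//; nra.
Qed.

Definition bernstein2 n u v (F : R -> R -> R) :=
  bernstein n u (fun i => bernstein n v (fun j => F (i%:R / n%:R) (j%:R / n%:R))).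

(** Chebyshev's inequality: at grid points within del of (u, v) uniform continuity gives e / 2, and
    at the others 2 M is at most 2 M / del^2 times the squared distance, whose mean is at most 2 /
    n. *)
Lemma bernstein2_approx (F : R * R -> R) e : continuous F -> 0 < e ->
  exists2 n, (0 < n)%N & forall u v, 0 <= u <= 1 -> 0 <= v <= 1 ->
    `|bernstein2 n u v (fun x y => F (x, y)) - F (u, v)| <= e.
Proof.
move=> cF e0.
have cK := compact_setX (@segment_compact R 0 1) (@segment_compact R 0 1).
have [M FM] : exists M, forall x, (`[0, 1] `*` `[0, 1]) x -> `|F x| <= M.
  have : compact (F @` (`[0, 1] `*` `[0, 1])).
    by apply: continuous_compact => //; exact: continuous_subspaceT.
  move=> /compact_bounded[N [_ hN]]; exists (N + 1) => x Kx.
  by apply: (hN (N + 1)); rewrite ?ltrDl//; exists x.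
have M0 : 0 <= M by apply: le_trans (FM (0, 0) _); rewrite ?normr_ge0//=; split; rewrite /= in_itv/= lexx ler01.
have e2 : 0 < e / 2 by rewrite divr_gt0.
have [del del0 hdel] := compact_unif_continuous cK cF e2.
pose n := (Num.truncn (4 * M / del ^+ 2 / (e / 2))).+1.
have nlarge : 4 * M / del ^+ 2 / n%:R <= e / 2.
  rewrite ler_pdivrMr ?ltr0n// [leRHS]mulrC -ler_pdivrMr//.
  by rewrite ltW// /n truncnS_gt.
exists n => // u v u01 v01.
pose B := bernstein n u (fun i => bernstein n v (fun j =>
   e / 2 + 2 * M / del ^+ 2 * ((i%:R / n%:R - u) ^+ 2 + (j%:R / n%:R - v) ^+ 2))).
have pt i j : (i <= n)%N -> (j <= n)%N -> `|F (i%:R / n%:R, j%:R / n%:R) - F (u, v)| <=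
    e / 2 + 2 * M / del ^+ 2 * ((i%:R / n%:R - u) ^+ 2 + (j%:R / n%:R - v) ^+ 2).
  move=> ni nj.
  have in01 k : (k <= n)%N -> 0 <= (k%:R / n%:R : R) <= 1.
    by move=> kn; rewrite divr_ge0//= ler_pdivrMr// mul1r ler_nat.
  have Kuv : (`[0, 1] `*` `[0, 1])%classic (u, v) by split; rewrite /= in_itv/=.
  have Kij : (`[0, 1] `*` `[0, 1])%classic ((i%:R / n%:R, j%:R / n%:R) : R * R).
    by split; rewrite /= in_itv/= in01.
  have d20 : 0 < del ^+ 2 by rewrite exprn_gt0.
  set a := i%:R / n%:R; set b := j%:R / n%:R.
  have c0 : 0 <= 2 * M / del ^+ 2 by apply: divr_ge0; rewrite ?mulr_ge0// ltW.
  have [near|far] := boolP ((`|u - a| < del) && (`|v - b| < del)).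
    have : `|F (u, v) - F (a, b)| < e / 2.
      by case/andP: near => ? ?; apply: hdel => //; split.
    rewrite distrC => /ltW /le_trans; apply.
    by rewrite lerDl mulr_ge0// addr_ge0 ?sqr_ge0.
  apply: (@le_trans _ _ (2 * M)).
    rewrite (le_trans (ler_normB _ _))//.
    by have := FM _ Kuv; have := FM _ Kij; rewrite -/a -/b; lra.
  apply: (@le_trans _ _ (2 * M / del ^+ 2 * ((a - u) ^+ 2 + (b - v) ^+ 2))); last first.
    by rewrite lerDr ltW.
  have far2 : del ^+ 2 <= (a - u) ^+ 2 + (b - v) ^+ 2.
    have sq z : del <= `|z| -> del ^+ 2 <= z ^+ 2.
      by move=> ?; rewrite -[z ^+ 2]real_normK ?num_real// lerXn2r ?nnegrE// ltW.
    move: far; rewrite negb_and -!leNgt => /orP[] /sq H.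
      by rewrite -[(a - u) ^+ 2]sqrrN opprB; have := sqr_ge0 (b - v); lra.
    by rewrite -[(b - v) ^+ 2]sqrrN opprB; have := sqr_ge0 (a - u); lra.
  rewrite -{1}[2 * M](divfK (lt0r_neq0 d20)); exact: ler_wpM2l.
have lin : B = e / 2 + 2 * M / del ^+ 2 *
    (bernstein n u (fun i => (i%:R / n%:R - u) ^+ 2)
     + bernstein n v (fun j => (j%:R / n%:R - v) ^+ 2)).
  rewrite /B; set c := 2 * M / del ^+ 2.
  set bv := bernstein n v (fun j => (j%:R / n%:R - v) ^+ 2).
  transitivity (bernstein n u (fun i => 1 * ((e / 2 + c * bv) * 1) + c * (i%:R / n%:R - u) ^+ 2)).
    congr bernstein; apply/funext => i.
    transitivity (bernstein n v (fun j => (e / 2 + c * (i%:R / n%:R - u) ^+ 2) * 1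
        + c * (j%:R / n%:R - v) ^+ 2)).
      by congr bernstein; apply/funext => j; ring.
    by rewrite bernstein_lin bernstein_cst -/bv; ring.
  by rewrite bernstein_lin bernstein_cst; ring.
have Bn : B <= e.
  have v1 := bernstein_variance u01 (isT : (0 < n)%N).
  have v2 := bernstein_variance v01 (isT : (0 < n)%N).
  have d20 : 0 < del ^+ 2 by rewrite exprn_gt0.
  have c0 : 0 <= 2 * M / del ^+ 2 by apply: divr_ge0; rewrite ?mulr_ge0// ltW.
  rewrite lin [leRHS]splitr lerD2l; apply: le_trans nlarge.
  apply: (le_trans (ler_wpM2l c0 (lerD v1 v2))).
  by rewrite le_eqVlt; apply/orP; left; apply/eqP; ring.
apply: le_trans Bn.
have dif : bernstein2 n u v (fun x y => F (x, y)) - F (u, v) =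
  bernstein n u (fun i => bernstein n v (fun j => F (i%:R / n%:R, j%:R / n%:R) - F (u, v))).
  transitivity (bernstein n u (fun i => 1 * bernstein n v (fun j => F (i%:R / n%:R, j%:R / n%:R))
     + (-1) * F (u, v))).
    by rewrite bernstein_lin bernstein_cst /bernstein2; ring.
  congr bernstein; apply/funext => i.
  transitivity (bernstein n v (fun j => 1 * F (i%:R / n%:R, j%:R / n%:R) + (-1) * F (u, v))).
    by rewrite bernstein_lin bernstein_cst; ring.
  by congr bernstein; apply/funext => j; ring.
rewrite ler_norml dif; apply/andP; split.
  rewrite lerNl -bernsteinN; under eq_fun do rewrite -bernsteinN.
  apply: bernstein_le => // i ni; apply: bernstein_le => // j nj.
  by apply: le_trans (pt i j ni nj); rewrite -normrN ler_norm.
apply: bernstein_le => // i ni; apply: bernstein_le => // j nj.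
by apply: le_trans (pt i j ni nj); rewrite ler_norm.
Qed.

Lemma bernstein2_bound n u v (F : R -> R -> R) M : 0 <= u <= 1 -> 0 <= v <= 1 ->
  (forall x y, `|F x y| <= M) -> `|bernstein2 n u v F| <= M.
Proof.
move=> u01 v01 FM; rewrite ler_norml; apply/andP; split.
  rewrite -(bernstein_cst n u (- M)); apply: bernstein_le => // i _.
  rewrite -(bernstein_cst n v (- M)); apply: bernstein_le => // j _.
  by have := FM (i%:R / n%:R) (j%:R / n%:R); rewrite ler_norml => /andP[].
rewrite -[leRHS](bernstein_cst n u M); apply: bernstein_le => // i _.
rewrite -[leRHS](bernstein_cst n v M); apply: bernstein_le => // j _.
by have := FM (i%:R / n%:R) (j%:R / n%:R); rewrite ler_norml => /andP[].
Qed.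

End bernstein.

Section test_functions.
Context (R : realType).
Implicit Types h g : R -> R -> R.

Definition test_fun h := measurable_fun [set: R * R] (fun z => h z.1 z.2) /\
  exists M, forall x y, `|h x y| <= M.

Lemma test_fun_comp d (T : measurableType d) h (U V : T -> R) : test_fun h ->
  measurable_fun setT U -> measurable_fun setT V -> bmfun (fun w => h (U w) (V w)).
Proof.
move=> [mh [M hM]] mU mV; split; last by exists M.
have mUV : measurable_fun setT (fun w => (U w, V w)) by exact: measurable_fun_pair.
exact: (measurableT_comp mh mUV).
Qed.

Lemma test_fun_cst a : test_fun (fun _ _ => a).
Proof. by split; [exact: measurable_cst|exists `|a|]. Qed.

Lemma test_fun_lin h g a b : test_fun h -> test_fun g ->
  test_fun (fun x y => a * h x y + b * g x y).
Proof.
move=> [mh [M hM]] [mg [N gN]]; split.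
  by apply: measurable_funD; apply: measurable_funM.
exists (`|a| * M + `|b| * N) => x y; rewrite (le_trans (ler_normD _ _))// !normrM.
by rewrite lerD// ler_wpM2l.
Qed.

Lemma test_funM h g : test_fun h -> test_fun g -> test_fun (fun x y => h x y * g x y).
Proof.
move=> [mh [M hM]] [mg [N gN]]; split; first exact: measurable_funM.
by exists (M * N) => x y; rewrite normrM ler_pM.
Qed.

Lemma test_fun_cos s t th : test_fun (fun x y => cos (s * x + t * y + th)).
Proof.
split; last by exists 1 => x y; exact: cos_max.
apply: measurableT_comp; first by apply: continuous_measurable_fun; exact: continuous_cos.
by apply: measurable_funD => //; apply: measurable_funD; apply: measurable_funM.
Qed.

End test_functions.

(** * Characters determine weighted limits of pairs of real variables *)

Section cos_determining.
Context (R : realType) d (T : measurableType d) (P : probability T R)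
  d' (T' : measurableType d') (Q : probability T' R).
Variables (psi : T -> R) (psi' : T' -> R) (U V : nat -> T -> R) (U' V' : T' -> R).
Hypothesis mpsi : bmfun psi.
Hypothesis mpsi' : bmfun psi'.
Hypothesis mU : forall n, measurable_fun setT (U n).
Hypothesis mV : forall n, measurable_fun setT (V n).
Hypothesis mU' : measurable_fun setT U'.
Hypothesis mV' : measurable_fun setT V'.
Implicit Types h g : R -> R -> R.

Let L n h := \int[P]_w (psi w * h (U n w) (V n w)).
Let L' h := \int[Q]_w (psi' w * h (U' w) (V' w)).

Let mh n h : test_fun h -> bmfun (fun w => psi w * h (U n w) (V n w)).
Proof. by move=> th; apply: bmfunM => //; exact: test_fun_comp. Qed.

Let mh' h : test_fun h -> bmfun (fun w => psi' w * h (U' w) (V' w)).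
Proof. by move=> th; apply: bmfunM => //; exact: test_fun_comp. Qed.

Let L_lin n h g a b : test_fun h -> test_fun g ->
  L n (fun x y => a * h x y + b * g x y) = a * L n h + b * L n g.
Proof.
move=> th tg; have h1 := mh n th; have h2 := mh n tg.
rewrite /L -!expectZ// -expectD; [|by bmf..].
by apply: eq_Rintegral => w _; ring.
Qed.

Let L'_lin h g a b : test_fun h -> test_fun g ->
  L' (fun x y => a * h x y + b * g x y) = a * L' h + b * L' g.
Proof.
move=> th tg; have h1 := mh' th; have h2 := mh' tg.
rewrite /L' -!expectZ// -expectD; [|by bmf..].
by apply: eq_Rintegral => w _; ring.
Qed.

Hypothesis cos_cvg : forall s t th,
  L n (fun x y => cos (s * x + t * y + th)) @[n --> \oo] -->
  L' (fun x y => cos (s * x + t * y + th)).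

(* Convergence against h times every character; unlike plain convergence
   against h, this is preserved when h is multiplied by a sine. *)
Let chars h := test_fun h /\ forall s t th,
  L n (fun x y => h x y * cos (s * x + t * y + th)) @[n --> \oo] -->
  L' (fun x y => h x y * cos (s * x + t * y + th)).

Let chars_lin h g a b : chars h -> chars g -> chars (fun x y => a * h x y + b * g x y).
Proof.
move=> [th ch] [tg cg]; split; first exact: test_fun_lin.
move=> s t ph; have tc := test_fun_cos s t ph.
have E : (fun x y => (a * h x y + b * g x y) * cos (s * x + t * y + ph)) =
    (fun x y => a * (h x y * cos (s * x + t * y + ph)) + b * (g x y * cos (s * x + t * y + ph))).
  by apply/funext => x; apply/funext => y; ring.
rewrite E L'_lin; [|exact: test_funM..].
rewrite (_ : (fun n => _) = fun n => a * L n (fun x y => h x y * cos (s * x + t * y + ph))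
  + b * L n (fun x y => g x y * cos (s * x + t * y + ph))).
  by apply: cvgD; apply: cvgM => //; exact: cvg_cst.
by apply/funext => n; rewrite L_lin//; exact: test_funM.
Qed.

Let chars_cst a : chars (fun _ _ => a).
Proof.
split; first exact: test_fun_cst.
move=> s t ph; have tc := test_fun_cos s t ph.
have E : (fun x y => a * cos (s * x + t * y + ph)) =
    (fun x y : R => a * cos (s * x + t * y + ph) + 0 * cos (s * x + t * y + ph)).
  by apply/funext => x; apply/funext => y; ring.
rewrite E L'_lin// (_ : (fun n => _) = fun n =>
    a * L n (fun x y => cos (s * x + t * y + ph)) + 0 * L n (fun x y => cos (s * x + t * y + ph))).
  by apply: cvgD; apply: cvgM; rewrite ?cos_cvg//; exact: cvg_cst.
by apply/funext => n; rewrite L_lin.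
Qed.

(** The product formula trades a sine factor for two characters with shifted frequencies and phase,
    which is why [chars] quantifies over all of them. *)
Let chars_sin h k l : chars h -> chars (fun x y => h x y * sin (k * x + l * y)).
Proof.
move=> [th ch]; split.
  apply: test_funM => //; have := test_fun_cos k l (- (pi / 2)).
  by rewrite (_ : (fun x y => cos _) = fun x y => sin (k * x + l * y))//;
    apply/funext => x; apply/funext => y; rewrite cosD sinN cosN sin_pihalf cos_pihalf; ring.
move=> s t ph.
have tc s1 s2 s3 : test_fun (fun x y => h x y * cos (s1 * x + s2 * y + s3)).
  by apply: test_funM => //; exact: test_fun_cos.
pose f1 x y := h x y * cos ((s + k) * x + (t + l) * y + (ph - pi / 2)).
pose f2 x y := h x y * cos ((s - k) * x + (t - l) * y + (ph - pi / 2)).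
have E : (fun x y => h x y * sin (k * x + l * y) * cos (s * x + t * y + ph)) =
    (fun x y => 2^-1 * f1 x y + (- 2^-1) * f2 x y).
  apply/funext => x; apply/funext => y; rewrite /f1 /f2.
  have -> : (s + k) * x + (t + l) * y + (ph - pi / 2) =
    ((s * x + t * y + ph) + (k * x + l * y)) - pi / 2 by ring.
  have -> : (s - k) * x + (t - l) * y + (ph - pi / 2) =
    ((s * x + t * y + ph) - (k * x + l * y)) - pi / 2 by ring.
  move: (s * x + t * y + ph) (k * x + l * y) => al be.
  rewrite !(cosD _ (- (pi / 2))) sinN cosN sin_pihalf cos_pihalf sinB sinD.
  by field.
have t1 : test_fun f1 by exact: tc.
have t2 : test_fun f2 by exact: tc.
rewrite E L'_lin//.
rewrite (_ : (fun n => _) = fun n => 2^-1 * L n f1 + (- 2^-1) * L n f2).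
  by apply: cvgD; apply: cvgM; [exact: cvg_cst|exact: ch|exact: cvg_cst|exact: ch].
by apply/funext => n; rewrite L_lin.
Qed.

(** The recursion defining [bernstein] multiplies only by u and 1 - u, here affine in a sine, so
    [chars_sin] and linearity carry the induction. *)
Let chars_bernstein n k l (h : nat -> R -> R -> R) : (forall i, chars (h i)) ->
  chars (fun x y => bernstein n ((1 + sin (k * x + l * y)) / 2) (fun i => h i x y)).
Proof.
elim: n h => [|n IH] h ch /=; first exact: ch.
pose A x y := bernstein n ((1 + sin (k * x + l * y)) / 2) (fun i => h i.+1 x y).
pose B x y := bernstein n ((1 + sin (k * x + l * y)) / 2) (fun i => h i x y).
have cA : chars A by apply: (IH (fun i => h i.+1)).
have cB : chars B by exact: IH.
have := chars_lin 1 1 (chars_lin 2^-1 2^-1 cA (chars_sin k l cA))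
   (chars_lin 2^-1 (- 2^-1) cB (chars_sin k l cB)).
set F := (X in chars X -> _); set G := (X in _ -> chars X).
suff -> : F = G by [].
by apply/funext => x; apply/funext => y; rewrite /F /G -/(A x y) -/(B x y); field.
Qed.

Definition outside K (x y : R) : R := ((K < `|x|) || (K < `|y|))%:R.

Hypothesis tight : forall e, 0 < e -> exists2 K, 0 < K &
  forall n, \int[P]_w (`|psi w| * outside K (U n w) (V n w)) <= e.
Hypothesis tight' : forall e, 0 < e -> exists2 K, 0 < K &
  \int[Q]_w (`|psi' w| * outside K (U' w) (V' w)) <= e.

Lemma test_fun_outside K : test_fun (outside K).
Proof.
split; last by exists 1 => x y; rewrite /outside ger0_norm// lern1 leq_b1.
have m1 : measurable [set z : R * R | K < `|z.1| ].
  have mf : measurable_fun setT (fun z : R * R => `|z.1|) by exact: measurableT_comp.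
  rewrite -[X in measurable X]setTI.
  rewrite (_ : [set z : R * R | K < `|z.1|] = (fun z : R * R => `|z.1|) @^-1` `]K, +oo[).
    exact: mf.
  by apply/seteqP; split => z /=; rewrite in_itv/= andbT.
have m2 : measurable [set z : R * R | K < `|z.2| ].
  have mf : measurable_fun setT (fun z : R * R => `|z.2|) by exact: measurableT_comp.
  rewrite -[X in measurable X]setTI.
  rewrite (_ : [set z : R * R | K < `|z.2|] = (fun z : R * R => `|z.2|) @^-1` `]K, +oo[).
    exact: mf.
  by apply/seteqP; split => z /=; rewrite in_itv/= andbT.
rewrite (_ : (fun z => _) = \1_([set z : R * R | K < `|z.1| ] `|` [set z : R * R | K < `|z.2| ])).
  by apply: measurable_indic; exact: measurableU.
apply/funext => z; rewrite /outside indicE; congr (nat_of_bool _)%:R.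
by apply/idP/idP; rewrite inE/= => /orP.
Qed.

Let outside_le K K' x y : K <= K' -> outside K' x y <= outside K x y.
Proof.
move=> KK; rewrite /outside; have [out|_] := boolP ((K' < _) || _); last exact: ler0n.
suff -> : (K < `|x|) || (K < `|y|) by [].
by case/orP: out => /(le_lt_trans KK) ->; rewrite ?orbT.
Qed.

(** On the box, h is a continuous function F of (1 + sin (k x)) / 2 and (1 + sin (k y)) / 2, and a
    Bernstein polynomial of F belongs to [chars]. Off the box both are bounded by M, and tightness
    makes the discrepancy small. *)
Theorem cos_cvg_continuous h : test_fun h -> continuous (fun z : R * R => h z.1 z.2) ->
  L n h @[n --> \oo] --> L' h.
Proof.
move=> th ch; apply/cvgrPdist_le => e e0.
have [M hM] : exists M, forall x y, `|h x y| <= M by case: th.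
have M0 : 0 <= M by rewrite (le_trans _ (hM 0 0)).
have [Mp psiM] : exists M, forall w, `|psi w| <= M by case: mpsi.
have [Mp' psiM'] : exists M, forall w, `|psi' w| <= M by case: mpsi'.
have Mp0 : 0 <= Mp by rewrite (le_trans _ (psiM point)).
have Mp'0 : 0 <= Mp' by rewrite (le_trans _ (psiM' point)).
(* The sum of the three error coefficients at the end: Mp + 2 M, Mp' + 2 M and 1. *)
pose D := Mp + Mp' + 4 * M + 1.
have D0 : 0 < D by rewrite /D; lra.
pose e1 := e / D; have e10 : 0 < e1 by rewrite divr_gt0.
have [K1 K10 tK1] := tight e10; have [K2 K20 tK2] := tight' e10.
pose K := Num.max K1 K2.
have K0 : 0 < K by rewrite lt_max K10.
(* For |x| <= K the angle k x stays within pi / 4 of 0, where the sine is injective and bounded away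
   from 1 and -1. *)
pose k := pi / 4 / K.
have pi0 : 0 < pi :> R by exact: pi_gt0.
have k0 : 0 < k by rewrite !divr_gt0.
pose a : R := sin (pi / 4).
have in_pi (z : R) : - (pi / 4) <= z <= pi / 4 -> z \in `[- (pi / 2), pi / 2].
  by move=> /andP[z1 z2]; rewrite in_itv/=; apply/andP; split; lra.
have a0 : 0 < a by apply: sin_gt0_pihalf; apply/andP; split; lra.
have a1 : a < 1.
  rewrite -sin_pihalf /a ltr_sin; first by lra.
    by apply: in_pi; rewrite lexx andbT; lra.
  by rewrite in_itv/= lexx andbT; lra.
(* Clipping keeps the argument of [asin] inside the open interval of its continuity, so [tau] is
   continuous on the whole line while still inverting the sine on the box. *)
pose clip (z : R) := Num.max (- a) (Num.min a z).
have clip_in z : -1 < clip z < 1.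
  by rewrite /clip lt_max gt_max gt_min a1 ltrN2 a1/=; lra.
have cclip : continuous clip.
  move=> z; apply: (@continuous_max R R (fun=> - a) (fun z => Num.min a z)); first exact: cvg_cst.
  by apply: (@continuous_min R R (fun=> a) id); [exact: cvg_cst|exact: cvg_id].
pose tau (u : R) := asin (clip (2 * u - 1)) / k.
have caff : continuous (fun u : R => 2 * u - 1).
  by move=> u; apply: cvgB; [apply: cvgM; [exact: cvg_cst|exact: cvg_id]|exact: cvg_cst].
have ccl : continuous (fun u : R => clip (2 * u - 1)).
  by move=> u; apply: continuous_comp (caff u) _; exact: cclip.
have casin : continuous (fun u : R => asin (clip (2 * u - 1))).
  by move=> u; apply: continuous_comp (ccl u) _; exact: continuous_asin.
have ctau : continuous tau.
  by move=> u; apply: cvgM; [exact: casin|exact: cvg_cst].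
have tauE x : `|x| <= K -> tau ((1 + sin (k * x)) / 2) = x.
  move=> xK; rewrite /tau [2 * _ - 1](_ : _ = sin (k * x)); last by field.
  have kx : - (pi / 4) <= k * x <= pi / 4.
    rewrite -ler_norml normrM (gtr0_norm k0) /k mulrAC ler_pdivrMr//.
    by rewrite ler_wpM2l//; lra.
  have kx2 := in_pi _ kx.
  have pp : - (pi / 4) <= (pi / 4 : R) <= pi / 4 by rewrite lexx andbT; lra.
  have pn : - (pi / 4) <= (- (pi / 4) : R) <= pi / 4 by rewrite lexx/=; lra.
  have mono := ltr_sin (R := R).
  have s1 : sin (k * x) <= a.
    by rewrite leNgt mono ?in_pi// -leNgt; case/andP: kx.
  have s2 : - a <= sin (k * x).
    by rewrite -sinN leNgt mono ?in_pi// -leNgt; case/andP: kx.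
  have -> : clip (sin (k * x)) = sin (k * x).
    by rewrite /clip (min_idPr s1) (max_idPr s2).
  by rewrite sinK// mulrC mulKf// gt_eqF.
pose F (z : R * R) := h (tau z.1) (tau z.2).
have cF : continuous F.
  have c1 : continuous (fun z : R * R => tau z.1).
    by move=> z; apply: (continuous_comp (@cvg_fst _ _ _ _ _)); exact: ctau.
  have c2 : continuous (fun z : R * R => tau z.2).
    by move=> z; apply: (continuous_comp (@cvg_snd _ _ _ _ _)); exact: ctau.
  have cc : continuous (fun z : R * R => (tau z.1, tau z.2)).
    by move=> z; exact: (cvg_pair (c1 z) (c2 z)).
  by move=> z; exact: (continuous_comp (cc z) (ch (tau z.1, tau z.2))).
have [n n0 approx] := bernstein2_approx cF e10.
pose u x y : R := (1 + sin (k * x + 0 * y)) / 2.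
pose v x y : R := (1 + sin (0 * x + k * y)) / 2.
have sin01 (z : R) : 0 <= (1 + sin z) / 2 <= 1.
  by have := sin_geN1 z; have := sin_le1 z; lra.
pose p x y := bernstein2 n (u x y) (v x y) (fun x y => F (x, y)).
have cp : chars p.
  apply: (@chars_bernstein n k 0 (fun i x y => bernstein n (v x y) (fun j => F (i%:R / n%:R, j%:R / n%:R)))).
  move=> i; apply: (@chars_bernstein n 0 k (fun j x y => F (i%:R / n%:R, j%:R / n%:R))).
  by move=> j; exact: chars_cst.
have tp : test_fun p by case: cp.
have pM x y : `|p x y| <= M by apply: bernstein2_bound; rewrite ?sin01// => ? ?; exact: hM.
have hp x y : `|h x y - p x y| <= e1 + 2 * M * outside K x y.
  have [out|] := boolP ((K < `|x|) || (K < `|y|)).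
    rewrite /outside out mulr1 (le_trans (ler_normB _ _))//.
    by have := hM x y; have := pM x y; lra.
  rewrite negb_or -!leNgt => /andP[xK yK].
  have -> : outside K x y = 0 by rewrite /outside !ltNge xK yK.
  rewrite mulr0 addr0 distrC.
  have -> : h x y = F (u x y, v x y).
    by rewrite /F /u /v /= !mul0r addr0 add0r !tauE.
  by apply: approx; exact: sin01.
have to : test_fun (outside K) by exact: test_fun_outside.
have err d1 (T1 : measurableType d1) (P1 : probability T1 R) (f : T1 -> R) (X Y : T1 -> R) m K3 :
    bmfun f -> (forall w, `|f w| <= m) -> measurable_fun setT X -> measurable_fun setT Y ->
    K3 <= K -> \int[P1]_w (`|f w| * outside K3 (X w) (Y w)) <= e1 ->
    `|\int[P1]_w (f w * h (X w) (Y w)) - \int[P1]_w (f w * p (X w) (Y w))| <= e1 * (m + 2 * M).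
  move=> mf fm mX mY K3K tK3.
  have b1 := test_fun_comp th mX mY; have b2 := test_fun_comp tp mX mY.
  have b3 := test_fun_comp to mX mY; have b4 := test_fun_comp (test_fun_outside K3) mX mY.
  rewrite -expectB; [|by bmf..].
  apply: le_trans (expect_norm _ _) _; first by bmf.
  apply: (@le_trans _ _ (\int[P1]_w (m * e1 + 2 * M * (`|f w| * outside K3 (X w) (Y w))))).
    apply: expect_le => [||w]; [by bmf..|].
    rewrite -mulrBr normrM (le_trans (ler_wpM2l (normr_ge0 _) (hp _ _)))//.
    rewrite mulrDr lerD//; first by rewrite ler_wpM2r// ltW.
    rewrite mulrCA ler_wpM2l ?mulr_ge0// ler_wpM2l//; exact: outside_le.
  rewrite expectD; [|by bmf..]; rewrite expect_cst expectZ; last by bmf.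
  rewrite mulrDr [m * _]mulrC lerD2l mulrC ler_wpM2r// mulr_ge0//.
have [_ /(_ 0 0 0)] := cp.
rewrite (_ : (fun x y => _) = p); last first.
  by apply/funext => x; apply/funext => y; rewrite !mul0r !addr0 cos0 mulr1.
move=> /cvgrPdist_le /(_ _ e10); apply: filterS => m pm.
have E1 := err _ _ P psi (U m) (V m) Mp K1 mpsi psiM (mU m) (mV m).
have E2 := err _ _ Q psi' U' V' Mp' K2 mpsi' psiM' mU' mV'.
have {}E1 : `|L m h - L m p| <= e1 * (Mp + 2 * M) by apply: E1; rewrite ?le_max ?lexx.
have {}E2 : `|L' h - L' p| <= e1 * (Mp' + 2 * M) by apply: E2; rewrite ?le_max ?lexx ?orbT.
have -> : L' h - L m h = (L' h - L' p) + (L' p - L m p) - (L m h - L m p) by ring.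
have -> : e = e1 * (Mp' + 2 * M) + e1 + e1 * (Mp + 2 * M).
  by rewrite /e1 /D; field; rewrite gt_eqF.
rewrite (le_trans (ler_normB _ _))// lerD// (le_trans (ler_normD _ _))// lerD//.
Qed.

End cos_determining.

(** * Kernels and Gaussian measures on column vectors *)

Section borel_vectors.
Context (R : realType) (k : nat).

(** An open set is a countable union of balls with rational centres and radii 1 / (n + 1); for the
    sup norm, the preimage of such a ball is a finite intersection of conditions on coordinates. *)
Lemma measurable_borelV d (T : measurableType d) (f : T -> 'cV[R]_k) :
  (forall i, measurable_fun setT (fun w => f w i 0)) ->
  measurable_fun setT (f : T -> borelV R k).
Proof.
move=> mf; apply: (@measurability _ _ T (borelV R k) setT f (@open 'cV[R]_k)) => //.
move=> _ [U oU <-]; rewrite setTI.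
pose B (qn : 'cV[rat]_k * nat) : set 'cV[R]_k :=
  @ball R 'cV[R]_k (map_mx (@ratr R) qn.1) (qn.2.+1%:R^-1 : R).
have -> : f @^-1` U = \bigcup_(qn : 'cV[rat]_k * nat)
    (if `[< B qn `<=` U >] then f @^-1` B qn else set0).
  apply/seteqP; split => [w Uw|w [qn _]]; last by case: asboolP => // BU /BU.
  have [e e0 eU] : exists2 e : R, 0 < e & ball (f w) e `<=` U.
    by have /nbhs_ballP[e e0 eU] := open_nbhs_nbhs (conj oU Uw); exists e.
  have e2 : 0 < e / 2 by rewrite divr_gt0.
  have [n ne] : exists n : nat, (n.+1%:R^-1 : R) < e / 2.
    have [n _ hn] := near_infty_natSinv_lt (PosNum e2).
    by exists n; exact: (hn n (leqnn n)).
  have /choice[q hq] i : exists q : rat, `|f w i 0 - ratr q| < n.+1%:R^-1.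
    have lt : f w i 0 - n.+1%:R^-1 < f w i 0 + n.+1%:R^-1.
      by rewrite ltrBlDr -addrA ltrDl addr_gt0// invr_gt0.
    have [q] := rat_in_itvoo lt.
    by rewrite in_itv/= => h; exists q; rewrite ltr_distlC.
  exists (\col_i q i, n) => //.
  have fB : B (\col_i q i, n) (f w).
    split=> [|i j]; first by rewrite invr_gt0.
    by rewrite !mxE ord1 /ball/= distrC.
  case: asboolP => // H; exfalso; apply: H => y By; apply: eU.
  rewrite (splitr e); have b1 := le_ball (ltW ne) (ball_sym fB).
  exact: ball_triangle b1 (le_ball (ltW ne) By).
apply: countable_bigcupT_measurable => // -[q n].
case: asboolP => // _.
have -> : f @^-1` B (q, n) = \bigcap_(i in [set: 'I_k])
    ((fun w => f w i 0) @^-1` ball (ratr (q i 0) : R) (n.+1%:R^-1 : R)).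
  apply/seteqP; split => [w [_ Bw] i _|w Bw].
    by have := Bw i 0; rewrite mxE.
  by split=> [|i j]; [rewrite invr_gt0|rewrite mxE ord1; exact: Bw].
apply: fin_bigcap_measurable => // i _.
rewrite -[X in measurable X]setTI; apply: mf => //.
apply: open_measurable; exact: ball_open.
Qed.

Lemma continuous_bounded_borelV (f : 'cV[R]_k -> R) M : continuous f ->
  (forall x, `|f x| <= M) -> @bmfun _ (borelV R k) R f.
Proof.
move=> cf fM; split; last by exists M.
apply: (measurability _ (RGenOpens.measurableE R)) => _ [_ [a [b ->]] <-].
rewrite setTI; apply: sub_sigma_algebra.
by move/continuousP: cf; apply; exact: interval_open.
Qed.

End borel_vectors.

Lemma expect_prod d1 d2 (T1 : measurableType d1) (T2 : measurableType d2) (R : realType)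
    (P1 : probability T1 R) (P2 : probability T2 R) (f : T1 * T2 -> R) : bmfun f ->
  \int[(P1 \x P2)%E]_z f z = \int[P1]_x (\int[P2]_y f (x, y)).
Proof.
move=> mf; have intf := bmfun_integrable (P1 \x P2)%E mf.
have m2 x : bmfun (fun y => f (x, y)).
  case: mf => mf [M fM]; split; last by exists M => y; exact: fM.
  exact: measurableT_comp mf (measurable_pair1 _).
rewrite /Rintegral -integral12_prod_meas1//; congr fine.
apply: eq_integral => x _; rewrite fineK//.
exact: (integrable_fin_num measurableT (bmfun_integrable P2 (m2 x))).
Qed.

Section conditional_law.
Context d (T : measurableType d) (R : realType) (P : probability T R) (k : nat).
Variables (H : set T) (Y : T -> borelV R k).
Hypothesis mH : measurable H.
Hypothesis PH : (0 < P H)%E.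
Hypothesis mY : measurable_fun setT Y.
Local Notation law := (cond_law P H Y).

Let c0 : (0 <= (fine (P H))^-1%:E)%E.
Proof. by rewrite lee_fin invr_ge0 fine_ge0. Qed.

Let PHf : P H \is a fin_num. Proof. exact: fin_num_measure. Qed.

Let mYB B : measurable B -> measurable (Y @^-1` B `&` H).
Proof. by move=> mB; apply: measurableI => //; rewrite -[X in measurable X]setTI; exact: mY. Qed.

Let law0 : law set0 = 0%E.
Proof. by rewrite /cond_law preimage_set0 set0I measure0 mule0. Qed.

Let law_ge0 B : (0 <= law B)%E.
Proof. by rewrite /cond_law mule_ge0. Qed.

Let law_sigma_additive : semi_sigma_additive law.
Proof.
move=> F mF tF mUF; rewrite [X in X @ \oo --> _](_ : _ =
    (fun n => (fine (P H))^-1%:E * \sum_(0 <= i < n) P (Y @^-1` F i `&` H))%E); last first.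
  by apply/funext => n; rewrite ge0_sume_distrr.
apply: cvgeZl => //; rewrite preimage_bigcup setI_bigcupl.
apply: measure_semi_sigma_additive => //; first by move=> i; exact: mYB.
  apply/trivIsetP => i j _ _ ij; rewrite setIACA -preimage_setI.
  by move/trivIsetP : tF => /(_ _ _ _ _ ij) ->//; rewrite preimage_set0 set0I.
by rewrite -setI_bigcupl -preimage_bigcup; exact: mYB.
Qed.

HB.instance Definition _ := isMeasure.Build _ _ _ law law0 law_ge0 law_sigma_additive.

Let law_setT : law setT = 1%E.
Proof.
rewrite /cond_law preimage_setT setTI -[X in (_ * X)%E]fineK// -EFinM mulVf//.
by rewrite gt_eqF// fine_gt0// PH ltey_eq PHf.
Qed.

HB.instance Definition _ := Measure_isProbability.Build _ _ _ law law_setT.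

(** Checked on staircases, where it is the definition of the law, and extended by uniform
    approximation. *)
Lemma integral_cond_law (f : borelV R k -> R) : bmfun f ->
  (\int[law]_x (f x)%:E)%E = ((fine (P H))^-1 * \int[P]_w (\1_H w * f (Y w)))%:E.
Proof.
move=> mf.
have mfY : bmfun (fun w => f (Y w)).
  by case: mf => mf [M fM]; split; [exact: measurableT_comp|exists M].
have mH1 := bmfun_indic R mH.
have intf := bmfun_integrable law mf.
rewrite -[LHS]fineK; last exact: integrable_fin_num intf.
congr EFin; rewrite -/(Rintegral law setT f).
pose cc := (fine (P H))^-1; have cc0 : 0 <= cc by rewrite -lee_fin.
have ccH : cc * Rintegral P setT \1_H = 1.
  rewrite expect_indic// mulVf// gt_eqF// fine_gt0// PH ltey_eq PHf//.
apply/eqP; rewrite -subr_eq0 -normr_le0; apply/ler_addgt0Pr => e e0; rewrite add0r.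
have e2 : 0 < e / 2 by rewrite divr_gt0.
have [K [a [b [B [mB gB]]]]] := bmfun_simple_approx mf e2.
pose s x := a + b * \sum_i \1_(B i) x : R.
have mB1 i : @bmfun _ (borelV R k) R \1_(B i) by exact: bmfun_indic.
have ms : @bmfun _ (borelV R k) R s.
  by apply: bmfunD; [exact: bmfun_cst|apply: bmfunZ; exact: bmfun_sum].
have msY : bmfun (fun w => s (Y w)).
  by case: ms => ms [M sM]; split; [exact: measurableT_comp|exists M].
have mYi i : bmfun (\1_(Y @^-1` B i `&` H) : T -> R).
  by apply: bmfun_indic; exact: mYB.
have Es : Rintegral law setT s = cc * Rintegral P setT (fun w => \1_H w * s (Y w)).
  rewrite /s expectD; [|exact: bmfun_cst|by apply: bmfunZ; exact: bmfun_sum].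
  rewrite expect_cst expectZ; last exact: bmfun_sum.
  rewrite expect_sum//.
  have -> : (fun w => \1_H w * s (Y w)) =
      (fun w => a * \1_H w + b * \sum_i \1_(Y @^-1` B i `&` H) w).
    apply/funext => w; rewrite /s mulrDr mulrC; congr (_ + _).
    rewrite mulrCA; congr (_ * _); rewrite mulr_sumr; apply: eq_bigr => i _.
    by rewrite indicI/= mulrC !indicE.
  rewrite expectD; [|exact: bmfunZ|by apply: bmfunZ; exact: bmfun_sum].
  rewrite expectZ// expectZ; last exact: bmfun_sum.
  rewrite expect_sum// mulrDr [cc * (a * _)]mulrCA ccH mulr1; congr (_ + _).
  rewrite [RHS]mulrCA; congr (_ * _); rewrite mulr_sumr; apply: eq_bigr => i _.
  by rewrite expect_indic// expect_indic; [rewrite fineM//; exact: fin_num_measure (mYB (mB i))|exact: mYB].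
have ED : Rintegral P setT (fun w => \1_H w * (f (Y w) - s (Y w))) =
    Rintegral P setT (fun w => \1_H w * f (Y w)) - Rintegral P setT (fun w => \1_H w * s (Y w)).
  by rewrite -expectB; [|by bmf..]; apply: eq_Rintegral => w _; rewrite mulrBr.
have -> : Rintegral law setT f - cc * Rintegral P setT (fun w => \1_H w * f (Y w)) =
    Rintegral law setT (fun x => f x - s x) -
    cc * Rintegral P setT (fun w => \1_H w * (f (Y w) - s (Y w))).
  by rewrite ED expectB// Es; ring.
rewrite (le_trans (ler_normB _ _))// [e]splitr lerD//.
  by apply: expect_bound; [exact: bmfunB|move=> x; exact: gB].
rewrite normrM (ger0_norm cc0).
apply: (@le_trans _ _ (cc * (e / 2 * Rintegral P setT \1_H))); last by rewrite mulrCA ccH mulr1.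
rewrite ler_wpM2l//.
have mD : bmfun (fun w => \1_H w * (f (Y w) - s (Y w))) by bmf.
rewrite (le_trans (expect_norm _ mD))// -expectZ//.
apply: expect_le => [| |w]; [by bmf|by bmf|].
by rewrite normrM mulrC (@ger0_norm _ (\1_H w))// ler_wpM2r// gB.
Qed.

End conditional_law.

Lemma tight_measurable d (T : measurableType d) (R : realType) (P : probability T R)
    (psi U V : T -> R) e : bmfun psi -> measurable_fun setT U ->
  measurable_fun setT V -> 0 < e ->
  exists2 K, 0 < K & \int[P]_w (`|psi w| * outside K (U w) (V w)) <= e.
Proof.
move=> mpsi mU mV e0.
have mF n : bmfun (fun w => `|psi w| * outside n.+1%:R (U w) (V w)).
  apply: bmfunM; first exact: bmfun_norm.
  exact: test_fun_comp (@test_fun_outside R n.+1%:R) mU mV.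
have [M hM] : exists M, forall w, `|psi w| <= M by case: mpsi.
have H : \int[P]_w (`|psi w| * outside n.+1%:R (U w) (V w)) @[n --> \oo] -->
    \int[P]_w (fun=> 0 : R) w.
  apply: (expect_dominated (M := M)) => //; first exact: bmfun_cst.
    move=> n w; rewrite normrM normr_id -[leRHS]mulr1 ler_pM//.
    by rewrite /outside ger0_norm// lern1 leq_b1.
  apply: aeW => w; apply: cvg_near_cst; near=> n.
  have hn : Num.max `|U w| `|V w| <= n%:R by near: n; exact: nbhs_infty_ger.
  move: hn; rewrite ge_max => /andP[hU hV].
  rewrite /outside !ltNge (le_trans hU) ?(le_trans hV) ?ler_nat//= ?mulr0//.
rewrite (expect_cst P 0) in H.
have [n _ hn] : \forall n \near \oo, \int[P]_w (`|psi w| * outside n.+1%:R (U w) (V w)) <= e.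
  by have := H => /cvgr_le; apply.
by exists n.+1%:R => //; exact: (hn n (leqnn n)).
Unshelve. all: by end_near. Qed.

(** [cos_cvg_continuous] along a constant sequence identifies the integrals of bounded continuous
    functions; ramps then give the half-lines, a generating pi-system. *)
Lemma cos_law_unique d (T : measurableType d) (R : realType) (P : probability T R)
    (nu : probability (measurableTypeR R) R) (U : T -> R) : measurable_fun setT U ->
  (forall s th, \int[P]_w cos (s * U w + th) = \int[nu]_x cos (s * x + th)) ->
  forall B, measurable B -> P (U @^-1` B) = nu B.
Proof.
move=> mU Ucos.
have Uphi (phi : R -> R) M : continuous phi -> (forall x, `|phi x| <= M) ->
    \int[P]_w phi (U w) = \int[nu]_x phi x.
  move=> cphi phiM.
  have tphi : test_fun (fun x _ : R => phi x).
    split; last by exists M.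
    by apply: measurableT_comp => //; exact: continuous_measurable_fun.
  (* The planar theorem is used with second coordinate 0. *)
  have := @cos_cvg_continuous R _ T P _ _ nu (fun=> 1) (fun=> 1) (fun _ => U)
    (fun _ _ => 0) id (fun=> 0) (bmfun_cst _ _) (bmfun_cst _ _)
    (fun _ => mU) (fun _ => @measurable_cst _ _ _ _ _ _) (@measurable_id _ _ _) (@measurable_cst _ _ _ _ _ _) _ _ _
    (fun x _ => phi x) tphi _.
  have cvg : forall s t th, (fun=> \int[P]_w (1 * cos (s * U w + t * 0 + th))) n @[n --> \oo] -->
      \int[nu]_x (1 * cos (s * x + t * 0 + th)).
    move=> s t th; rewrite [X in _ --> X](_ : _ = \int[P]_w (1 * cos (s * U w + t * 0 + th))).
      exact: cvg_cst.
    under eq_Rintegral do rewrite mulr0 addr0 mul1r.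
    by under [RHS]eq_Rintegral do rewrite mulr0 addr0 mul1r.
  move=> /(_ cvg) H.
  have {}H : (fun=> \int[P]_w (1 * phi (U w))) n @[n --> \oo] --> \int[nu]_x (1 * phi x).
    apply: H => [e e0|e e0|z].
    - have [K K0 hK] := tight_measurable P (V := fun=> 0) (bmfun_cst T 1) mU (@measurable_cst _ _ _ _ _ _) e0.
      by exists K => // _; exact: hK.
    - exact: (tight_measurable nu (U := id) (V := fun=> 0) (bmfun_cst (measurableTypeR R) 1) (@measurable_id _ _ _) (@measurable_cst _ _ _ _ _ _) e0).
    - by apply: (@continuous_comp _ _ _ fst phi); [exact: cvg_fst|exact: cphi].
  have : \int[nu]_x (1 * phi x) = \int[P]_w (1 * phi (U w)).
    by apply: (cvg_unique _ H) => //; exact: cvg_cst.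
  under eq_Rintegral do rewrite mul1r.
  by under [X in _ = X -> _]eq_Rintegral do rewrite mul1r.
have mUR : measurable_fun setT (U : T -> measurableTypeR R) by [].
pose X := mfun_Sub (mem_set mUR : (U : T -> measurableTypeR R) \in mfun).
move=> B mB; rewrite -[LHS]/(distribution P X B).
refine (@measure_unique _ R (measurableTypeR R) (@RGenInftyO.G R) (fun n => `]-oo, n%:R[%classic) _ _ _ _
  (distribution P X) nu _ _ B mB).
- exact: RGenInftyO.measurableE.
- move=> _ _ [x ->] [y ->]; exists (Num.min x y).
  by apply/seteqP; split => z /=; rewrite !in_itv/= lt_min => /andP//; case.
- by move=> n; exists n%:R.
- apply/seteqP; split => // x _.
  have [n _ hn] := nbhs_infty_gtr x.
  by exists n => //=; rewrite in_itv/=; exact: hn n (leqnn n).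
- move=> _ [a ->]; rewrite /distribution/= /pushforward.
  (* Continuous ramps converging pointwise to the indicator of the open half-line below a. *)
  pose phi (n : nat) (x : R) := Num.min 1 (Num.max 0 (n%:R * (a - x))).
  have phi1 n x : `|phi n x| <= 1.
    by rewrite ger0_norm /phi ?ge_min ?lexx// le_min ler01 le_max lexx.
  have cphi n : continuous (phi n).
    have c1 : continuous (fun x : R => n%:R * (a - x)).
      move=> x; apply: cvgM; first exact: cvg_cst.
      by apply: cvgB; [exact: cvg_cst|exact: cvg_id].
    have c2 : continuous ((fun=> 0 : R) \max (fun x : R => n%:R * (a - x))).
      by move=> x; apply: continuous_max; [exact: cst_continuous|exact: c1].
    have : continuous ((fun=> 1 : R) \min ((fun=> 0 : R) \max (fun x : R => n%:R * (a - x)))).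
      by move=> x; apply: continuous_min; [exact: cst_continuous|exact: c2].
    by [].
  have phil x : phi n x @[n --> \oo] --> (\1_(`]-oo, a[) x : R).
    apply: cvg_near_cst; rewrite indicE mem_setE in_itv/=; near=> n.
    rewrite /phi; case: ltP => xa.
      apply/min_idPl; rewrite le_max; apply/orP; right.
      have ax : 0 < a - x by rewrite subr_gt0.
      rewrite -ler_pdivrMr// div1r; near: n; exact: nbhs_infty_ger.
    have -> : Num.max 0 (n%:R * (a - x)) = 0.
      by apply/max_idPl; rewrite mulr_ge0_le0// subr_le0.
    by apply/min_idPr.
  have mphi n : bmfun (phi n) by split; [exact: continuous_measurable_fun|exists 1].
  have mI : bmfun (\1_(`]-oo, a[) : R -> R) by exact: bmfun_indic.
  have mphiU n : bmfun (fun w => phi n (U w)).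
    by split; [apply: measurableT_comp => //; case: (mphi n)|exists 1].
  have mIU : bmfun (fun w => \1_(`]-oo, a[) (U w) : R).
    by case: mI => mI [N IN]; split; [exact: measurableT_comp|exists N].
  have L1 : \int[P]_w phi n (U w) @[n --> \oo] --> \int[P]_w \1_(`]-oo, a[) (U w).
    by apply: (expect_dominated (M := 1)) => //; apply: aeW => w; exact: phil.
  have L2 : \int[nu]_x phi n x @[n --> \oo] --> \int[nu]_x \1_(`]-oo, a[) x.
    by apply: (expect_dominated (M := 1)) => //; apply: aeW => w; exact: phil.
  rewrite (_ : (fun n => \int[P]_w phi n (U w)) = (fun n => \int[nu]_x phi n x)) in L1; last first.
    by apply/funext => n; apply: (Uphi _ 1).
  have mUa : measurable (U @^-1` `]-oo, a[) by rewrite -[X in measurable X]setTI; apply: (mU).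
  have e : Rintegral P setT \1_(U @^-1` `]-oo, a[) = Rintegral nu setT \1_(`]-oo, a[).
    by apply: (cvg_unique _ L1 L2).
  rewrite !expect_indic// in e; have := congr1 EFin e.
  by rewrite !fineK//; exact: fin_num_measure.
- by move=> n; rewrite (le_lt_trans (probability_le1 _ _))// ltry.
Unshelve. all: by end_near. Qed.

(** * Planar Gaussian laws and the kernels built from them *)

Section gaussian_plane.
Context (R : realType).
Local Notation gam := (normal_prob (0 : R) 1).
Local Notation TR := (measurableTypeR R).

Definition std_gauss2 : probability (TR * TR)%type R := (gam \x gam)%E.
Local Notation gg := std_gauss2.

Lemma gaussian_plane_charfun (s t th : R) :
  \int[gg]_z cos (s * z.1 + t * z.2 + th) = expR (- ((s ^+ 2 + t ^+ 2) / 2)) * cos th.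
Proof.
rewrite -[LHS]/(\int[(gam \x gam)%E]_z cos (s * z.1 + t * z.2 + th)) expect_prod; last first.
  by apply: (@test_fun_comp _ _ _ (fun x y => cos (s * x + t * y + th))) => //; exact: test_fun_cos.
under eq_Rintegral => x _.
  under eq_Rintegral => y _ do rewrite [s * x + _]addrC -addrA.
  rewrite normal_charfun//; over.
rewrite expectZ; last exact: bmfun_cos_affine.
by rewrite normal_charfun// mulrA -expRD; congr (expR _ * _); field.
Qed.

(** Zero variance, where [gauss1] is a Dirac mass, means al = be = 0 and the form vanishes
    identically; otherwise the characters agree. *)
Lemma gaussian_plane_linear (al be : R) (B : set R) : measurable B ->
  gg [set z | B (al * z.1 + be * z.2)] = gauss1 0 (al ^+ 2 + be ^+ 2) B.
Proof.
move=> mB; rewrite /gauss1; case: eqVneq => [|n0].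
  move/eqP; rewrite paddr_eq0 ?sqr_ge0// !sqrf_eq0 => /andP[/eqP -> /eqP ->].
  have -> : [set z : R * R | B (0 * z.1 + 0 * z.2)] = (if `[< B 0 >] then setT else set0).
    by apply/seteqP; split => z /=; rewrite !mul0r addr0; case: asboolP.
  rewrite diracE; case: asboolP => B0; first by rewrite mem_set// probability_setT.
  by rewrite memNset// measure0.
have p0 : 0 < al ^+ 2 + be ^+ 2 by rewrite lt_neqAle eq_sym n0 addr_ge0// sqr_ge0.
have mU : measurable_fun [set: measurableTypeR R * measurableTypeR R]
    (fun z => al * z.1 + be * z.2 : R).
  by apply: measurable_funD; apply: measurable_funM.
have := @cos_law_unique _ _ R gg (normal_prob 0 (Num.sqrt (al ^+ 2 + be ^+ 2))) _ mU.
apply => // s th.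
rewrite normal_charfun ?sqrtr_gt0// sqr_sqrtr ?(ltW p0)//.
under eq_Rintegral do rewrite mulrDr !mulrA.
by rewrite gaussian_plane_charfun !exprMn; congr (expR (- (_ / 2)) * _); ring.
Qed.

End gaussian_plane.

Section randomized_kernel.
Context d (T : measurableType d) d' (Z : measurableType d') (R : realType) (k : nat).
Variables (P : probability T R) (Q : probability Z R) (Phi : T * Z -> borelV R k).
Hypothesis mPhi : measurable_fun setT Phi.

Lemma measurable_Phi_section w : measurable_fun setT (fun z : Z => Phi (w, z)).
Proof. exact: (measurableT_comp mPhi (measurable_pair1 w)). Qed.

(** The kernel is realised as the law of a function of w and an independent variable z, so its
    measurability in w is that of sections of a product set. *)
Definition rand_kernel (w : T) : {measure set (borelV R k) -> \bar R} :=
  distribution Q (mfun_Sub (mem_set (measurable_Phi_section w))).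

Lemma rand_kernelE w B : rand_kernel w B = Q [set z | B (Phi (w, z))].
Proof. by []. Qed.

Lemma rand_kernel_xsection w B : rand_kernel w B = Q (xsection (Phi @^-1` B) w).
Proof.
by rewrite rand_kernelE; congr (Q _); apply/seteqP; split => z; rewrite /xsection/= inE.
Qed.

Let mPhiB B : measurable B -> measurable (Phi @^-1` B).
Proof. by move=> mB; rewrite -[X in measurable X]setTI; exact: mPhi. Qed.

Let measurable_rand_kernel U : measurable U -> measurable_fun setT (rand_kernel ^~ U).
Proof.
move=> mU; rewrite (_ : rand_kernel ^~ U = Q \o xsection (Phi @^-1` U)).
  exact: (measurable_fun_xsection Q (mPhiB mU)).
by apply/funext => w; rewrite rand_kernel_xsection.
Qed.

HB.instance Definition _ := isKernel.Build _ _ _ _ _ rand_kernel measurable_rand_kernel.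

Let rand_kernel_setT w : rand_kernel w setT = 1%E.
Proof. exact: probability_setT. Qed.

HB.instance Definition _ := Kernel_isProbability.Build _ _ _ _ _ rand_kernel rand_kernel_setT.

(** The mixture becomes a conditional law on the enlarged space, so that [integral_cond_law]
    computes both sides of a stable limit. *)
Lemma rand_kernel_mixture (H : set T) : measurable H -> cond_mixture P H rand_kernel =
  cond_law (P \x Q)%E (H `*` setT) Phi.
Proof.
move=> mH; apply/funext => B; rewrite /cond_mixture /cond_law.
rewrite [X in _ = ((fine X)^-1%:E * _)%E]product_measure1E//.
rewrite [X in (P H * X)%E](_ : _ = 1%E) ?mule1; last exact: probability_setT.
congr (_ * _)%E; rewrite integral_mkcond; apply: eq_integral => w _.
rewrite patchE /= xsectionI; case: ifPn => wH.
  by rewrite rand_kernel_xsection in_xsectionX// setIT.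
by rewrite notin_xsectionX// setI0 measure0.
Qed.

End randomized_kernel.

Section gaussian_kernel.
Context d (T : measurableType d) (R : realType) (k : nat).
Variables (a b : 'cV[R]_k) (s1 s2 : T -> R).
Hypothesis ms1 : measurable_fun setT s1.
Hypothesis ms2 : measurable_fun setT s2.
Local Notation TR := (measurableTypeR R).
Local Notation gg := (std_gauss2 R).

(** Two independent standard normals suffice, since the target covariance s1^2 a a^T + s2^2 b b^T
    has rank at most 2; this is an explicit square root of it. *)
Definition gauss_map (z : T * (TR * TR)) : borelV R k :=
  (s1 z.1 * z.2.1 : R) *: a + (s2 z.1 * z.2.2 : R) *: b.

Lemma measurable_gauss_coord1 : measurable_fun setT (fun z : T * (TR * TR) => s1 z.1 * z.2.1 : R).
Proof.
apply: measurable_funM; first exact: (measurableT_comp ms1 measurable_fst).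
exact: (measurableT_comp measurable_fst (@measurable_snd _ _ T (TR * TR)%type)).
Qed.

Lemma measurable_gauss_coord2 : measurable_fun setT (fun z : T * (TR * TR) => s2 z.1 * z.2.2 : R).
Proof.
apply: measurable_funM; first exact: (measurableT_comp ms2 measurable_fst).
exact: (measurableT_comp measurable_snd (@measurable_snd _ _ T (TR * TR)%type)).
Qed.

Lemma measurable_gauss_map : measurable_fun setT gauss_map.
Proof.
apply: measurable_borelV => i.
rewrite [X in measurable_fun _ X](_ : _ = (fun z : T * (TR * TR) =>
   (s1 z.1 * z.2.1 : R) * a i 0 + (s2 z.1 * z.2.2 : R) * b i 0)).
  apply: measurable_funD; apply: measurable_funM => //.
    exact: measurable_gauss_coord1.
  exact: measurable_gauss_coord2.
by apply/funext => z; rewrite !mxE.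
Qed.

Lemma gauss_kernel_gaussian w :
  is_gaussian (rand_kernel gg measurable_gauss_map w) 0
    (s1 w ^+ 2 *: (a *m a^T) + s2 w ^+ 2 *: (b *m b^T)).
Proof.
move=> u B mB; pose ua := (u^T *m a) 0 0; pose ub := (u^T *m b) 0 0.
rewrite mulmx0 [X in gauss1 X]mxE.
have e (x : 'cV[R]_k) : (x^T *m u) 0 0 = (u^T *m x) 0 0 :> R.
  by rewrite -[u in LHS]trmxK -trmx_mul mxE.
have -> : (u^T *m (s1 w ^+ 2 *: (a *m a^T) + s2 w ^+ 2 *: (b *m b^T)) *m u) 0 0 =
    (s1 w * ua) ^+ 2 + (s2 w * ub) ^+ 2.
  have q (x : 'cV[R]_k) : (u^T *m (x *m x^T) *m u) 0 0 = (u^T *m x) 0 0 ^+ 2 :> R.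
    have -> : u^T *m (x *m x^T) *m u = (u^T *m x) *m (x^T *m u) by rewrite !mulmxA.
    by rewrite [LHS]mxE big_ord1 e expr2.
  by rewrite mulmxDr mulmxDl mxE -!scalemxAr -!scalemxAl mxE [X in _ + X]mxE !q !exprMn.
have lin z : (u^T *m gauss_map (w, z)) 0 0 = s1 w * ua * z.1 + s2 w * ub * z.2.
  rewrite /gauss_map mulmxDr -!scalemxAr [LHS]mxE [X in X + _ = _]mxE [X in _ + X = _]mxE.
  by rewrite -/ua -/ub /= mulrAC [X in _ + X]mulrAC.
rewrite rand_kernelE.
rewrite (_ : [set z | _] = [set z | B (s1 w * ua * z.1 + s2 w * ub * z.2)]).
  exact: gaussian_plane_linear.
by apply/seteqP; split => z; rewrite /mkset lin.
Qed.

End gaussian_kernel.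

(** * Stable convergence to a Gaussian mixture *)

Section stable_gaussian_limit.
Context d (T : measurableType d) (R : realType) (P : probability T R) (k : nat).
Variables (a b : 'cV[R]_k) (s1 s2 : T -> R) (U V : nat -> T -> R) (Y : nat -> T -> 'cV[R]_k).
Local Notation E := (Rintegral P setT).
Local Notation TR := (measurableTypeR R).
Local Notation gg := (std_gauss2 R).
Hypothesis ms1 : measurable_fun setT s1.
Hypothesis ms2 : measurable_fun setT s2.
Hypothesis mU : forall n, bmfun (U n).
Hypothesis mV : forall n, bmfun (V n).
Hypothesis mY : forall n i, bmfun (fun w => Y n w i 0).
Hypothesis UV_cos : forall psi s t th, bmfun psi ->
  E (fun w => psi w * cos (s * U n w + t * V n w + th)) @[n --> \oo] -->
  E (fun w => psi w * expR (- (((s * s1 w) ^+ 2 + (t * s2 w) ^+ 2) / 2))) * cos th.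
Hypothesis U_sqr : exists A, forall n, E (fun w => U n w ^+ 2) <= A.
Hypothesis V_sqr : exists A, forall n, E (fun w => V n w ^+ 2) <= A.

Let lin (x y : R) : 'cV[R]_k := x *: a + y *: b.
Let rem n w i := Y n w i 0 - lin (U n w) (V n w) i 0.

Hypothesis Y_rem : forall i,
  E (fun w => `|Y n w i 0 - (U n w * a i 0 + V n w * b i 0)|) @[n --> \oo] --> (0 : R).

Let remE n w i : rem n w i = Y n w i 0 - (U n w * a i 0 + V n w * b i 0).
Proof. by rewrite /rem !mxE. Qed.

Let mrem n i : bmfun (fun w => rem n w i).
Proof.
rewrite (_ : (fun w => rem n w i) = (fun w => Y n w i 0 - (U n w * a i 0 + V n w * b i 0))).
  have h1 := mU n; have h2 := mV n; have h3 := mY n i; by bmf.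
by apply/funext => w; rewrite remE.
Qed.

Let continuous_lin : continuous (fun z : R * R => lin z.1 z.2).
Proof.
move=> z; apply: cvgD; apply: cvgZr_tmp; [exact: cvg_fst|exact: cvg_snd].
Qed.

Let tight psi : bmfun psi -> (forall w, `|psi w| <= 1) -> forall e, 0 < e ->
  exists2 K, 0 < K & forall n, E (fun w => `|psi w| * outside K (U n w) (V n w)) <= e.
Proof.
move=> mpsi psi1 e e0; have [A1 hA1] := U_sqr; have [A2 hA2] := V_sqr.
(* Chebyshev's inequality needs K^2 >= (A1 + A2) / e; the +1 keeps K positive. *)
pose K := Num.sqrt ((`|A1| + `|A2|) / e) + 1.
have K0 : 0 < K by rewrite ltr_wpDl// sqrtr_ge0.
exists K => // n.
have h1 := mU n; have h2 := mV n.
have mo : bmfun (fun w => outside K (U n w) (V n w)).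
  by apply: (test_fun_comp (test_fun_outside K)); [case: h1|case: h2].
have Ksq : (`|A1| + `|A2|) / e <= K ^+ 2.
  have q0 : 0 <= (`|A1| + `|A2|) / e by apply: divr_ge0; [exact: addr_ge0|exact: ltW].
  rewrite -[leLHS]sqr_sqrtr// lerXn2r ?nnegrE ?sqrtr_ge0 ?(ltW K0)//.
  by rewrite /K lerDl.
apply: (@le_trans _ _ (E (fun w => K ^- 2 * (U n w ^+ 2 + V n w ^+ 2)))).
  apply: expect_le => [| |w]; [by bmf|by bmf|].
  have o0 : 0 <= outside K (U n w) (V n w) by rewrite /outside ler0n.
  rewrite (le_trans (ler_wpM2r o0 (psi1 w)))//.
  rewrite mul1r mulrC ler_pdivlMr ?exprn_gt0// /outside.
  have sq x : K < `|x| -> K ^+ 2 <= x ^+ 2.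
    move=> Kx; rewrite -[x ^+ 2]ger0_norm ?sqr_ge0// normrX lerXn2r ?nnegrE ?(ltW K0)//.
    exact: ltW.
  have [/orP[/sq Kx|/sq Kx]|_] := boolP (_ || _).
  - by rewrite mul1r (le_trans Kx)// lerDl sqr_ge0.
  - by rewrite mul1r (le_trans Kx)// lerDr sqr_ge0.
  - by rewrite mul0r addr_ge0 ?sqr_ge0.
rewrite expectZ; last by bmf.
rewrite expectD; [|by bmf..].
rewrite mulrC ler_pdivrMr ?exprn_gt0// mulrC -ler_pdivrMr//.
apply: le_trans Ksq; rewrite ler_pM2r ?invr_gt0// lerD//.
  by rewrite (le_trans (hA1 n))// ler_norm.
by rewrite (le_trans (hA2 n))// ler_norm.
Qed.

Section test_function.
Variables (f : 'cV[R]_k -> R) (M : R) (H : set T).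
Hypothesis cf : continuous f.
Hypothesis fM : forall x, `|f x| <= M.
Hypothesis mH : measurable H.

Let mfB : @bmfun _ (borelV R k) R f. Proof. exact: continuous_bounded_borelV cf fM. Qed.
Let h x y := f (lin x y).
Let M0 : 0 <= M := le_trans (normr_ge0 _) (fM 0).
Let mH1 : bmfun (\1_H : T -> R). Proof. exact: bmfun_indic. Qed.
Let H1 w : `|\1_H w : R| <= 1. Proof. by rewrite indicE ger0_norm// lern1 leq_b1. Qed.

Let continuous_h : continuous (fun z : R * R => h z.1 z.2).
Proof. by move=> z; exact: (continuous_comp (@continuous_lin z) (@cf (lin z.1 z.2))). Qed.

Let test_h : test_fun h.
Proof.
split; last by exists M => x y; exact: fM.
have mlin : measurable_fun [set: R * R] ((fun z => lin z.1 z.2) : R * R -> borelV R k).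
  apply: measurable_borelV => i.
  rewrite (_ : (fun w : R * R => lin w.1 w.2 i 0) = (fun w => w.1 * a i 0 + w.2 * b i 0)).
    by apply: measurable_funD; apply: measurable_funM.
  by apply/funext => w; rewrite !mxE.
by case: mfB => mf _; exact: (measurableT_comp mf mlin).
Qed.

Let mhUV n : bmfun (fun w => h (U n w) (V n w)).
Proof. by apply: (test_fun_comp test_h); [case: (mU n)|case: (mV n)]. Qed.

Let mfY n : bmfun (fun w => f (Y n w)).
Proof.
have mYn : measurable_fun setT (Y n : T -> borelV R k).
  by apply: measurable_borelV => i; case: (mY n i).
by case: mfB => mf _; split; [exact: (measurableT_comp mf mYn)|exists M].
Qed.

(** Three cases: outside the box the difference is at most 2 M, with small probability; a remainder
    coordinate of size >= del makes 2 M at most 2 M / del times the sum of the remainders; otherwise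
    uniform continuity near the compact image of the box applies. *)
Let rem_diff e : 0 < e -> \forall n \near \oo,
  `|E (fun w => \1_H w * (f (Y n w) - h (U n w) (V n w)))| <= e.
Proof.
move=> e0; have e3 : 0 < e / 3 by rewrite divr_gt0.
have e_split : e = e / 3 + e / 3 + e / 3 by field.
have eM : 0 < e / 3 / (2 * M + 1) by rewrite divr_gt0// ltr_wpDl// mulr_ge0.
have one1 w : `|(fun=> 1 : R) (w : T)| <= 1 by rewrite normr1.
have [K K0 hK] := tight (bmfun_cst _ 1) one1 eM.
have cbox : compact [set lin z.1 z.2 | z in `[- K, K]%classic `*` `[- K, K]%classic].
  apply: continuous_compact; first exact: continuous_subspaceT continuous_lin.
  by apply: compact_setX; exact: segment_compact.
have [del del0 hdel] := compact_unif_continuous cbox cf e3.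
have S0 : 2 * M / del * \sum_i E (fun w => `|rem n w i|) @[n --> \oo] --> (0 : R).
  rewrite -[X in _ --> X](mulr0 (2 * M / del)); apply: cvgM; first exact: cvg_cst.
  rewrite [X in _ --> X](_ : 0 = \sum_(i < k) 0); last by rewrite big1.
  apply: cvg_sumr => i.
  rewrite (_ : (fun n => _) =
    (fun n => E (fun w => `|Y n w i 0 - (U n w * a i 0 + V n w * b i 0)|))); first exact: Y_rem.
  by apply/funext => n; apply: eq_Rintegral => w _; rewrite remE.
near=> n.
have Sn : 2 * M / del * \sum_i E (fun w => `|rem n w i|) <= e / 3.
  by near: n; have := S0 => /cvgr_le; apply.
have mo : bmfun (fun w => outside K (U n w) (V n w)).
  by apply: (test_fun_comp (test_fun_outside K)); [case: (mU n)|case: (mV n)].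
have mn i : bmfun (fun w => `|rem n w i|) by exact: bmfun_norm.
have mD : bmfun (fun w => \1_H w * (f (Y n w) - h (U n w) (V n w))) by bmf.
rewrite (le_trans (expect_norm _ mD))//.
have mS : bmfun (fun w => \sum_i `|rem n w i|) by exact: bmfun_sum.
apply: (@le_trans _ _ (E (fun w => (e / 3 + (2 * M + 1) * outside K (U n w) (V n w)) +
    2 * M / del * \sum_i `|rem n w i|))).
  apply: expect_le => [| |w]; [by bmf|by bmf|].
  rewrite normrM (le_trans (ler_wpM2r (normr_ge0 _) (H1 w)))// mul1r.
  have r0 : 0 <= 2 * M / del * \sum_i `|rem n w i|.
    apply: mulr_ge0; last exact: sumr_ge0.
    by apply: divr_ge0; [exact: mulr_ge0|exact: ltW].
  have t2 : `|f (Y n w) - h (U n w) (V n w)| <= 2 * M.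
    by rewrite (le_trans (ler_normB _ _))// mulr_natl mulr2n lerD ?fM.
  have [out|ins] := boolP ((K < `|U n w|) || (K < `|V n w|)).
    rewrite /outside out mulr1 (le_trans t2)//.
    by rewrite -[leLHS]addr0 lerD// addrCA lerDl addr_ge0// ltW.
  have [/existsP[i di]|/existsPn small] := boolP [exists i, del <= `|rem n w i|].
    rewrite (le_trans t2)//.
    apply: (@le_trans _ _ (2 * M / del * \sum_i `|rem n w i|)); last first.
      by rewrite lerDr addr_ge0 ?(ltW e3)// mulr_ge0// addr_ge0// mulr_ge0.
    rewrite mulrAC ler_pdivlMr// ler_wpM2l ?mulr_ge0// (le_trans di)//.
    by rewrite (bigD1 i)//= lerDl sumr_ge0.
  have bx : [set lin z.1 z.2 | z in `[- K, K]%classic `*` `[- K, K]%classic]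
      (lin (U n w) (V n w)).
    exists (U n w, V n w) => //; move: ins; rewrite negb_or -!leNgt => /andP[u v].
    by split; rewrite /= in_itv/= -ler_norml.
  have bl : ball (lin (U n w) (V n w)) del (Y n w).
    split=> // i j; rewrite ord1 /ball/= distrC.
    by have := small i; rewrite -ltNge.
  have := hdel _ _ bx bl; rewrite distrC => /ltW hh.
  rewrite (le_trans hh)// -addrA lerDl addr_ge0// mulr_ge0// addr_ge0// mulr_ge0//.
rewrite expectD; [|by bmf..]; rewrite expectD; [|by bmf..].
rewrite expect_cst !expectZ// expect_sum//.
have hKn : (2 * M + 1) * E (fun w => outside K (U n w) (V n w)) <= e / 3.
  have := hK n; under eq_Rintegral do rewrite normr1 mul1r.
  by rewrite ler_pdivlMr ?ltr_wpDl ?mulr_ge0// mulrC.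
by rewrite [leRHS]e_split !lerD.
Unshelve. all: by end_near. Qed.

(** The limit is expressed on T enlarged by two independent normals. Integrating these out first, by
    Fubini, produces the exponential factor of [UV_cos]. *)
Let limit_law : E (fun w => \1_H w * f (Y n w)) @[n --> \oo] -->
  \int[(P \x gg)%E]_z (\1_(H `*` [set: TR * TR]) z * f (gauss_map a b s1 s2 z)).
Proof.
pose psi' : T * (TR * TR) -> R := \1_(H `*` [set: TR * TR]).
have mpsi' : bmfun psi' by apply: bmfun_indic; exact: measurableX.
pose U' (z : T * (TR * TR)) : R := s1 z.1 * z.2.1.
pose V' (z : T * (TR * TR)) : R := s2 z.1 * z.2.2.
have mU' : measurable_fun setT U' := measurable_gauss_coord1 ms1.
have mV' : measurable_fun setT V' := measurable_gauss_coord2 ms2.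
have psiE w z : psi' (w, z) = \1_H w.
  by rewrite /psi' !indicE in_setX/= in_setT andbT.
have H' := @cos_cvg_continuous R _ T P _ _ (P \x gg)%E \1_H psi' U V U' V' mH1 mpsi'
  (fun n => (mU n).1) (fun n => (mV n).1) mU' mV'.
have limh : E (fun w => \1_H w * h (U n w) (V n w)) @[n --> \oo] -->
    \int[(P \x gg)%E]_z (psi' z * h (U' z) (V' z)).
  apply: H' => //.
  - move=> s t th.
    suff -> : \int[(P \x gg)%E]_z (psi' z * cos (s * U' z + t * V' z + th)) =
        E (fun w => \1_H w * expR (- (((s * s1 w) ^+ 2 + (t * s2 w) ^+ 2) / 2))) * cos th.
      exact: (@UV_cos _ s t th mH1).
    have mc : bmfun (fun z => cos (s * U' z + t * V' z + th)).
      exact: (test_fun_comp (test_fun_cos s t th) mU' mV').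
    rewrite expect_prod; last exact: bmfunM.
    have mexp : bmfun (fun w => expR (- (((s * s1 w) ^+ 2 + (t * s2 w) ^+ 2) / 2))).
      split; last first.
        by exists 1 => w; rewrite ger0_norm ?expR_ge0// -expR0 ler_expR oppr_le0 divr_ge0 ?addr_ge0 ?sqr_ge0.
      apply: measurableT_comp => //; apply: measurable_funN; apply: measurable_funM => //.
      apply: measurable_funD; apply: measurable_funX; apply: measurable_funM => //.
    rewrite [RHS](_ : _ = \int[P]_w (cos th * (\1_H w *
       expR (- (((s * s1 w) ^+ 2 + (t * s2 w) ^+ 2) / 2))))); last first.
      by rewrite [RHS](@expectZ _ _ _ P (cos th) _ (bmfunM mH1 mexp)) mulrC.
    apply: eq_Rintegral => w _.
    under eq_Rintegral do rewrite psiE /U' /V' /= !mulrA.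
    rewrite expectZ; last first.
      apply: (@test_fun_comp _ _ _ (fun x y => cos (s * s1 w * x + t * s2 w * y + th))).
      + exact: test_fun_cos.
      + exact: measurable_fst.
      + exact: measurable_snd.
    by rewrite gaussian_plane_charfun; ring.
  - exact: tight mH1 H1.
  - move=> e e0; exact: (tight_measurable (P \x gg)%E mpsi' mU' mV' e0).
pose D n := E (fun w => \1_H w * (f (Y n w) - h (U n w) (V n w))).
have D0 : D n @[n --> \oo] --> (0 : R).
  apply/cvgrPdist_le => e /rem_diff; apply: filterS => n.
  by rewrite sub0r normrN.
rewrite (_ : (fun n => E (fun w => \1_H w * f (Y n w))) =
    (fun n => D n + E (fun w => \1_H w * h (U n w) (V n w)))); last first.
  apply/funext => n; have h1 := mfY n; have h2 := mhUV n.
  rewrite /D -expectD; [|by bmf..]; by apply: eq_Rintegral => w _; ring.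
by rewrite -[X in _ --> X]add0r; exact: cvgD.
Qed.

Lemma cond_law_cvg : (0 < P H)%E ->
  (\int[cond_law P H (Y n)]_x (f x)%:E @[n --> \oo] -->
   \int[cond_law (P \x gg)%E (H `*` [set: TR * TR]) (gauss_map a b s1 s2)]_x (f x)%:E)%E.
Proof.
move=> PH.
have PQ : (P \x gg)%E (H `*` [set: TR * TR]) = P H.
  by rewrite product_measure1E// [X in (P H * X)%E](_ : _ = 1%E) ?mule1//; exact: probability_setT.
have mYn n : measurable_fun setT (Y n : T -> borelV R k).
  by apply: measurable_borelV => i; case: (mY n i).
rewrite (_ : (fun n => (\int[cond_law P H (Y n)]_x (f x)%:E)%E) =
    (fun n => ((fine (P H))^-1 * E (fun w => \1_H w * f (Y n w)))%:E)); last first.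
  by apply/funext => n; rewrite integral_cond_law.
rewrite integral_cond_law//; first last.
- exact: measurable_gauss_map.
- by move: PH; rewrite -PQ.
- exact: measurableX.
rewrite [X in (fine X)^-1 * Rintegral (P \x gg)%E _ _](_ : _ = P H); last exact: PQ.
apply: cvg_EFin; first exact: nearW.
by apply: cvgM; [exact: cvg_cst|exact: limit_law].
Qed.

End test_function.

Theorem stable_gaussian_limit : exists K : R.-pker T ~> borelV R k,
  (forall w, is_gaussian (K w) 0 (s1 w ^+ 2 *: (a *m a^T) + s2 w ^+ 2 *: (b *m b^T))) /\
  stable_cvg P Y K.
Proof.
exists (rand_kernel gg (measurable_gauss_map a b ms1 ms2)); split.
  exact: gauss_kernel_gaussian.
split=> [n|H mH PH f cf [M fM]].
  by apply: measurable_borelV => i; case: (mY n i).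
rewrite rand_kernel_mixture//; exact: cond_law_cvg cf fM mH PH.
Qed.

End stable_gaussian_limit.

(** * Calculus of conditional expectations *)

Section cond_expect_theory.
Context d (T : measurableType d) (R : realType) (P : probability T R).
Variable G : set (set T).
Hypothesis G_meas : <<s G >> `<=` measurable.
Local Notation E := (Rintegral P setT).
Local Notation Gfun := (fun f : T -> R => @bmfun _ (g_sigma_algebraType G) R f).
Implicit Types (f g p Y : T -> R).

Lemma cond_expect_self f : Gfun f -> cond_expect P G f f.
Proof. by move=> Gf; split=> //; exact: bmfun_sub Gf. Qed.

Lemma cond_expectD Y Y' p p' : cond_expect P G Y p -> cond_expect P G Y' p' ->
  cond_expect P G (fun w => Y w + Y' w) (fun w => p w + p' w).
Proof.
move=> [mY Gp eY] [mY' Gp' eY']; split; [by bmf|by bmf|move=> g Gg].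
have mg := bmfun_sub G_meas Gg.
have mp := bmfun_sub G_meas Gp; have mp' := bmfun_sub G_meas Gp'.
under eq_Rintegral do rewrite mulrDr; rewrite expectD; [|by bmf..].
under [RHS]eq_Rintegral do rewrite mulrDr; rewrite expectD; [|by bmf..].
by rewrite eY// eY'.
Qed.

Lemma cond_expectM f Y p : Gfun f -> cond_expect P G Y p ->
  cond_expect P G (fun w => f w * Y w) (fun w => f w * p w).
Proof.
move=> Gf [mY Gp eY]; have mf := bmfun_sub G_meas Gf.
split; [by bmf|by bmf|move=> g Gg].
under eq_Rintegral do rewrite mulrA; under [RHS]eq_Rintegral do rewrite mulrA.
by rewrite eY//; exact: bmfunM.
Qed.

Lemma cond_expectZ a Y p : cond_expect P G Y p ->
  cond_expect P G (fun w => a * Y w) (fun w => a * p w).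
Proof. by apply: cond_expectM; exact: bmfun_cst. Qed.

Lemma cond_expect_sum (I : finType) (Q : pred I) (Y p : I -> T -> R) :
  (forall i, Q i -> cond_expect P G (Y i) (p i)) ->
  cond_expect P G (fun w => \sum_(i | Q i) Y i w) (fun w => \sum_(i | Q i) p i w).
Proof.
move=> H; rewrite /index_enum; elim: (Finite.enum _) => [|i s IH].
  under eq_fun do rewrite big_nil; under [X in cond_expect _ _ _ X]eq_fun do rewrite big_nil.
  by apply: cond_expect_self; exact: bmfun_cst.
have [Qi|nQi] := boolP (Q i).
  under eq_fun do rewrite big_cons Qi.
  under [X in cond_expect _ _ _ X]eq_fun do rewrite big_cons Qi.
  by apply: cond_expectD => //; exact: H.
under eq_fun do rewrite big_cons (negbTE nQi).
by under [X in cond_expect _ _ _ X]eq_fun do rewrite big_cons (negbTE nQi).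
Qed.

Lemma cond_expect_ext Y Y' p p' : Y =1 Y' -> p =1 p' ->
  cond_expect P G Y p -> cond_expect P G Y' p'.
Proof. by move=> /funext <- /funext <-. Qed.

End cond_expect_theory.

(** * The interacting system *)

Section network.
Context (d : measure_display) (T : measurableType d) (R : realType) (P : probability T R)
  (N : nat) (W : 'M[R]_N) (r : nat -> R) (Z0 : 'I_N -> {RV P >-> R})
  (X : nat -> 'I_N -> {RV P >-> R}).
Hypothesis sys : interacting_system W r Z0 X.
Local Notation E := (Rintegral P setT).
Local Notation Z := (Zproc r Z0 X).

(** The generators of [sysfilt], kept apart from the sigma-algebra because [g_sigma_algebraType]
    takes a generating family. *)
Definition sysgen n : set (set T) :=
  \bigcup_h preimage_set_system [set: T] (Z0 h) measurable `|`
  \bigcup_(k in [set k | (1 <= k <= n)%N]) \bigcup_j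
    preimage_set_system [set: T] (X k j) measurable.
Local Notation Gfun n :=
  (fun f : T -> R => @bmfun _ (g_sigma_algebraType (sysgen n)) R f).

Lemma sysgen_meas n : <<s sysgen n >> `<=` measurable.
Proof.
apply: smallest_sub; first exact: sigma_algebra_measurable.
move=> A [[h _ [B mB <-]]|[k _ [j _ [B mB <-]]]]; exact: measurable_funPT.
Qed.

Lemma sysgen_mono n : <<s sysgen n >> `<=` <<s sysgen n.+1 >>.
Proof.
apply: sub_sigma_algebra2 => A [HA|[k /andP[k1 kn] HA]]; [by left|right].
by exists k => //=; rewrite k1 leqW.
Qed.

Lemma X_adapted n j : Gfun n.+1 (X n.+1 j).
Proof.
split; last first.
  by exists 1 => w; case: (X_range sys j w (ltn0Sn n)) => ->; rewrite ?normr0 ?normr1.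
move=> _ B mB; apply: sub_sigma_algebra; right; exists n.+1; first by rewrite /= leqnn.
by exists j => //; exists B.
Qed.

Lemma Z0_adapted j : Gfun 0 (Z0 j).
Proof.
split; last by exists 1 => w; have /andP[? ?] := Z0_range sys j w; rewrite ger0_norm.
by move=> _ B mB; apply: sub_sigma_algebra; left; exists j => //; exists B.
Qed.

Lemma X01 n j w : 0 <= X n.+1 j w <= 1.
Proof. by case: (X_range sys j w (ltn0Sn n)) => ->; rewrite ?lexx ler01. Qed.

Lemma r01 n : 0 <= r n <= 1.
Proof. by have /andP[-> /ltW ->] := r_range sys n. Qed.

Lemma Zproc01 n j w : 0 <= Z n j w <= 1.
Proof.
elim: n => [|n /andP[z0 z1]] /=; first exact: (Z0_range sys).
have /andP[x0 x1] := X01 n j w; have /andP[r0 r1] := r01 n.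
apply/andP; split; first by rewrite addr_ge0// mulr_ge0// subr_ge0.
by nra.
Qed.

Lemma Zproc_adapted n j : Gfun n (Z n j).
Proof.
elim: n => [|n IH] /=; first exact: Z0_adapted.
apply: (@bmfunD _ (g_sigma_algebraType (sysgen n.+1))); apply: bmfunZ; last exact: X_adapted.
by apply: adapted_le IH => //; exact: sysgen_mono.
Qed.

Definition succ_prob n j w := \sum_h W h j * Z n h w.

Lemma W_sum1 j : \sum_h W h j = 1.
Proof.
have /colP/(_ j) := W_col_sum sys; rewrite !mxE => <-.
by apply: eq_bigr => h _; rewrite !mxE mulr1.
Qed.

Lemma succ_prob01 n j w : 0 <= succ_prob n j w <= 1.
Proof.
apply/andP; split.
  by apply: sumr_ge0 => h _; have /andP[? _] := Zproc01 n h w; rewrite mulr_ge0// (W_ge0 sys).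
rewrite -(W_sum1 j); apply: ler_sum => h _; have /andP[_ ?] := Zproc01 n h w.
by rewrite -[leRHS]mulr1 ler_wpM2l// (W_ge0 sys).
Qed.

Lemma succ_prob_adapted n j : Gfun n (succ_prob n j).
Proof.
by apply: bmfun_sum => h; apply: bmfunZ; exact: Zproc_adapted.
Qed.

Lemma X_indic n j : (X n.+1 j : T -> R) = \1_(X n.+1 j @^-1` [set 1]).
Proof.
apply/funext => w; rewrite indicE; case: (X_range sys j w (ltn0Sn n)) => Xw.
  by rewrite Xw memNset//= Xw => /esym/eqP; rewrite oner_eq0.
by rewrite Xw mem_set//= Xw.
Qed.

Lemma X_cond_expect n j : cond_expect P (sysgen n) (X n.+1 j) (succ_prob n j).
Proof.
rewrite X_indic; apply: cond_prob_version_expect.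
- exact: sysgen_meas.
- by rewrite -[X in measurable X]setTI; exact: measurable_funPT.
- exact: succ_prob_adapted.
- exact: (X_cond_prob sys).
Qed.

(** Conditional independence speaks of all vertices at once; those other than i and j receive the
    sure event, with the constant 1 as a version of its conditional probability. *)
Lemma X_cond_expectM n i j : i != j ->
  cond_expect P (sysgen n) (fun w => X n.+1 i w * X n.+1 j w)
    (fun w => succ_prob n i w * succ_prob n j w).
Proof.
move=> ij.
pose U k := if (k == i) || (k == j) then [set (1 : R)] else setT.
pose g k := if (k == i) || (k == j) then succ_prob n k else fun=> 1.
have := X_cond_independent sys (n := n) (U := U) (g := g).
have mU k : measurable (U k) by rewrite /U; case: ifP => _ //; exact: measurable_set1.
have hg k : cond_prob_version P (sysfilt Z0 X n) (X n.+1 k @^-1` U k) (g k).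
  rewrite /U /g; case: ifP => _; first exact: (X_cond_prob sys).
  split.
  - move=> V mV; have := @measurable_cst _ _ (g_sigma_algebraType (sysgen n)) R setT (1 : R).
    by move=> /(_ measurableT V mV); rewrite setTI.
  - exact: (@bmfun_integrable _ _ _ P (fun=> 1) (bmfun_cst _ _)).
  - by move=> B GB; rewrite integral_cst ?preimage_setT ?setTI ?mul1e//; exact: sysgen_meas GB.
move=> /(_ mU hg).
have -> : (fun w => \prod_k g k w) = (fun w => succ_prob n i w * succ_prob n j w).
  apply/funext => w; rewrite (bigD1 i)//= (bigD1 j)/=; last by rewrite eq_sym.
  rewrite big1 ?mulr1; first by rewrite /g !eqxx orbT.
  by move=> k /andP[ki kj]; rewrite /g (negbTE ki) (negbTE kj).
have -> : \bigcap_k (X n.+1 k @^-1` U k) =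
    X n.+1 i @^-1` [set 1] `&` X n.+1 j @^-1` [set 1].
  apply/seteqP; split => [w H|w [Hi Hj] k _].
    by split; [have := H i I|have := H j I]; rewrite /U eqxx ?orbT.
  by rewrite /U; case: ifP => // /orP[] /eqP ->.
move=> H.
have -> : (fun w => X n.+1 i w * X n.+1 j w) =
    \1_(X n.+1 i @^-1` [set 1] `&` X n.+1 j @^-1` [set 1]).
  apply/funext => w; rewrite indicI.
  have := congr1 (@^~ w) (X_indic n i); have := congr1 (@^~ w) (X_indic n j).
  by move=> /= -> ->.
apply: cond_prob_version_expect H.
- exact: sysgen_meas.
- by apply: measurableI; rewrite -[X in measurable X]setTI; exact: measurable_funPT.
- by apply: bmfunM; exact: succ_prob_adapted.
Qed.

Definition noise n j w := X n.+1 j w - succ_prob n j w.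

Lemma noise_norm_le1 n j w : `|noise n j w| <= 1.
Proof.
have := X01 n j w; have := succ_prob01 n j w; rewrite /noise => /andP[? ?] /andP[? ?].
by rewrite ler_norml; apply/andP; split; lra.
Qed.

Lemma noise_adapted n j : Gfun n.+1 (noise n j).
Proof.
apply: bmfunB; first exact: X_adapted.
by apply: adapted_le (succ_prob_adapted n j) => //; exact: sysgen_mono.
Qed.

Lemma noise_sum_mart n (a : 'I_N -> R) :
  cond_expect P (sysgen n) (fun w => \sum_j a j * noise n j w) (fun=> 0).
Proof.
have Gm := @sysgen_meas n.
have H j : cond_expect P (sysgen n) (fun w => a j * noise n j w) (fun=> 0).
  apply: (cond_expect_ext (fun=> erefl)); last first.
    apply: cond_expectZ => //; apply: cond_expectD => //; first exact: X_cond_expect.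
    by apply: cond_expect_self => //; apply: bmfunN; exact: succ_prob_adapted.
  by move=> w /=; rewrite subrr mulr0.
apply: cond_expect_ext (cond_expect_sum Gm (Q := predT) (fun j _ => H j)) => //.
by move=> w; rewrite big1.
Qed.

Definition succ_var n j w := succ_prob n j w * (1 - succ_prob n j w).

(** On the diagonal X^2 = X, as X takes the values 0 and 1; off the diagonal, X_i X_j has
    conditional mean the product of the success probabilities. *)
Lemma noise_cross n i j : cond_expect P (sysgen n) (fun w => noise n i w * noise n j w)
  (fun w => if i == j then succ_var n i w else 0).
Proof.
have Gm := @sysgen_meas n; have Gp k := succ_prob_adapted n k.
have cX k := X_cond_expect n k.
have [<-|ij] := eqVneq i j.
  have := cond_expectD Gm (cX i) (cond_expectD Gm (cond_expectM Gm (bmfunZ (-2) (Gp i)) (cX i))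
    (cond_expect_self P Gm (bmfunM (Gp i) (Gp i)))).
  apply: cond_expect_ext => w; rewrite /noise /succ_var; last by ring.
  by case: (X_range sys i w (ltn0Sn n)) => ->; ring.
have := cond_expectD Gm (X_cond_expectM n ij)
  (cond_expectD Gm (cond_expectM Gm (bmfunN (Gp i)) (cX j))
  (cond_expectD Gm (cond_expectM Gm (bmfunN (Gp j)) (cX i))
    (cond_expect_self P Gm (bmfunM (Gp i) (Gp j))))).
by apply: cond_expect_ext => w; rewrite /noise; ring.
Qed.

Lemma noise_sum_var n (a : 'I_N -> R) :
  cond_expect P (sysgen n) (fun w => (\sum_j a j * noise n j w) ^+ 2)
    (fun w => \sum_j a j ^+ 2 * succ_var n j w).
Proof.
have Gm := @sysgen_meas n.
have H i := cond_expect_sum Gm (Q := predT)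
  (fun j _ => cond_expectZ Gm (a i * a j) (noise_cross n i j)).
apply: cond_expect_ext (cond_expect_sum Gm (Q := predT) (fun i _ => H i)) => w.
  rewrite expr2 mulr_suml; apply: eq_bigr => i _.
  by rewrite mulr_sumr; apply: eq_bigr => j _; ring.
apply: eq_bigr => i _; rewrite (bigD1 i)//= eqxx big1 ?addr0 ?expr2// => j.
by rewrite eq_sym => /negbTE ->; rewrite mulr0.
Qed.

End network.

Section martingale_differences.
Context d (T : measurableType d) (R : realType) (P : probability T R).
Variable G : nat -> set (set T).
Hypothesis G_meas : forall n, <<s G n >> `<=` measurable.
Hypothesis G_mono : forall n, <<s G n >> `<=` <<s G n.+1 >>.
Local Notation E := (Rintegral P setT).

Lemma mart_diff_sum_sqr (xi : nat -> T -> R) m n :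
  (forall l, @bmfun _ (g_sigma_algebraType (G l.+1)) R (xi l)) ->
  (forall l, cond_expect P (G l) (xi l) (fun=> 0)) ->
  E (fun w => (\sum_(m <= l < n) xi l w) ^+ 2) = \sum_(m <= l < n) E (fun w => xi l w ^+ 2).
Proof.
move=> Gxi mxi; have bxi l := bmfun_sub (G_meas (n := l.+1)) (Gxi l).
have [nm|mn] := leqP n m.
  rewrite big_geq//; under eq_Rintegral do rewrite big_geq// expr0n.
  exact: expect_cst.
rewrite -(subnKC (ltnW mn)); elim: (n - m)%N => [|k IH].
  rewrite addn0 big_geq//; under eq_Rintegral do rewrite big_geq// expr0n.
  exact: expect_cst.
have mk : (m <= m + k)%N by rewrite leq_addr.
pose S w := \sum_(m <= l < m + k) xi l w.
have GS : @bmfun _ (g_sigma_algebraType (G (m + k)%N)) R S.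
  have -> : S = (fun w => \sum_(m <= l < m + k | (m <= l < m + k)%N) xi l w).
    by apply/funext => w; rewrite /S big_nat.
  rewrite /index_iota; elim: (iota _ _) => [|l s IHs].
    by under eq_fun do rewrite big_nil; exact: bmfun_cst.
  have [/andP[ml lk]|H] := boolP (m <= l < m + k)%N.
    under eq_fun do rewrite big_cons ml lk.
    by apply: bmfunD => //; exact: adapted_le (Gxi l).
  by under eq_fun do rewrite big_cons (negbTE H).
have mS := bmfun_sub (@G_meas _) GS.
rewrite addnS big_nat_recr//= -IH.
have -> : (fun w => (\sum_(m <= l < (m + k).+1) xi l w) ^+ 2) =
  (fun w => S w ^+ 2 + xi (m + k)%N w ^+ 2 + 2 * (S w * xi (m + k)%N w)).
  by apply/funext => w; rewrite big_nat_recr//= -/(S w); ring.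
have [_ _ orth] := mxi (m + k)%N.
rewrite expectD; [|by bmf..]; rewrite expectD; [|by bmf..].
rewrite expectZ; last by bmf.
by rewrite orth//; under [X in 2 * X]eq_Rintegral do rewrite mulr0; rewrite expect_cst mulr0 addr0.
Qed.

End martingale_differences.

Section network_mean.
Context (d : measure_display) (T : measurableType d) (R : realType) (P : probability T R)
  (N : nat) (W : 'M[R]_N) (r : nat -> R) (Z0 : 'I_N -> {RV P >-> R})
  (X : nat -> 'I_N -> {RV P >-> R}) (p : 'I_N -> R).
Hypothesis sys : interacting_system W r Z0 X.
Hypothesis p_stat : forall h, \sum_j W h j * p j = p h.
Hypothesis p_sum : \sum_j p j = 1.
Local Notation E := (Rintegral P setT).
Local Notation Z := (Zproc r Z0 X).
Local Notation eta := (noise W r Z0 X).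
Local Notation G := (sysgen Z0 X).
Local Notation Gfun n :=
  (fun f : T -> R => @bmfun _ (g_sigma_algebraType (sysgen Z0 X n)) R f).

Let p0 h : 0 <= p h.
Proof. exact: (stationary_ge0 (W_ge0 sys) (W_sum1 sys) (W_irreducible sys) p_stat p_sum). Qed.

Let Gm n : <<s G n >> `<=` measurable. Proof. exact: sysgen_meas. Qed.
Let GM n : <<s G n >> `<=` <<s G n.+1 >>. Proof. exact: sysgen_mono. Qed.

Definition netmean n w := wmean p (Z n ^~ w).
Definition meannoise n w := \sum_j p j * eta n j w.
Definition meanvar n w := \sum_j p j ^+ 2 * succ_var W r Z0 X n j w.

(** The drift r_n (mean of [push] Z_n minus mean of Z_n) is zero by stationarity of p; it is
    inserted in the form of the equation [H]. *)
Lemma netmean_succ n w : netmean n.+1 w = netmean n w + r n * meannoise n w.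
Proof.
have H : 0 = r n * (wmean p (push W (Z n ^~ w)) - wmean p (Z n ^~ w)).
  by rewrite (wmean_push p_stat) subrr mulr0.
rewrite -[X in _ = X + _]addr0 [X in _ = (_ + X) + _]H /netmean /meannoise.
rewrite /wmean -sumrB !mulr_sumr -!big_split/=; apply: eq_bigr => j _.
by rewrite /noise /succ_prob /push; ring.
Qed.

Lemma meannoise_le1 n w : `|meannoise n w| <= 1.
Proof.
rewrite -p_sum (le_trans (ler_norm_sum _ _ _))//; apply: ler_sum => j _.
by rewrite normrM ger0_norm// -[leRHS]mulr1 ler_wpM2l// (noise_norm_le1 sys).
Qed.

Lemma meannoise_adapted n : Gfun n.+1 (meannoise n).
Proof. by apply: bmfun_sum => j; apply: bmfunZ; exact: noise_adapted. Qed.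

Lemma meannoise_mart n : cond_expect P (G n) (meannoise n) (fun=> 0).
Proof. exact: noise_sum_mart. Qed.

Lemma meannoise_var n : cond_expect P (G n) (fun w => meannoise n w ^+ 2) (meanvar n).
Proof. exact: noise_sum_var. Qed.

Lemma weight_le1 j : p j <= 1.
Proof. by rewrite -p_sum (bigD1 j)//= lerDl sumr_ge0. Qed.

Lemma succ_var01 n j w : 0 <= succ_var W r Z0 X n j w <= 1.
Proof.
have /andP[a b] := succ_prob01 sys n j w; rewrite /succ_var; apply/andP; split.
  by rewrite mulr_ge0// subr_ge0.
by nra.
Qed.

Lemma meanvar01 n w : 0 <= meanvar n w <= 1.
Proof.
apply/andP; split.
  apply: sumr_ge0 => j _; rewrite mulr_ge0 ?sqr_ge0//.
  by have /andP[] := succ_var01 n j w.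
rewrite -p_sum; apply: ler_sum => j _; have /andP[a b] := succ_var01 n j w.
have := weight_le1 j; have := p0 j; nra.
Qed.

Lemma netmean_adapted n : Gfun n (netmean n).
Proof. by apply: bmfun_sum => j; apply: bmfunZ; exact: (Zproc_adapted sys n j). Qed.

Lemma netmean_bounded n : bmfun (netmean n).
Proof. exact: (bmfun_sub (@Gm _) (netmean_adapted n)). Qed.

Lemma meannoise_bounded n : bmfun (meannoise n).
Proof. exact: (bmfun_sub (@Gm _) (meannoise_adapted n)). Qed.

Lemma netmean01 n w : 0 <= netmean n w <= 1.
Proof.
apply/andP; split.
  apply: sumr_ge0 => j _; rewrite mulr_ge0//.
  by have /andP[] := Zproc01 sys n j w.
rewrite -p_sum; apply: ler_sum => j _; have /andP[a b] := Zproc01 sys n j w.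
by rewrite -[leRHS]mulr1 ler_wpM2l.
Qed.

Lemma netmean_sub m n w : (m <= n)%N ->
  netmean n w - netmean m w = \sum_(m <= l < n) r l * meannoise l w.
Proof.
move=> /subnKC <-; elim: (n - m)%N => [|k IH]; first by rewrite addn0 big_geq// subrr.
by rewrite addnS big_nat_recr ?leq_addr//= -IH netmean_succ; ring.
Qed.

Lemma weighted_noise_sqr (eps : nat -> T -> R) (a : nat -> R) m n :
  (forall l, Gfun l.+1 (eps l)) -> (forall l, cond_expect P (G l) (eps l) (fun=> 0)) ->
  (forall l w, `|eps l w| <= 1) ->
  E (fun w => (\sum_(m <= l < n) a l * eps l w) ^+ 2) <= \sum_(m <= l < n) a l ^+ 2.
Proof.
move=> Ge me e1.
rewrite (mart_diff_sum_sqr Gm GM); first last.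
- move=> l; have := cond_expectZ (@Gm _) (a l) (me l).
  by apply: cond_expect_ext => // w; rewrite mulr0.
- by move=> l; exact: bmfunZ.
apply: ler_sum => l _; rewrite -[leRHS](expect_cst P).
have := bmfun_sub (@Gm _) (Ge l) => be.
apply: expect_le => [| |w]; [by bmf|exact: bmfun_cst|].
rewrite exprMn -[leRHS]mulr1 ler_wpM2l ?sqr_ge0//.
by have := e1 l w; rewrite ler_norml => /andP[? ?]; nra.
Qed.

Lemma netmean_increment_sqr m n : (m <= n)%N ->
  E (fun w => (netmean n w - netmean m w) ^+ 2) <= \sum_(m <= l < n) r l ^+ 2.
Proof.
move=> mn; under eq_Rintegral do rewrite (netmean_sub _ mn).
apply: weighted_noise_sqr; [exact: meannoise_adapted|exact: meannoise_mart|exact: meannoise_le1].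
Qed.

(** Z_{n+1,j} - M_{n+1} = A_j + r_n nu_j with A_j known at time n and nu_j centred, so the cross
    term integrates to 0. [wvar_contraction] handles the A_j, and |nu_j| <= 2 gives the constant
    4. *)
Lemma wvar_step : exists2 K, 0 < K & forall n, r n <= 2^-1 ->
  E (fun w => wvar p (Z n.+1 ^~ w)) <=
  (1 - K * r n) * E (fun w => wvar p (Z n ^~ w)) + 4 * r n ^+ 2.
Proof.
have [K K0 hK] := wvar_contraction (W_ge0 sys) (W_sum1 sys) (W_irreducible sys) p_stat p_sum.
exists K => // n r2.
have mwvar m : bmfun (fun w => wvar p (Z m ^~ w)).
  have mZ j : bmfun (Z m j).
    exact: (bmfun_sub (@Gm _) (Zproc_adapted sys m j)).
  apply: bmfun_sum => j; apply: bmfunZ; apply: bmfunX.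
  by apply: bmfunB => //; exact: netmean_bounded.
pose A j w := (1 - r n) * Z n j w + r n * push W (Z n ^~ w) j - wmean p (Z n ^~ w).
have GA j : Gfun n (A j).
  apply: bmfunB; last exact: netmean_adapted.
  by apply: bmfunD; apply: bmfunZ; [exact: (Zproc_adapted sys n j)|exact: (succ_prob_adapted sys n j)].
have mA j : bmfun (A j : T -> R) := bmfun_sub (@Gm _) (GA j).
(* Vertex noise minus mean noise, written as one weighted sum so that [noise_sum_mart] applies. *)
pose nu j w := \sum_i ((i == j)%:R - p i) * eta n i w.
have nuE j w : nu j w = eta n j w - meannoise n w.
  rewrite /nu /meannoise; under eq_bigr do rewrite mulrBl; rewrite sumrB; congr (_ - _).
  by rewrite (bigD1 j)//= eqxx mul1r big1 ?addr0// => i /negbTE ->; rewrite mul0r.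
have nu2 j w : nu j w ^+ 2 <= 4.
  rewrite nuE; have := noise_norm_le1 sys n j w; have := meannoise_le1 n w.
  rewrite !ler_norml => /andP[? ?] /andP[? ?]; nra.
have cnu j : cond_expect P (G n) (nu j) (fun=> 0) := noise_sum_mart sys n _.
have mnu j : bmfun (nu j) by case: (cnu j).
have ZE j w : Z n.+1 j w - wmean p (Z n.+1 ^~ w) = A j w + r n * nu j w.
  by rewrite -/(netmean n.+1 w) netmean_succ nuE /A /netmean /= /noise /push /succ_prob; ring.
have step j : E (fun w => (Z n.+1 j w - wmean p (Z n.+1 ^~ w)) ^+ 2) <=
    E (fun w => A j w ^+ 2) + 4 * r n ^+ 2.
  have -> : (fun w => (Z n.+1 j w - wmean p (Z n.+1 ^~ w)) ^+ 2) =
      (fun w => A j w ^+ 2 + r n ^+ 2 * nu j w ^+ 2 + (2 * r n) * (A j w * nu j w)).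
    by apply/funext => w; rewrite ZE; ring.
  have [_ _ orth] := cnu j; have mAj := mA j; have mnuj := mnu j.
  rewrite expectD; [|by bmf..]; rewrite expectD; [|by bmf..].
  rewrite [X in _ + X](_ : _ = 0) ?addr0; last first.
    rewrite expectZ; last by bmf.
    by rewrite orth//; under eq_Rintegral do rewrite mulr0; rewrite expect_cst mulr0.
  rewrite lerD2l mulrC -[leRHS](expect_cst P); apply: expect_le.
  - by bmf.
  - exact: bmfun_cst.
  - by move=> w; rewrite ler_wpM2l ?sqr_ge0.
have wvarE m : E (fun w => wvar p (Z m ^~ w)) =
    \sum_j p j * E (fun w => (Z m j w - wmean p (Z m ^~ w)) ^+ 2).
  have mZ j : bmfun (fun w => (Z m j w - wmean p (Z m ^~ w)) ^+ 2).
    apply: bmfunX; apply: bmfunB; last exact: netmean_bounded.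
    exact: (bmfun_sub (@Gm _) (Zproc_adapted sys m j)).
  rewrite /wvar expect_sum => [|j]; last exact: bmfunZ.
  by apply: eq_bigr => j _; rewrite expectZ.
rewrite wvarE; apply: (@le_trans _ _ (\sum_j p j * (E (fun w => A j w ^+ 2) + 4 * r n ^+ 2))).
  by apply: ler_sum => j _; rewrite ler_wpM2l.
under eq_bigr do rewrite mulrDr; rewrite big_split/= -mulr_suml p_sum mul1r lerD2r.
rewrite -expectZ//.
have -> : \sum_j p j * E (fun w => A j w ^+ 2) = E (fun w => \sum_j p j * A j w ^+ 2).
  rewrite expect_sum => [|j]; last by apply: bmfunZ; exact/bmfunX/mA.
  by apply: eq_bigr => j _; rewrite expectZ//; exact/bmfunX/mA.
apply: expect_le => [| |w]; [|exact: bmfunZ|].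
  by apply: bmfun_sum => j; apply: bmfunZ; exact/bmfunX/mA.
by apply: hK; rewrite r2 andbT; have /andP[] := r01 sys n.
Qed.

Lemma wvar_ge0 z : 0 <= wvar p z.
Proof. by apply: sumr_ge0 => j _; rewrite mulr_ge0// sqr_ge0. Qed.

Variables (g c : R).
Hypothesis g01 : 2^-1 < g < 1.
Hypothesis c0 : 0 < c.
Hypothesis hr : n%:R `^ g * r n @[n --> \oo] --> c.

Lemma step_cvg0 : r n @[n --> \oo] --> (0 : R).
Proof.
have g0 : 0 < g by have /andP[? _] := g01; lra.
have H : (n%:R `^ (- g)) * (n%:R `^ g * r n) @[n --> \oo] --> (0 : R).
  by rewrite -[X in _ --> X](mul0r c); apply: cvgM => //; apply: powR_nat_cvg0; rewrite oppr_lt0.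
apply: cvg_trans H; apply: near_eq_cvg; near=> n.
have n0 : 0 < n%:R :> R by rewrite ltr0n; near: n; exact: nbhs_infty_gt.
rewrite mulrA -powRD; last by rewrite (gt_eqF n0) implybT.
by rewrite addNr powRr0 mul1r.
Unshelve. all: by end_near. Qed.

Lemma wvar_rate : exists2 K, 0 <= K &
  \forall n \near \oo, E (fun w => wvar p (Z n ^~ w)) <= K * n%:R `^ (- g).
Proof.
have [K K0 hK] := wvar_step.
have g01' : 0 < g < 1 by have /andP[? ->] := g01; rewrite andbT; lra.
apply: (step_recursion_rate g01' c0 K0 _ hr (C := 4)) => //.
  move=> n; rewrite -[leLHS](expect_cst P); apply: expect_le => [| |w]; [exact: bmfun_cst| |exact: wvar_ge0].
  apply: bmfun_sum => j; apply: bmfunZ; apply: bmfunX.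
  apply: bmfunB; last exact: netmean_bounded.
  exact: (bmfun_sub (@Gm _) (Zproc_adapted sys n j)).
have : \forall n \near \oo, r n < 2^-1.
  by have := step_cvg0 => /cvgr_lt; apply; rewrite invr_gt0.
by apply: filterS => n rn; apply: hK; exact: ltW.
Qed.

End network_mean.

Lemma near_bounded (R : realType) (u : nat -> R) (B : R) :
  (\forall n \near \oo, u n <= B) -> exists A, forall n, u n <= A.
Proof.
move=> [n0 _ uB]; exists (`|B| + \sum_(i < n0) `|u i|) => n.
have [n0n|nn0] := leqP n0 n.
  rewrite (le_trans (uB n n0n))// (le_trans (ler_norm _))// lerDl.
  by apply: sumr_ge0 => i _.
rewrite (le_trans (ler_norm _))// (bigD1 (Ordinal nn0))//= addrCA lerDl.
by apply: addr_ge0 => //; apply: sumr_ge0.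
Qed.

Lemma cvg_sqr (R : realType) (u : nat -> R) (a : R) :
  u n @[n --> \oo] --> a -> u n ^+ 2 @[n --> \oo] --> a ^+ 2.
Proof.
move=> ua; rewrite (_ : (fun n => u n ^+ 2) = (fun n => u n * u n)); first exact: cvgM.
by apply/funext => n; rewrite expr2.
Qed.

Lemma cos_lipschitz (R : realType) (x y : R) : `|cos x - cos y| <= `|x - y|.
Proof.
have := @MVT_pow R (fun z => cos (y + z) - cos y) (fun z => - sin (y + z)) 1 0 (x - y).
rewrite expr0 expr1 !mul1r subrKC; apply.
- move=> z.
  have H : is_derive z 1 (fun z : R => y + z) 1.
    have := is_deriveD (is_derive_cst y z 1) (is_derive_id z (1 : R)).
    by rewrite add0r.
  have H2 := is_derive1_comp (is_derive_cos (y + z)) H.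
  have := is_deriveB H2 (is_derive_cst (cos y) z 1).
  by rewrite subr0 mulr1.
- by rewrite addr0 subrr.
- by move=> z _; rewrite normrN ler_norml sin_geN1 sin_le1.
Qed.

(** * Asymptotics of the step sizes and of their squared sums *)

Section step_sizes.
Context (R : realType) (g c : R) (r : nat -> R).
Hypothesis g01 : 2^-1 < g < 1.
Hypothesis c0 : 0 < c.
Hypothesis hr : n%:R `^ g * r n @[n --> \oo] --> c.
Hypothesis r_ge0 : forall n, 0 <= r n.

Let natr_gt0 n : (0 < n)%N -> 0 < n%:R :> R. Proof. by rewrite ltr0n. Qed.

Lemma powR_natD (n : nat) a b : (0 < n)%N -> n%:R `^ a * n%:R `^ b = n%:R `^ (a + b) :> R.
Proof. by move=> n0; rewrite powRD// (gt_eqF (natr_gt0 n0)) implybT. Qed.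

Lemma powR_nat_sqr (n : nat) a : (n%:R `^ a) ^+ 2 = n%:R `^ (2 * a) :> R.
Proof. by rewrite -powR_mulrn ?powR_ge0// -powRrM mulrC. Qed.

(** The index n + 1 makes the bound meaningful at n = 0, where [r 0] enters the constant; elsewhere
    the shift costs 2^g. *)
Lemma step_bound : exists2 C, 0 <= C & forall n, r n <= C * n.+1%:R `^ (- g).
Proof.
have g0 : 0 < g by have /andP[? _] := g01; lra.
have [B hB] : exists B, forall n, n%:R `^ g * r n <= B.
  apply: (@near_bounded _ _ (c + 1)).
  by have := hr => /cvgr_le; apply; rewrite ltrDl.
exists (2 `^ g * `|B| + r 0); first by rewrite addr_ge0// mulr_ge0// powR_ge0.
move=> n; rewrite powRN ler_pdivlMr ?powR_gt0//.
case: n => [|n]; first by rewrite powR1 mulr1 lerDr mulr_ge0// powR_ge0.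
apply: (@le_trans _ _ (2 `^ g * `|B|)); last by rewrite lerDl.
apply: (@le_trans _ _ (2 `^ g * (n.+1%:R `^ g * r n.+1))); last first.
  by rewrite ler_wpM2l ?powR_ge0// (le_trans (hB _))// ler_norm.
rewrite mulrA -powRM// mulrC ler_wpM2r// ge0_ler_powR ?nnegrE// ?mulr_ge0//; first exact: ltW.
by rewrite -natrM ler_nat mul2n -addnn -[X in (X <= _)%N]addn1 leq_add2l.
Qed.

(** The summand behaves like c^2 v l^(2 - 2 g), so [power_head_sum] applies with q = 2 g - 2, and 1
    - q = 3 - 2 g. *)
Lemma head_variance (V : nat -> R) v : V n @[n --> \oo] --> v ->
  n%:R `^ (2 * g - 3) * \sum_(0 <= l < n) (l.+1%:R * r l) ^+ 2 * V l @[n --> \oo] -->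
  c ^+ 2 * v / (3 - 2 * g).
Proof.
move=> Vv; have /andP[gl gh] := g01.
have -> : 3 - 2 * g = 1 - (2 * g - 2) by ring.
have -> : (fun n => n%:R `^ (2 * g - 3) * \sum_(0 <= l < n) (l.+1%:R * r l) ^+ 2 * V l) =
  (fun n => n%:R `^ (2 * g - 2 - 1) * \sum_(0 <= l < n) (l.+1%:R * r l) ^+ 2 * V l).
  by apply/funext => n; congr (_ `^ _ * _); ring.
apply: power_head_sum; first lra.
have H : (1 + n%:R^-1) ^+ 2 * (n%:R `^ g * r n) ^+ 2 * V n @[n --> \oo] --> (1 + 0) ^+ 2 * c ^+ 2 * v.
  apply: cvgM => //; apply: cvgM; last exact: cvg_sqr.
  apply: cvg_sqr; apply: cvgD; first exact: cvg_cst.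
  rewrite (_ : (fun n => n%:R^-1) = (fun n => n%:R `^ (- 1) : R)); last first.
    by apply/funext => n; rewrite powR_inv1.
  by apply: powR_nat_cvg0; rewrite oppr_lt0.
rewrite addr0 expr1n mul1r in H.
apply: cvg_trans H; apply: near_eq_cvg; near=> n.
have n0 : (0 < n)%N by near: n; exact: nbhs_infty_gt.
have nr := natr_gt0 n0.
have -> : n%:R `^ (2 * g - 2) = (n%:R `^ g) ^+ 2 * n%:R ^- 2 :> R.
  by rewrite powR_nat_sqr powRD ?(gt_eqF nr) ?implybT// powRN powR_mulrn.
by rewrite -natr1; field; rewrite gt_eqF.
Unshelve. all: by end_near. Qed.

(** [power_tail_sum] with q = 2 g and m = n^2: the truncation factor 1 - n^(-(2 g - 1)) tends to
    1. *)
Lemma tail_variance (V : nat -> R) v : V n @[n --> \oo] --> v ->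
  n%:R `^ (2 * g - 1) * \sum_(n <= l < n * n) r l ^+ 2 * V l @[n --> \oo] -->
  c ^+ 2 * v / (2 * g - 1).
Proof.
move=> Vv; have /andP[gl gh] := g01; have q0 : 0 < 2 * g - 1 by lra.
have H : r n ^+ 2 * V n * n%:R `^ (2 * g) @[n --> \oo] --> c ^+ 2 * v.
  have -> : (fun n => r n ^+ 2 * V n * n%:R `^ (2 * g)) = (fun n => (n%:R `^ g * r n) ^+ 2 * V n).
    by apply/funext => n; rewrite exprMn powR_nat_sqr; ring.
  by apply: cvgM => //; exact: cvg_sqr.
have q1 : 1 < 2 * g by lra.
have tail := power_tail_sum q1 H.
set k := c ^+ 2 * v / _.
have K : k * (1 - n%:R `^ (- (2 * g - 1))) @[n --> \oo] --> k.
  suff : k * (1 - n%:R `^ (- (2 * g - 1))) @[n --> \oo] --> k * (1 - 0) by rewrite subr0 mulr1.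
  apply: cvgM; first exact: cvg_cst.
  by apply: cvgB; [exact: cvg_cst|apply: powR_nat_cvg0; rewrite oppr_lt0].
apply/cvgrPdist_le => e e0.
have e2 : 0 < e / 2 by rewrite divr_gt0.
have /cvgrPdist_le/(_ _ e2) K' := K.
near=> n.
have n0 : (0 < n)%N by near: n; exact: nbhs_infty_gt.
have nr := natr_gt0 n0.
have Kn : `|k - k * (1 - n%:R `^ (- (2 * g - 1)))| <= e / 2 by near: n.
have Tn : forall m m', (n <= m <= m')%N -> `|m%:R `^ (2 * g - 1) * \sum_(m <= l < m') r l ^+ 2 * V l
       - k * (1 - (m%:R / m'%:R) `^ (2 * g - 1))| <= e / 2.
  by near: n; exact: tail.
have := Tn n (n * n)%N; rewrite leqnn leq_pmulr// => /(_ isT).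
rewrite (_ : n%:R / (n * n)%:R = n%:R^-1 :> R); last first.
  by rewrite natrM; field; rewrite gt_eqF.
rewrite -[n%:R^-1]powR_inv1 ?(ltW nr)// -powRrM mulN1r => Tn'.
rewrite (_ : k - _ = (k - k * (1 - n%:R `^ (- (2 * g - 1)))) -
   (n%:R `^ (2 * g - 1) * \sum_(n <= l < n * n) r l ^+ 2 * V l - k * (1 - n%:R `^ (- (2 * g - 1))))).
  by rewrite (le_trans (ler_normB _ _))// [e]splitr lerD.
by ring.
Unshelve. all: by end_near. Qed.

Lemma tail_sqr_bound : exists2 C, 0 <= C & \forall m \near \oo, forall n, (m <= n)%N ->
  \sum_(m <= l < n) r l ^+ 2 <= C * m%:R `^ (1 - 2 * g).
Proof.
have /andP[gl gh] := g01; have q0 : 0 < 2 * g - 1 by lra.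
have H : r n ^+ 2 * n%:R `^ (2 * g) @[n --> \oo] --> c ^+ 2.
  have -> : (fun n => r n ^+ 2 * n%:R `^ (2 * g)) = (fun n => (n%:R `^ g * r n) ^+ 2).
    by apply/funext => n; rewrite exprMn powR_nat_sqr; ring.
  exact: cvg_sqr.
have q1 : 1 < 2 * g by lra.
set k := c ^+ 2 / (2 * g - 1).
have k0 : 0 <= k by apply: divr_ge0; [exact: sqr_ge0|exact: ltW].
exists (1 + k); first by rewrite addr_ge0.
have := power_tail_sum q1 H (ltr01 (R := R)); rewrite -/k => tail.
near=> m => n mn.
have m0 : (0 < m)%N by near: m; exact: nbhs_infty_gt.
have Tm : forall m' n', (m <= m' <= n')%N -> `|m'%:R `^ (2 * g - 1) * \sum_(m' <= l < n') r l ^+ 2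
       - k * (1 - (m'%:R / n'%:R) `^ (2 * g - 1))| <= 1.
  by near: m; exact: tail.
have := Tm m n; rewrite leqnn mn => /(_ isT); rewrite ler_norml => /andP[_].
rewrite lerBlDr => Hmn.
have -> : 1 - 2 * g = - (2 * g - 1) by ring.
rewrite powRN ler_pdivlMr ?powR_gt0 ?natr_gt0// mulrC (le_trans Hmn)// lerD2l.
by rewrite -[leRHS]mulr1 ler_wpM2l// gerBl powR_ge0.
Unshelve. all: by end_near. Qed.

End step_sizes.

(** * Fluctuations of the network mean *)

Section fluctuations.
Context (d : measure_display) (T : measurableType d) (R : realType) (P : probability T R)
  (N : nat) (W : 'M[R]_N) (r : nat -> R) (Z0 : 'I_N -> {RV P >-> R})
  (X : nat -> 'I_N -> {RV P >-> R}) (p : 'I_N -> R) (g c : R) (Zinf : {RV P >-> R}).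
Hypothesis sys : interacting_system W r Z0 X.
Hypothesis p_stat : forall h, \sum_j W h j * p j = p h.
Hypothesis p_sum : \sum_j p j = 1.
Hypothesis g01 : 2^-1 < g < 1.
Hypothesis c0 : 0 < c.
Hypothesis hr : n%:R `^ g * r n @[n --> \oo] --> c.
Hypothesis hZ : is_Zlimit r Z0 X Zinf.
Local Notation E := (Rintegral P setT).
Local Notation Z := (Zproc r Z0 X).
Local Notation eta := (noise W r Z0 X).
Local Notation G := (sysgen Z0 X).
Local Notation M := (netmean r Z0 X p).
Local Notation xi := (meannoise W r Z0 X p).
Local Notation V := (meanvar W r Z0 X p).
Local Notation scale n := (n%:R `^ (g - 2^-1) : R).

Let p_gt0 h : 0 < p h.
Proof. exact: (stationary_gt0 (W_ge0 sys) (W_sum1 sys) (W_irreducible sys) p_stat p_sum). Qed.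

Let p_ge0 h : 0 <= p h. Proof. exact: ltW. Qed.

Let r_ge0 n : 0 <= r n. Proof. by have /andP[] := r_range sys n. Qed.

Let mM n : bmfun (M n). Proof. exact: (netmean_bounded p sys). Qed.

Let mxi n : bmfun (xi n). Proof. exact: (meannoise_bounded p sys). Qed.

Let Gm n : <<s G n >> `<=` measurable. Proof. exact: sysgen_meas. Qed.

Let mZ n j : bmfun (Z n j).
Proof. exact: (bmfun_sub (@Gm n) (Zproc_adapted sys n j)). Qed.

Let mq n j : bmfun (succ_prob W r Z0 X n j).
Proof. exact: (bmfun_sub (@Gm n) (succ_prob_adapted sys n j)). Qed.

Let meta n j : bmfun (eta n j).
Proof. exact: (bmfun_sub (@Gm n.+1) (noise_adapted sys n j)). Qed.

Let mZinf : bmfun (Zinf : T -> R).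
Proof.
split; first exact: measurable_funPT.
by exists 1 => w; have /andP[? ?] := hZ.1 w; rewrite ger0_norm.
Qed.

Lemma netmean_cvg : \forall w \ae P, M n w @[n --> \oo] --> Zinf w.
Proof.
apply: filterS (hZ.2) => w Zw.
have -> : Zinf w = \sum_j p j * Zinf w by rewrite -mulr_suml p_sum mul1r.
by apply: cvg_sumr => j; apply: cvgM; [exact: cvg_cst|exact: Zw].
Qed.

Lemma meanvar_cvg : \forall w \ae P,
  V n w @[n --> \oo] --> Zinf w * (1 - Zinf w) * \sum_j p j ^+ 2.
Proof.
apply: filterS (hZ.2) => w Zw.
rewrite mulrC mulr_suml; apply: cvg_sumr => j; apply: cvgM; first exact: cvg_cst.
have Q : succ_prob W r Z0 X n j w @[n --> \oo] --> Zinf w.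
  have -> : Zinf w = \sum_h W h j * Zinf w by rewrite -mulr_suml (W_sum1 sys) mul1r.
  by apply: cvg_sumr => h; apply: cvgM; [exact: cvg_cst|exact: Zw].
by apply: cvgM => //; apply: cvgB => //; exact: cvg_cst.
Qed.

(** The increments of M after time m have second moments bounded uniformly by the tail of r^2;
    dominated convergence carries the bound to the limit. *)
Lemma netmean_limit_sqr : exists2 C, 0 <= C & \forall m \near \oo,
  E (fun w => (M m w - Zinf w) ^+ 2) <= C * m%:R `^ (1 - 2 * g).
Proof.
have [C C0 hC] := tail_sqr_bound g01 hr; exists C => //.
apply: filterS hC => m hm.
have lim : E (fun w => (M m w - M (n + m)%N w) ^+ 2) @[n --> \oo] -->
    E (fun w => (M m w - Zinf w) ^+ 2).
  apply: (expect_dominated (M := 1)).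
  - by move=> n; have h1 := mM m; have h2 := mM (n + m)%N; bmf.
  - by have h1 := mM m; bmf.
  - move=> n w; rewrite ger0_norm ?sqr_ge0//.
    have /andP[? ?] := netmean01 sys p_stat p_sum m w.
    by have /andP[? ?] := netmean01 sys p_stat p_sum (n + m)%N w; nra.
  - apply: filterS netmean_cvg => w Mw; apply: cvg_sqr.
    by apply: cvgB; [exact: cvg_cst|rewrite (cvg_shiftn m (fun n => M n w))].
apply: (@closed_cvg _ _ _ eventually_filter _ (fun x => x <= C * m%:R `^ (1 - 2 * g)) _ _ _ lim).
  exact: closed_le.
near=> n.
rewrite (@le_trans _ _ (\sum_(m <= l < n + m) r l ^+ 2))//; last by rewrite hm// leq_addl.
under eq_Rintegral do rewrite -sqrrN opprB.
exact: (netmean_increment_sqr sys p_stat p_sum (leq_addl n m)).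
Unshelve. all: by end_near. Qed.

Lemma wvar_coord z j : p j * (z j - wmean p z) ^+ 2 <= wvar p z.
Proof.
rewrite /wvar (bigD1 j)//= lerDl; apply: sumr_ge0 => i _.
by rewrite mulr_ge0// sqr_ge0.
Qed.

(** One coordinate is controlled by the weighted variance because p j > 0, and E|.| by the square
    root of the second moment. It is stated for a general z to serve both the states and the success
    probabilities. *)
Lemma spread_rate (z : nat -> T -> 'I_N -> R) j :
  (forall n, bmfun (fun w => z n w j - M n w)) ->
  (forall n w, p j * (z n w j - M n w) ^+ 2 <= wvar p (Z n ^~ w)) ->
  exists2 K, 0 <= K & \forall n \near \oo,
    E (fun w => `|z n w j - M n w|) <= K * n%:R `^ (- (g / 2)).
Proof.
move=> mz zM; have [K K0 hK] := wvar_rate sys p_stat p_sum g01 c0 hr.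
exists (Num.sqrt (K / p j)); first exact: sqrtr_ge0.
apply: filterS hK => n hn; rewrite (le_trans (expect_norm_sqrt _ (mz n)))//.
have -> : n%:R `^ (- (g / 2)) = Num.sqrt (n%:R `^ (- g)) :> R.
  by rewrite -powR12_sqrt ?powR_ge0// -powRrM; congr (_ `^ _); field.
rewrite -sqrtrM ?divr_ge0// ler_wsqrtr// mulrAC ler_pdivlMr// mulrC.
apply: le_trans hn; rewrite -expectZ; last by have h1 := mz n; bmf.
have mwvar : bmfun (fun w => wvar p (Z n ^~ w)).
  apply: bmfun_sum => i; apply: bmfunZ; apply: bmfunX.
  by apply: bmfunB; [exact: mZ|exact: mM].
apply: expect_le => //; by have h1 := mz n; bmf.
Qed.

Lemma Zproc_spread j : exists2 K, 0 <= K & \forall n \near \oo,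
  E (fun w => `|Z n j w - M n w|) <= K * n%:R `^ (- (g / 2)).
Proof.
apply: (@spread_rate (fun n w j => Z n j w)) => [n|n w].
  by apply: bmfunB; [exact: mZ|exact: mM].
exact: wvar_coord.
Qed.

Lemma succ_prob_spread j : exists2 K, 0 <= K & \forall n \near \oo,
  E (fun w => `|succ_prob W r Z0 X n j w - M n w|) <= K * n%:R `^ (- (g / 2)).
Proof.
apply: (@spread_rate (fun n w j => succ_prob W r Z0 X n j w)) => [n|n w].
  by apply: bmfunB; [exact: mq|exact: mM].
apply: le_trans (wvar_push (W_ge0 sys) (W_sum1 sys) (W_irreducible sys) p_stat p_sum (Z n ^~ w)).
rewrite /netmean -(wmean_push p_stat); exact: wvar_coord.
Qed.

Lemma Zproc_rem_cvg0 j :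
  scale n * E (fun w => `|Z n j w - M n w|) @[n --> \oo] --> (0 : R).
Proof.
have /andP[gl gh] := g01.
have [K K0 hK] := Zproc_spread j.
apply: (@squeeze_cvgr _ _ _ _ (fun=> 0) (fun n => K * n%:R `^ ((g - 1) / 2))).
- near=> n; apply/andP; split.
    rewrite mulr_ge0 ?powR_ge0// -[leLHS](expect_cst P); apply: expect_le => //.
      exact: bmfun_cst.
    by apply: bmfun_norm; apply: bmfunB; [exact: mZ|exact: mM].
  have n0 : (0 < n)%N by near: n; exact: nbhs_infty_gt.
  have hn : E (fun w => `|Z n j w - M n w|) <= K * n%:R `^ (- (g / 2)) by near: n.
  rewrite (le_trans (ler_wpM2l (powR_ge0 _ _) hn))// mulrCA powR_natD//.
  by rewrite (_ : g - 2^-1 + - (g / 2) = (g - 1) / 2)//; field.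
- exact: cvg_cst.
- rewrite -[X in _ --> X](mulr0 K); apply: cvgM; first exact: cvg_cst.
  by apply: powR_nat_cvg0; rewrite pmulr_llt0 ?invr_gt0// subr_lt0.
Unshelve. all: by end_near. Qed.

Definition empirical_rem j n w :=
  n%:R^-1 * \sum_(0 <= l < n) (eta l j w + (succ_prob W r Z0 X l j w - M l w)).

Definition weighted_noise n w := n%:R^-1 * \sum_(0 <= l < n) l.+1%:R * r l * xi l w.

Lemma empirical_decomposition j n w : (0 < n)%N ->
  n%:R^-1 * \sum_(1 <= k < n.+1) X k j w =
  M n w - weighted_noise n w + empirical_rem j n w.
Proof.
move=> n0; have nr : n%:R != 0 :> R by rewrite pnatr_eq0 -lt0n.
(* Summation of (l + 1) M_{l+1} - l M_l = M_l + (l + 1) r_l xi_l. *)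
have H : n%:R * M n w = \sum_(0 <= l < n) M l w + \sum_(0 <= l < n) l.+1%:R * r l * xi l w.
  elim: n {n0 nr} => [|n IH]; first by rewrite !big_geq// mul0r addr0.
  rewrite !big_nat_recr//= (netmean_succ r Z0 X p_stat) addrACA -IH -natr1; ring.
have -> : M n w = n%:R^-1 * (n%:R * M n w) by rewrite mulKf.
rewrite H /weighted_noise /empirical_rem -mulrBr -mulrDr addrK; congr (_ * _).
by rewrite big_add1/= -big_split/=; apply: eq_bigr => l _; rewrite /noise; ring.
Qed.

Lemma empirical_rem_bounded j n : bmfun (empirical_rem j n).
Proof.
apply: bmfunZ; apply: bmfun_sum => l; apply: bmfunD; first exact: meta.
by apply: bmfunB; [exact: mq|exact: mM].
Qed.

(** By orthogonality the sum of n noises has L^1 norm at most n^(1/2), hence n^(g - 1) after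
    scaling. The other part is an average of terms that are o(n^(1/2 - g)), and [power_head_sum]
    applies with limit 0. *)
Lemma empirical_rem_cvg0 j :
  scale n * E (fun w => `|empirical_rem j n w|) @[n --> \oo] --> (0 : R).
Proof.
have /andP[gl gh] := g01.
pose x l := E (fun w => `|succ_prob W r Z0 X l j w - M l w|).
have mx l : bmfun (fun w => `|succ_prob W r Z0 X l j w - M l w|).
  by apply: bmfun_norm; apply: bmfunB; [exact: mq|exact: mM].
have x_ge0 l : 0 <= x l.
  by rewrite -[leLHS](expect_cst P); apply: expect_le => //; exact: bmfun_cst.
have x0 : x n * n%:R `^ (g - 2^-1) @[n --> \oo] --> (0 : R).
  have [K K0 hK] := succ_prob_spread j.
  apply: (@squeeze_cvgr _ _ _ _ (fun=> 0) (fun n => K * n%:R `^ ((g - 1) / 2))).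
  - near=> n; rewrite mulr_ge0 ?powR_ge0//=.
    have n0 : (0 < n)%N by near: n; exact: nbhs_infty_gt.
    have hn : x n <= K * n%:R `^ (- (g / 2)) by near: n.
    rewrite (le_trans (ler_wpM2r (powR_ge0 _ _) hn))// -mulrA powR_natD//.
    by rewrite (_ : - (g / 2) + (g - 2^-1) = (g - 1) / 2)//; field.
  - exact: cvg_cst.
  - rewrite -[X in _ --> X](mulr0 K); apply: cvgM; first exact: cvg_cst.
    by apply: powR_nat_cvg0; rewrite pmulr_llt0 ?invr_gt0// subr_lt0.
have q1 : g - 2^-1 < 1 by lra.
have H := power_head_sum q1 x0.
apply: (@squeeze_cvgr _ _ _ _ (fun=> 0)
  (fun n => n%:R `^ (g - 1) + n%:R `^ (g - 2^-1 - 1) * \sum_(0 <= l < n) x l)).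
- near=> n; apply/andP; split.
    rewrite mulr_ge0 ?powR_ge0// -[leLHS](expect_cst P); apply: expect_le => //.
      exact: bmfun_cst.
    exact: bmfun_norm (empirical_rem_bounded j n).
  have n0 : (0 < n)%N by near: n; exact: nbhs_infty_gt.
  have nr : 0 < n%:R :> R by rewrite ltr0n.
  have mS : bmfun (fun w => \sum_(0 <= l < n) eta l j w).
    by apply: bmfun_sum => l; exact: meta.
  have mS' : bmfun (fun w => \sum_(0 <= l < n) `|succ_prob W r Z0 X l j w - M l w|).
    exact: bmfun_sum.
  have S2 : E (fun w => `|\sum_(0 <= l < n) eta l j w|) <= n%:R `^ 2^-1.
    rewrite (le_trans (expect_norm_sqrt _ mS))// powR12_sqrt ?ler0n// ler_wsqrtr//.
    have ce l : cond_expect P (G l) (eta l j) (fun=> 0).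
      have := noise_sum_mart sys l (fun i => (i == j)%:R).
      apply: cond_expect_ext => // w.
      by rewrite (bigD1 j)//= eqxx mul1r big1 ?addr0// => i /negbTE ->; rewrite mul0r.
    have := weighted_noise_sqr (fun=> 1) 0 n (fun l => noise_adapted sys l j) ce
      (fun l w => noise_norm_le1 sys l j w).
    rewrite big_const_nat subn0 iter_addr addr0 expr1n.
    by under eq_Rintegral do under eq_bigr do rewrite mul1r.
  have le1 : E (fun w => `|empirical_rem j n w|) <=
      n%:R^-1 * (n%:R `^ 2^-1 + \sum_(0 <= l < n) x l).
    apply: (@le_trans _ _ (E (fun w => n%:R^-1 * (`|\sum_(0 <= l < n) eta l j w| +
        \sum_(0 <= l < n) `|succ_prob W r Z0 X l j w - M l w|)))).
      apply: expect_le => [| |w]; [exact: bmfun_norm (empirical_rem_bounded j n)| |].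
        by apply: bmfunZ; bmf.
      rewrite normrM ger0_norm ?invr_ge0// ler_wpM2l ?invr_ge0//.
      rewrite big_split/= (le_trans (ler_normD _ _))// lerD2l.
      exact: ler_norm_sum.
    rewrite expectZ; last by bmf.
    rewrite ler_wpM2l ?invr_ge0// expectD; [|by bmf..].
    by rewrite lerD// expect_sum.
  rewrite (le_trans (ler_wpM2l (powR_ge0 _ _) le1))//.
  rewrite -[X in X * (_ + _)]powR_inv1 ?(ltW nr)// mulrA powR_natD// mulrDr powR_natD//.
  by have -> : g - 2^-1 + -1 + 2^-1 = g - 1 by field.
- exact: cvg_cst.
- rewrite [X in _ --> X](_ : 0 = 0 + 0 / (1 - (g - 2^-1))); last by rewrite mul0r addr0.
  by apply: cvgD => //; apply: powR_nat_cvg0; rewrite subr_lt0.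
Unshelve. all: by end_near. Qed.

Definition mean_fluct n w := scale n * (M n w - Zinf w).
Definition noise_fluct n w := - (scale n * weighted_noise n w).
Definition limit_var w := Zinf w * (1 - Zinf w) * \sum_j p j ^+ 2.

Lemma mean_fluct_bounded n : bmfun (mean_fluct n).
Proof. by apply: bmfunZ; apply: bmfunB. Qed.

Lemma noise_fluct_bounded n : bmfun (noise_fluct n).
Proof.
apply: bmfunN; apply: bmfunZ; apply: bmfunZ.
by apply: bmfun_sum => l; apply: bmfunZ.
Qed.

Lemma limit_var_bounded : bmfun limit_var.
Proof.
by apply: bmfunM; [apply: bmfunM => //; apply: bmfunB|]; bmf.
Qed.

Lemma limit_var_ge0 w : 0 <= limit_var w.
Proof.
have /andP[z0 z1] := hZ.1 w; apply: mulr_ge0; first by rewrite mulr_ge0// subr_ge0.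
by apply: sumr_ge0 => j _; rewrite sqr_ge0.
Qed.

Section joint.
Variables (s t : R).

(* The coefficient of xi l in s * mean_fluct n + t * noise_fluct n, where the
   limit Zinf is replaced by the network mean at time n ^ 2. *)
Definition weight n l :=
  if (l < n)%N then - (t * scale n * n%:R^-1 * (l.+1%:R * r l)) else - (s * scale n * r l).

(** The function f is the identity for the row itself and the square for its variance. *)
Lemma weight_sum n (f : R -> R) (Y : nat -> R) : (0 < n)%N ->
  \sum_(l < n * n) f (weight n l) * Y l =
  \sum_(0 <= l < n) f (- (t * scale n * n%:R^-1 * (l.+1%:R * r l))) * Y l +
  \sum_(n <= l < n * n) f (- (s * scale n * r l)) * Y l.
Proof.
move=> n0; rewrite -(big_mkord predT (fun l => f (weight n l) * Y l)).
rewrite (big_cat_nat (n := n))//=; last by rewrite leq_pmulr.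
congr (_ + _); rewrite big_nat [RHS]big_nat; apply: eq_bigr => l /andP[l1 l2].
  by rewrite /weight l2.
by rewrite /weight ltnNge l1.
Qed.

Lemma weight_noise_sum n w : (0 < n)%N ->
  s * mean_fluct n w + t * noise_fluct n w =
  wsum xi (weight n) (n * n) w + s * (scale n * (M (n * n)%N w - Zinf w)).
Proof.
move=> n0; have -> := weight_sum id (xi ^~ w) n0 : wsum xi (weight n) (n * n) w = _.
rewrite /=.
have -> : M (n * n)%N w = M n w + \sum_(n <= l < n * n) r l * xi l w.
  by rewrite -(netmean_sub r Z0 X p_stat w (leq_pmulr n n0)) subrKC.
rewrite /mean_fluct /noise_fluct /weighted_noise.
have -> : \sum_(0 <= l < n) - (t * scale n * n%:R^-1 * (l.+1%:R * r l)) * xi l w =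
    - (t * scale n * n%:R^-1) * \sum_(0 <= l < n) l.+1%:R * r l * xi l w.
  by rewrite mulr_sumr; apply: eq_bigr => l _; ring.
have -> : \sum_(n <= l < n * n) - (s * scale n * r l) * xi l w =
    - (s * scale n) * \sum_(n <= l < n * n) r l * xi l w.
  by rewrite mulr_sumr; apply: eq_bigr => l _; ring.
by ring.
Qed.

(** Each index carries either s or t, so no term in s t appears: this is the asymptotic independence
    of the two fluctuations. *)
Lemma weight_var_cvg (Y : nat -> R) v : Y n @[n --> \oo] --> v ->
  \sum_(l < n * n) weight n l ^+ 2 * Y l @[n --> \oo] -->
  (s ^+ 2 * (c ^+ 2 / (2 * g - 1)) + t ^+ 2 * (c ^+ 2 / (3 - 2 * g))) * v.
Proof.
move=> Yv.
have H : s ^+ 2 * (n%:R `^ (2 * g - 1) * \sum_(n <= l < n * n) r l ^+ 2 * Y l) +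
    t ^+ 2 * (n%:R `^ (2 * g - 3) * \sum_(0 <= l < n) (l.+1%:R * r l) ^+ 2 * Y l) @[n --> \oo] -->
    s ^+ 2 * (c ^+ 2 * v / (2 * g - 1)) + t ^+ 2 * (c ^+ 2 * v / (3 - 2 * g)).
  apply: cvgD; apply: cvgM; [exact: cvg_cst|exact: tail_variance|exact: cvg_cst|].
  exact: head_variance.
rewrite [X in _ --> X](_ : _ = s ^+ 2 * (c ^+ 2 * v / (2 * g - 1)) +
  t ^+ 2 * (c ^+ 2 * v / (3 - 2 * g))); last by ring.
apply: cvg_trans H; apply: near_eq_cvg; near=> n.
have n0 : (0 < n)%N by near: n; exact: nbhs_infty_gt.
have nr : 0 < n%:R :> R by rewrite ltr0n.
rewrite (weight_sum (fun x => x ^+ 2) _ n0) addrC.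
have e1 : n%:R `^ (2 * g - 3) = (scale n * n%:R^-1) ^+ 2.
  rewrite exprMn powR_nat_sqr -[n%:R^-1]powR_inv1 ?(ltW nr)// powR_nat_sqr powR_natD//.
  by congr (_ `^ _); field.
have e2 : n%:R `^ (2 * g - 1) = scale n ^+ 2.
  by rewrite powR_nat_sqr; congr (_ `^ _); field.
rewrite e1 e2 !mulrA !mulr_sumr; congr (_ + _); apply: eq_bigr => l _; ring.
Unshelve. all: by end_near. Qed.

(** Both branches are largest near l = n: there (l + 1) r_l / n and r_l are O(n^(-g)), and the scale
    leaves n^(-1/2). *)
Lemma weight_bound : exists2 C, 0 <= C & forall n l, (l < n * n)%N ->
  `|weight n l| <= C * n%:R `^ (- 2^-1).
Proof.
have /andP[gl gh] := g01.
have [C C0 hC] := step_bound g01 hr r_ge0.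
exists ((`|s| + `|t|) * C); first by rewrite mulr_ge0// addr_ge0.
move=> n l ln.
have n0 : (0 < n)%N by case: n ln.
have nr : 0 < n%:R :> R by rewrite ltr0n.
have lr : 0 < l.+1%:R :> R by rewrite ltr0n.
rewrite /weight; case: ltnP => nl; rewrite normrN.
  rewrite !normrM !(ger0_norm (powR_ge0 _ _)) (@ger0_norm _ n%:R^-1) ?invr_ge0//.
  rewrite (ger0_norm (r_ge0 l)) (@ger0_norm _ l.+1%:R)//.
  apply: (@le_trans _ _ (`|t| * scale n * n%:R^-1 * (C * n%:R `^ (1 - g)))).
    rewrite ler_wpM2l//.
    rewrite (le_trans (ler_wpM2l (ltW lr) (hC l)))// mulrCA ler_wpM2l//.
    rewrite -{1}[l.+1%:R]powRr1 ?(ltW lr)// powR_natD//.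
    by rewrite ge0_ler_powR ?nnegrE ?(ltW lr) ?(ltW nr) ?ler_nat// subr_ge0 ltW.
  rewrite -[n%:R^-1]powR_inv1 ?(ltW nr)//.
  rewrite (_ : _ * (C * _) = `|t| * C * (scale n * n%:R `^ (-1) * n%:R `^ (1 - g))); last by ring.
  rewrite !powR_natD// (_ : g - 2^-1 + -1 + (1 - g) = - 2^-1); last by ring.
  by rewrite ler_wpM2r ?powR_ge0// ler_wpM2r// lerDr.
rewrite !normrM !(ger0_norm (powR_ge0 _ _)) (ger0_norm (r_ge0 l)).
apply: (@le_trans _ _ (`|s| * scale n * (C * n%:R `^ (- g)))).
  rewrite ler_wpM2l//.
  rewrite (le_trans (hC l))// ler_wpM2l// !powRN lef_pV2 ?posrE ?powR_gt0//.
  by rewrite ge0_ler_powR ?nnegrE ?(ltW lr) ?(ltW nr) ?ler_nat// ?(leqW nl)//; lra.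
rewrite (_ : _ * (C * _) = `|s| * C * (scale n * n%:R `^ (- g))); last by ring.
rewrite !powR_natD// (_ : g - 2^-1 + - g = - 2^-1); last by ring.
by rewrite ler_wpM2r ?powR_ge0// ler_wpM2r// lerDl.
Qed.

(** The scaled second moment is of order n^(2 g - 1) (n^2)^(1 - 2 g) = n^(1 - 2 g), whose square
    root tends to 0. *)
Lemma truncation_cvg0 :
  E (fun w => `|scale n * (M (n * n)%N w - Zinf w)|) @[n --> \oo] --> (0 : R).
Proof.
have /andP[gl gh] := g01.
have [C C0 [n1 _ hC]] := netmean_limit_sqr.
have mD n : bmfun (fun w => M n w - Zinf w) by apply: bmfunB.
have mD' n : bmfun (fun w => scale n * (M (n * n)%N w - Zinf w)) by exact: bmfunZ.
apply: (@squeeze_cvgr _ _ _ _ (fun=> 0) (fun n => Num.sqrt C * n%:R `^ (2^-1 - g))).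
- near=> n; apply/andP; split.
    rewrite -[leLHS](expect_cst P); apply: expect_le => //; first exact: bmfun_cst.
    exact: bmfun_norm.
  have n0 : (0 < n)%N by near: n; exact: nbhs_infty_gt.
  have nn : (n1 <= n * n)%N.
    by apply: (@leq_trans n); [near: n; exact: nbhs_infty_ge|rewrite leq_pmulr].
  rewrite (le_trans (expect_norm_sqrt _ (mD' n)))//.
  have -> : n%:R `^ (2^-1 - g) = Num.sqrt ((scale n) ^+ 2 * (n * n)%:R `^ (1 - 2 * g)) :> R.
    rewrite natrM powRM// powR_nat_sqr powR_natD// powR_natD//.
    by rewrite -powR12_sqrt ?powR_ge0// -powRrM; congr (_ `^ _); field.
  rewrite -sqrtrM// ler_wsqrtr//.
  under eq_Rintegral do rewrite exprMn.
  rewrite expectZ; last by have h := mD (n * n)%N; bmf.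
  by rewrite mulrCA ler_wpM2l ?sqr_ge0//; apply: hC.
- exact: cvg_cst.
- rewrite -[X in _ --> X](mulr0 (Num.sqrt C)); apply: cvgM; first exact: cvg_cst.
  by apply: powR_nat_cvg0; rewrite subr_lt0.
Unshelve. all: by end_near. Qed.

Theorem fluct_cos_cvg (th : R) (psi : T -> R) : bmfun psi ->
  E (fun w => psi w * cos (s * mean_fluct n w + t * noise_fluct n w + th)) @[n --> \oo] -->
  E (fun w => psi w * expR (- ((s ^+ 2 * (c ^+ 2 / (2 * g - 1)) +
    t ^+ 2 * (c ^+ 2 / (3 - 2 * g))) * limit_var w / 2))) * cos th.
Proof.
move=> mpsi; have /andP[gl gh] := g01.
pose kap := s ^+ 2 * (c ^+ 2 / (2 * g - 1)) + t ^+ 2 * (c ^+ 2 / (3 - 2 * g)).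
have kap0 : 0 <= kap.
  by apply: addr_ge0; apply: mulr_ge0; rewrite ?sqr_ge0//;
    apply: divr_ge0; rewrite ?sqr_ge0//; lra.
have [C C0 hC] := weight_bound.
(* The constant sequence 1 in [weight_var_cvg] bounds the sums of squared weights. *)
have [A hA] : exists A, forall n, \sum_(l < n * n) weight n l ^+ 2 <= A.
  have cvg1 : (fun=> 1 : R) n @[n --> \oo] --> (1 : R) by exact: cvg_cst.
  have H := weight_var_cvg cvg1.
  apply: (@near_bounded _ _ (kap * 1 + 1)).
  have : \forall n \near \oo, \sum_(l < n * n) weight n l ^+ 2 * 1 <= kap * 1 + 1.
    by have := H => /cvgr_le; apply; rewrite ltrDl.
  by apply: filterS => n; under eq_bigr do rewrite mulr1.
have V01 l w : 0 <= V l w <= 1 ^+ 2.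
  by rewrite expr1n; exact: (meanvar01 sys p_stat p_sum).
have clt := martingale_clt Gm (@sysgen_mono _ _ _ _ _ _ _) ler01
  (meannoise_le1 sys p_stat p_sum) V01 (meannoise_adapted p sys)
  (meannoise_mart p sys) (meannoise_var p sys)
  (a := weight) (m := fun n => (n * n)%N) (al := fun n => C * n%:R `^ (- 2^-1))
  (A := A) (th := th) (v := fun w => kap * limit_var w) (psi := psi).
have {}clt : E (fun w => psi w * cos (wsum xi (weight n) (n * n) w + th)) @[n --> \oo] -->
    E (fun w => psi w * expR (- (kap * limit_var w / 2))) * cos th.
  apply: clt => //.
  - by move=> n; rewrite mulr_ge0// powR_ge0.
  - rewrite -[X in _ --> X](mulr0 C); apply: cvgM; first exact: cvg_cst.
    by apply: powR_nat_cvg0; rewrite oppr_lt0 invr_gt0.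
  - move=> k; exists k => // n /= kn; case: k kn => // k kn.
    by rewrite (leq_trans kn)// leq_pmulr// (leq_trans _ kn).
  - by apply: bmfunZ; exact: limit_var_bounded.
  - by move=> w; rewrite mulr_ge0// limit_var_ge0.
  - by apply: filterS meanvar_cvg => w Vw; exact: (weight_var_cvg Vw).
have [B hB] : exists B, forall w, `|psi w| <= B by case: mpsi.
pose rest n w := scale n * (M (n * n)%N w - Zinf w).
have mrest n : bmfun (rest n) by apply: bmfunZ; apply: bmfunB.
have mwsum n : bmfun (wsum xi (weight n) (n * n)).
  by apply: bmfun_sum => l; apply: bmfunZ.
have mU := mean_fluct_bounded; have mV := noise_fluct_bounded.
pose D n := E (fun w => psi w * cos (s * mean_fluct n w + t * noise_fluct n w + th)) -
  E (fun w => psi w * cos (wsum xi (weight n) (n * n) w + th)).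
(* The cosine is 1-Lipschitz, so dropping the truncation remainder costs at most its L^1 norm. *)
have D0 : D n @[n --> \oo] --> (0 : R).
  apply: norm_cvg0; apply: (@squeeze_cvgr _ _ _ _ (fun=> 0)
    (fun n => B * `|s| * E (fun w => `|rest n w|))); last 2 first.
  - exact: cvg_cst.
  - rewrite -[X in _ --> X](mulr0 (B * `|s|)); apply: cvgM; first exact: cvg_cst.
    exact: truncation_cvg0.
  near=> n; rewrite normr_ge0/=.
  have n0 : (0 < n)%N by near: n; exact: nbhs_infty_gt.
  have m1 : bmfun (fun w => psi w * cos (s * mean_fluct n w + t * noise_fluct n w + th)).
    apply: bmfunM => //; apply: bmfun_cos; apply: bmfunD; last by bmf.
    by apply: bmfunD; apply: bmfunZ.
  have m2 : bmfun (fun w => psi w * cos (wsum xi (weight n) (n * n) w + th)).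
    by apply: bmfunM => //; apply: bmfun_cos; apply: bmfunD => //; bmf.
  rewrite /D -expectB// (le_trans (expect_norm _ (bmfunB m1 m2)))// -expectZ; last by bmf.
  apply: expect_le => [| |w]; [by bmf|by bmf|].
  rewrite -mulrBr normrM -mulrA ler_pM//.
  rewrite (le_trans (cos_lipschitz _ _))// (weight_noise_sum w n0).
  by rewrite -normrM le_eqVlt; apply/orP; left; apply/eqP; congr `|_|; rewrite /rest; ring.
rewrite (_ : (fun n => E (fun w => psi w * cos (s * mean_fluct n w + t * noise_fluct n w + th))) =
    (fun n => D n + E (fun w => psi w * cos (wsum xi (weight n) (n * n) w + th)))); last first.
  by apply/funext => n; rewrite /D subrK.
by rewrite -[X in _ --> X]add0r; exact: cvgD.
Unshelve. all: by end_near. Qed.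

End joint.

Lemma mean_fluct_sqr : exists A, forall n, E (fun w => mean_fluct n w ^+ 2) <= A.
Proof.
have [C C0 hC] := netmean_limit_sqr.
apply: (@near_bounded _ _ C); near=> n.
have n0 : (0 < n)%N by near: n; exact: nbhs_infty_gt.
have hn : E (fun w => (M n w - Zinf w) ^+ 2) <= C * n%:R `^ (1 - 2 * g) by near: n.
rewrite /mean_fluct; under eq_Rintegral do rewrite exprMn.
rewrite expectZ; last by bmf.
rewrite (le_trans (ler_wpM2l (sqr_ge0 _) hn))// powR_nat_sqr mulrCA powR_natD//.
by rewrite (_ : 2 * (g - 2^-1) + (1 - 2 * g) = 0) ?powRr0 ?mulr1//; field.
Unshelve. all: by end_near. Qed.

Lemma noise_fluct_sqr : exists A, forall n, E (fun w => noise_fluct n w ^+ 2) <= A.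
Proof.
have cvg1 : (fun=> 1 : R) n @[n --> \oo] --> (1 : R) by exact: cvg_cst.
have H := head_variance g01 hr cvg1.
apply: (@near_bounded _ _ (c ^+ 2 * 1 / (3 - 2 * g) + 1)).
have {}H : \forall n \near \oo, n%:R `^ (2 * g - 3) *
    \sum_(0 <= l < n) (l.+1%:R * r l) ^+ 2 * 1 <= c ^+ 2 * 1 / (3 - 2 * g) + 1.
  by have := H => /cvgr_le; apply; rewrite ltrDl.
near=> n.
have n0 : (0 < n)%N by near: n; exact: nbhs_infty_gt.
have nr : 0 < n%:R :> R by rewrite ltr0n.
have : n%:R `^ (2 * g - 3) * \sum_(0 <= l < n) (l.+1%:R * r l) ^+ 2 * 1 <=
  c ^+ 2 * 1 / (3 - 2 * g) + 1 by near: n.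
under eq_bigr do rewrite mulr1.
apply: le_trans.
have e1 : n%:R `^ (2 * g - 3) = (scale n * n%:R^-1) ^+ 2.
  rewrite exprMn powR_nat_sqr -[n%:R^-1]powR_inv1 ?(ltW nr)// powR_nat_sqr powR_natD//.
  by congr (_ `^ _); field.
have mS : bmfun (fun w => \sum_(0 <= l < n) l.+1%:R * r l * xi l w).
  by apply: bmfun_sum => l; apply: bmfunZ.
rewrite e1 /noise_fluct /weighted_noise.
under eq_Rintegral do rewrite sqrrN mulrA exprMn.
rewrite expectZ; last by bmf.
rewrite ler_wpM2l ?sqr_ge0//.
exact: (weighted_noise_sqr (fun l => l.+1%:R * r l) 0 n (meannoise_adapted p sys)
  (meannoise_mart p sys) (meannoise_le1 sys p_stat p_sum)).
Unshelve. all: by end_near. Qed.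

End fluctuations.

Theorem theorem3p2 (d : measure_display) (T : measurableType d) (R : realType)
    (P : probability T R) (N : nat) (W : 'M[R]_N) (r : nat -> R) (gamma c : R)
    (Z0 : 'I_N -> {RV P >-> R}) (X : nat -> 'I_N -> {RV P >-> R})
    (Zinf : {RV P >-> R}) (v1 : 'cV[R]_N)
    (hN : (1 <= N)%N)
    (hsys : interacting_system W r Z0 X)
    (hgamma : 2^-1 < gamma < 1) (hc : 0 < c)
    (hr : n%:R `^ gamma * r n @[n --> \oo] --> c)
    (hZinf : is_Zlimit r Z0 X Zinf)
    (hv1 : W *m v1 = v1)
    (hv1n : (Num.sqrt N%:R)^-1 * ((ones R N)^T *m v1) 0 0 = 1) :
  let sigma2_tilde := c ^+ 2 * euclidean_norm v1 ^+ 2 / (N%:R * (2 * gamma - 1)) in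
  let sigma2_hat := c ^+ 2 * euclidean_norm v1 ^+ 2 / (N%:R * (3 - 2 * gamma)) in
  let Sigma_tilde : 'M[R]_N := sigma2_tilde *: (ones R N *m (ones R N)^T) in
  let Gamma_hat : 'M[R]_N := sigma2_hat *: (ones R N *m (ones R N)^T) in
  [/\ 0 < sigma2_tilde, 0 < sigma2_hat &
    exists K : R.-pker T ~> borelV R (N + N),
      (forall w : T, is_gaussian (K w) 0
         ((Zinf w * (1 - Zinf w)) *:
            block_mx Sigma_tilde Sigma_tilde
                     Sigma_tilde (Sigma_tilde + Gamma_hat))) /\
      stable_cvg P
        (fun n w => n%:R `^ (gamma - 2^-1) *:
           col_mx (Zvec r Z0 X n w - Zinf w *: ones R N)
                  (Nvec X n w - Zinf w *: ones R N))
        K].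
Proof.
move=> sigma2_tilde sigma2_hat Sigma_tilde Gamma_hat.
have /andP[gl gh] := hgamma.
have N0 : 0 < N%:R :> R by rewrite ltr0n.
pose p h := (Num.sqrt N%:R)^-1 * v1 h 0.
have p_stat h : \sum_j W h j * p j = p h.
  rewrite /p -[in RHS]hv1 mxE mulr_sumr; apply: eq_bigr => j _; ring.
have p_sum : \sum_j p j = 1.
  move: hv1n; rewrite mxE mulr_sumr => <-; apply: eq_bigr => j _.
  by rewrite !mxE mul1r.
have v1sq : euclidean_norm v1 ^+ 2 = \sum_i v1 i 0 ^+ 2.
  by rewrite /euclidean_norm sqr_sqrtr//; apply: sumr_ge0 => i _; rewrite sqr_ge0.
have p_sqr : \sum_j p j ^+ 2 = euclidean_norm v1 ^+ 2 / N%:R.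
  rewrite v1sq mulrC mulr_sumr; apply: eq_bigr => j _.
  by rewrite /p exprMn exprVn sqr_sqrtr// ler0n.
have norm_gt0 : 0 < euclidean_norm v1 ^+ 2.
  rewrite lt_neqAle sqr_ge0 andbT eq_sym; apply/eqP => n0.
  move: p_sqr; rewrite n0 mul0r => /eqP; rewrite psumr_eq0; last by move=> j _; rewrite sqr_ge0.
  move=> /allP H; move: p_sum; rewrite big1 => [/esym/eqP|j _]; first by rewrite oner_eq0.
  by apply/eqP; rewrite -sqrf_eq0; exact: H (mem_index_enum j).
have tilde_gt0 : 0 < sigma2_tilde.
  by rewrite /sigma2_tilde divr_gt0// mulr_gt0// ?exprn_gt0//; lra.
have hat_gt0 : 0 < sigma2_hat.
  by rewrite /sigma2_hat divr_gt0// mulr_gt0// ?exprn_gt0//; lra.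
split=> //.
have Z01 w : 0 <= Zinf w * (1 - Zinf w).
  by have /andP[? ?] := hZinf.1 w; rewrite mulr_ge0// subr_ge0.
(* Random standard deviations of the two fluctuations; the factor |v1|^2 / N of their variances is
   the sum of the p_j^2, by [p_sqr]. *)
pose s1 w := Num.sqrt (sigma2_tilde * (Zinf w * (1 - Zinf w))).
pose s2 w := Num.sqrt (sigma2_hat * (Zinf w * (1 - Zinf w))).
have s1E w : s1 w ^+ 2 = sigma2_tilde * (Zinf w * (1 - Zinf w)).
  by rewrite sqr_sqrtr// mulr_ge0// ltW.
have s2E w : s2 w ^+ 2 = sigma2_hat * (Zinf w * (1 - Zinf w)).
  by rewrite sqr_sqrtr// mulr_ge0// ltW.
have mZZ : measurable_fun setT (fun w => Zinf w * (1 - Zinf w)).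
  by apply: measurable_funM => //; apply: measurable_funB.
have ms1 : measurable_fun setT s1.
  apply: measurableT_comp; last exact: measurable_funM.
  by apply: continuous_measurable_fun; exact: sqrt_continuous.
have ms2 : measurable_fun setT s2.
  apply: measurableT_comp; last exact: measurable_funM.
  by apply: continuous_measurable_fun; exact: sqrt_continuous.
(* The fluctuation of the network mean moves both blocks equally, the head noise only the empirical
   means: a a^T carries all four blocks of [Sigma_tilde], and b b^T the block [Gamma_hat]. *)
pose a : 'cV[R]_(N + N) := col_mx (ones R N) (ones R N).
pose b : 'cV[R]_(N + N) := col_mx 0 (ones R N).
pose scale n : R := n%:R `^ (gamma - 2^-1).
pose Y n w : 'cV[R]_(N + N) := scale n *:
  col_mx (Zvec r Z0 X n w - Zinf w *: ones R N) (Nvec X n w - Zinf w *: ones R N).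
pose M n := netmean r Z0 X p n.
have Ytop n w j : Y n w (lshift N j) 0 = scale n * (Zproc r Z0 X n j w - Zinf w).
  by rewrite /Y mxE col_mxEu !mxE mulr1.
have Ybot n w j : Y n w (rshift N j) 0 =
    scale n * (n%:R^-1 * \sum_(1 <= k < n.+1) X k j w - Zinf w).
  by rewrite /Y mxE col_mxEd !mxE mulr1.
have bZinf : bmfun (Zinf : T -> R).
  by split=> //; exists 1 => w; have /andP[? ?] := hZinf.1 w; rewrite ger0_norm.
have bZ n j : bmfun (Zproc r Z0 X n j).
  exact: (bmfun_sub (@sysgen_meas _ _ _ _ _ Z0 X n) (Zproc_adapted hsys n j)).
have bX n j : bmfun (X n.+1 j : T -> R).
  exact: (bmfun_sub (@sysgen_meas _ _ _ _ _ Z0 X n.+1) (X_adapted hsys n j)).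
have bM n : bmfun (M n) by exact: (netmean_bounded p hsys).
have bU := mean_fluct_bounded p gamma hsys hZinf.
have bV := noise_fluct_bounded p gamma hsys.
have bY n i : bmfun (fun w => Y n w i 0).
  case: (split_ordP i) => j ->.
    under eq_fun do rewrite Ytop.
    by apply: bmfunZ; apply: bmfunB.
  under eq_fun do rewrite Ybot big_add1.
  apply: bmfunZ; apply: bmfunB => //; apply: bmfunZ.
  by apply: bmfun_sum => k; exact: bX.
have bRem n j : bmfun (empirical_rem W r Z0 X p j n).
  exact: (empirical_rem_bounded p hsys).
pose U := mean_fluct r Z0 X p gamma Zinf; pose V := noise_fluct W r Z0 X p gamma.
have UV_cos psi s t th : bmfun psi ->
    \int[P]_w (psi w * cos (s * U n w + t * V n w + th)) @[n --> \oo] -->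
    \int[P]_w (psi w * expR (- (((s * s1 w) ^+ 2 + (t * s2 w) ^+ 2) / 2))) * cos th.
  move=> mpsi.
  suff -> : \int[P]_w (psi w * expR (- (((s * s1 w) ^+ 2 + (t * s2 w) ^+ 2) / 2))) =
    \int[P]_w (psi w * expR (- ((s ^+ 2 * (c ^+ 2 / (2 * gamma - 1)) +
      t ^+ 2 * (c ^+ 2 / (3 - 2 * gamma))) * limit_var p Zinf w / 2))).
    exact: (@fluct_cos_cvg _ _ _ _ _ _ _ _ _ _ _ _ _ hsys p_stat p_sum hgamma hr hZinf s t th _ mpsi).
  apply: eq_Rintegral => w _; congr (_ * expR (- (_ / 2))).
  rewrite !exprMn s1E s2E /limit_var p_sqr /sigma2_tilde /sigma2_hat.
  have n1 : 2 * gamma - 1 != 0 by apply: lt0r_neq0; lra.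
  have n2 : 3 - 2 * gamma != 0 by apply: lt0r_neq0; lra.
  by field; rewrite (lt0r_neq0 N0) n1 n2.
have Y_rem i : \int[P]_w `|Y n w i 0 - (U n w * a i 0 + V n w * b i 0)| @[n --> \oo] --> (0 : R).
  case: (split_ordP i) => j ->.
    rewrite (_ : (fun n => _) = (fun n => scale n * \int[P]_w `|Zproc r Z0 X n j w - M n w|)).
      exact: (Zproc_rem_cvg0 hsys p_stat p_sum hgamma hc hr).
    apply/funext => n; rewrite -expectZ; last by apply: bmfun_norm; apply: bmfunB.
    apply: eq_Rintegral => w _; rewrite Ytop !col_mxEu !mxE mulr1 mulr0 addr0 /U /mean_fluct.
    by rewrite -mulrBr opprB addrA subrK normrM ger0_norm ?powR_ge0.
  (* The decomposition of the empirical mean divides by n, so the two sequences agree only for n >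
     0. *)
  apply: cvg_trans (empirical_rem_cvg0 hsys p_stat p_sum hgamma hc hr j); apply: near_eq_cvg; near=> n.
  have n0 : (0 < n)%N by near: n; exact: nbhs_infty_gt.
  rewrite -expectZ; last by apply: bmfun_norm.
  apply: eq_Rintegral => w _; rewrite Ybot !col_mxEd !mxE !mulr1.
  rewrite (empirical_decomposition r Z0 X p_stat j w n0) /U /V /mean_fluct /noise_fluct.
  rewrite -[X in X * _]ger0_norm ?powR_ge0// -normrM; congr `|_|.
  by rewrite /scale -/(M n); ring.
have [K [gK sK]] := stable_gaussian_limit ms1 ms2 bU bV bY UV_cos
  (mean_fluct_sqr hsys p_stat p_sum hgamma hr hZinf)
  (noise_fluct_sqr hsys p_stat p_sum hgamma hr) Y_rem.
exists K; split=> [w|]; last exact: sK.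
suff -> : (Zinf w * (1 - Zinf w)) *: block_mx Sigma_tilde Sigma_tilde
    Sigma_tilde (Sigma_tilde + Gamma_hat) =
    s1 w ^+ 2 *: (a *m a^T) + s2 w ^+ 2 *: (b *m b^T) by exact: gK.
rewrite s1E s2E /a /b !tr_col_mx !mul_col_row trmx0 !mul0mx !mulmx0.
have swap (x y : R) (A : 'M[R]_(N + N)) : (x * y) *: A = y *: (x *: A).
  by rewrite scalerA mulrC.
rewrite (swap sigma2_tilde) (swap sigma2_hat) -scalerDr; congr (_ *: _).
by rewrite !scale_block_mx !scaler0 add_block_mx !addr0.
Unshelve. all: by end_near. Qed.
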